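(* Let $\mathfrak g=\mathrm{gl}(m,\Gamma)$ with $\Gamma$ finite, let $\chi\in\mathfrak g_{\bar0}^*$ be standard semisimple, let $\delta_1,\dots,\delta_N$ be an ordering of $\Phi^+$ such that $(\mathfrak g,H,(\delta_i)_{i=1}^N)$ is an FP triple, and let $\lambda\in H^*$ be the weight of a one-dimensional $u_\chi(B)$-module $\mathbf Fv$ with $N^+v=0$, $hv=\lambda(h)v$ for all $h\in H$. Then the baby Verma module $Z^\chi(\lambda)=u_\chi(\mathfrak g)\otimes_{u_\chi(B)}\mathbf Fv$ is simple if and only if $f(\lambda)\ne0$.
   Context: $\mathbf F$ is an algebraically closed field of characteristic $p>3$. $\Gamma$ is a finite abelian group with a bicharacter $(,):\Gamma\times\Gamma\to\mathbf F^\times$: $(\alpha,\beta)(\beta,\alpha)=1$, multiplicative in each argument; $\Gamma^\pm=\{\gamma:(\gamma,\gamma)=\pm1\}$. $V=\oplus_{\alpha\in\Gamma}V_\alpha$ is a $\Gamma$-graded space of finite dimension $m$, and $\mathrm{gl}(m,\Gamma)=\mathrm{gl}(V)=\oplus_\alpha\mathrm{gl}(V)_\alpha$ ($\mathrm{gl}(V)_\alpha$ = linear maps of degree $\alpha$) is the general linear Lie color algebra, with $[f,g]=fg-(\alpha,\beta)gf$ for $f,g$ of degrees $\alpha,\beta$ and $x^{[p]}=x^p$ for $x$ homogeneous of degree in $\Gamma^+$. Fix an ordering of $\Gamma$ and a homogeneous basis $v_1,\dots,v_m$ of $V$ ordered compatibly with it; $e_{ij}$ are the matrix units, $e_{ij}$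 having degree $\deg v_i-\deg v_j$. $H=\sum_i\mathbf Fe_{ii}$, $\Phi=\{\varepsilon_i-\varepsilon_j:i\ne j\}$, $\mathfrak g_{\varepsilon_i-\varepsilon_j}=\mathbf Fe_{ij}$, $\Phi^+=\{\varepsilon_i-\varepsilon_j:i<j\}$, $N^\pm=\oplus_{\delta\in\pm\Phi^+}\mathfrak g_\delta$, $B=H\oplus N^+$. For $\delta=\varepsilon_i-\varepsilon_j\in\Phi^+$: $e_\delta=e_{ij}$, $f_\delta=e_{ji}$; $\bar p$ attached to $\delta$ is $p$ if $\deg e_{ij}\in\Gamma^+$ and $2$ if $\deg e_{ij}\in\Gamma^-$. $\chi\in\mathfrak g_{\bar0}^*$ is regarded as a linear function on $\mathfrak g$ vanishing on $\mathfrak g_\alpha$, $\alpha\neq\bar0$; it is standard semisimple if $\chi(N^\pm)=0$. $u_\chi(\mathfrak g)$ is the quotient of the universal enveloping algebra $U(\mathfrak g)$ (tensor algebra modulo $x\otimes y-(\alpha,\beta)y\otimes x-[x,y]$) by the ideal generated by $x^p-x^{[p]}-\chi(x)^p$, $x\in\mathfrak g_\alpha$, $\alpha\in\Gamma^+$; similarly for restricted subalgebras. The condition on $\lambda$ is $\lambda(e_{ii})^p-\lambda(e_{ii})=\chi(e_{ii})^p$ for all $i$. Modules are $\Gamma$-graded; simple means no nontrivial $\Gamma$-graded submodules. $(\mathfrak g,H,(\delta_i)_{i=1}^N)$ is an FP triple if $\{\delta_1,\dots,\delta_N\}=\Phi^+$ and for each $1\le i\le N$ the set $\{-\delta_1,\dots,-\delta_{i-1},\delta_i,\dots,\delta_N\}$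 is a system of positive roots in which $\delta_i$ is simple and $\{-\delta_1,\dots,-\delta_i\}$ is additive (contains every root that is a sum of two of its elements). Such orderings exist. $\gamma$ is the projection of $u_\chi(\mathfrak g)=u_\chi(H)\oplus(N^-u_\chi(\mathfrak g)+u_\chi(\mathfrak g)N^+)$ onto $u_\chi(H)$ (Harish-Chandra homomorphism, used on the zero weight part). $f(h)=\gamma\big(e_{\delta_1}^{\bar p-1}\cdots e_{\delta_N}^{\bar p-1}f_{\delta_1}^{\bar p-1}\cdots f_{\delta_N}^{\bar p-1}\big)\in u_\chi(H)$, and $f(\lambda)\in\mathbf F$ is the image of $f(h)$ under the algebra homomorphism $u_\chi(H)\to\mathbf F$ induced by $\lambda$. *)

(* Defs.v *)
From HB Require Import structures.
From mathcomp Require Import all_boot all_order all_algebra.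
From mathcomp Require Import finmap boolp classical_sets.
From mathcomp.multinomials Require Import monalg.

Set Implicit Arguments.
Unset Strict Implicit.
Unset Printing Implicit Defensive.

Import GRing.Theory.
Local Open Scope ring_scope.
Local Open Scope quotient_scope.

Inductive zspan (V : zmodType) (P : V -> Prop) : V -> Prop :=
| zspan_gen x of P x : zspan P x
| zspan0 : zspan P 0
| zspanB x y of zspan P x & zspan P y : zspan P (x - y).

Section SpanPred.
Variables (V : zmodType) (P : V -> Prop).

Definition zspan_pred : {pred V} := [pred x | `[< zspan P x >]].

Lemma zspan_closed : zmod_closed zspan_pred.
Proof.
split; first by apply/asboolP; exact: zspan0.
by move=> x y /asboolP Px /asboolP Py; apply/asboolP; exact: zspanB.
Qed.

HB.instance Definition _ := GRing.isZmodClosed.Build V zspan_pred zspan_closed.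

End SpanPred.

(* Quotient of a K-algebra by the two-sided ideal generated by P; it may be
   the zero ring, hence pzRingType. *)
Section IdealQuotient.
Variables (K : nzRingType) (A : lalgType K) (P : A -> Prop).

Definition ideal_elt (x : A) := exists a r b, P r /\ x = a * r * b.

Definition ideal_quot : Type := Quotient.quot (zspan_pred ideal_elt).

HB.instance Definition _ := GRing.Zmodule.on ideal_quot.
HB.instance Definition _ := EqQuotient.on ideal_quot.

Lemma ideal_quotE (x y : A) :
  (x == y %[mod ideal_quot]) = (x - y \in zspan_pred ideal_elt).
Proof. by rewrite -Quotient.idealrBE. Qed.

Lemma ideal_mull a x : x \in zspan_pred ideal_elt -> a * x \in zspan_pred ideal_elt.
Proof.
move=> /asboolP Hx; apply/asboolP; elim: Hx => [y [c [r [b [Pr ->]]]]||y z _ IHy _ IHz].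
- by apply: zspan_gen; exists (a * c), r, b; rewrite !mulrA.
- by rewrite mulr0; exact: zspan0.
- by rewrite mulrBr; exact: zspanB.
Qed.

Lemma ideal_mulr a x : x \in zspan_pred ideal_elt -> x * a \in zspan_pred ideal_elt.
Proof.
move=> /asboolP Hx; apply/asboolP; elim: Hx => [y [c [r [b [Pr ->]]]]||y z _ IHy _ IHz].
- by apply: zspan_gen; exists c, r, (b * a); rewrite !mulrA.
- by rewrite mul0r; exact: zspan0.
- by rewrite mulrBl; exact: zspanB.
Qed.

Definition iq_one : ideal_quot := \pi_ideal_quot 1.
Definition iq_mul (x y : ideal_quot) : ideal_quot := \pi_ideal_quot (repr x * repr y).
Definition iq_scale (c : K) (x : ideal_quot) : ideal_quot := \pi_ideal_quot (c *: repr x).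

Lemma repr_pi_ideal x : repr (\pi_ideal_quot x) - x \in zspan_pred ideal_elt.
Proof. by rewrite -ideal_quotE reprK. Qed.

Lemma iq_pi_mul x y : \pi_ideal_quot (x * y) = iq_mul (\pi x) (\pi y).
Proof.
apply/esym/eqP; rewrite ideal_quotE.
set x' := repr _; set y' := repr _.
have -> : x' * y' - x * y = x' * (y' - y) + (x' - x) * y.
  by rewrite mulrBr mulrBl addrA addrNK.
by apply: rpredD; [apply: ideal_mull|apply: ideal_mulr]; exact: repr_pi_ideal.
Qed.

Lemma iq_pi_scale c x : \pi_ideal_quot (c *: x) = iq_scale c (\pi x).
Proof.
apply/esym/eqP; rewrite ideal_quotE -scalerBr -[_ - x]mul1r scalerAl.
by apply: ideal_mull; exact: repr_pi_ideal.
Qed.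

Lemma iq_pi_add (x y : A) : \pi_ideal_quot (x + y) = \pi x + \pi y.
Proof. by rewrite piE. Qed.

Lemma iq_mulA : associative iq_mul.
Proof.
elim/quotW=> x; elim/quotW=> y; elim/quotW=> z.
by rewrite -(iq_pi_mul y z) -(iq_pi_mul x y) -(iq_pi_mul x) -iq_pi_mul mulrA.
Qed.

Lemma iq_mul1 : left_id iq_one iq_mul.
Proof. by elim/quotW=> x; rewrite -(iq_pi_mul 1 x) mul1r. Qed.

Lemma iq_mulr1 : right_id iq_one iq_mul.
Proof. by elim/quotW=> x; rewrite -(iq_pi_mul x 1) mulr1. Qed.

Lemma iq_mulDl : left_distributive iq_mul +%R.
Proof.
elim/quotW=> x; elim/quotW=> y; elim/quotW=> z.
by rewrite -(iq_pi_add x y) -(iq_pi_mul x z) -(iq_pi_mul y z) -(iq_pi_mul (x + y))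
  mulrDl iq_pi_add.
Qed.

Lemma iq_mulDr : right_distributive iq_mul +%R.
Proof.
elim/quotW=> x; elim/quotW=> y; elim/quotW=> z.
by rewrite -(iq_pi_add y z) -(iq_pi_mul x y) -(iq_pi_mul x z) -(iq_pi_mul x (y + z))
  mulrDr iq_pi_add.
Qed.

HB.instance Definition _ := GRing.Zmodule_isPzRing.Build ideal_quot
  iq_mulA iq_mul1 iq_mulr1 iq_mulDl iq_mulDr.

Lemma iq_scaleA a b x : iq_scale a (iq_scale b x) = iq_scale (a * b) x.
Proof. by elim/quotW: x => x; rewrite -(iq_pi_scale b x) -(iq_pi_scale a) -iq_pi_scale scalerA. Qed.

Lemma iq_scale1 : left_id 1 iq_scale.
Proof. by elim/quotW=> x; rewrite -(iq_pi_scale 1 x) scale1r. Qed.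

Lemma iq_scaleDr : right_distributive iq_scale +%R.
Proof.
move=> a; elim/quotW=> x; elim/quotW=> y.
by rewrite -(iq_pi_add x y) -!iq_pi_scale scalerDr iq_pi_add.
Qed.

Lemma iq_scaleDl x : {morph iq_scale^~ x : a b / a + b}.
Proof.
by move=> a b; elim/quotW: x => x; rewrite -!iq_pi_scale scalerDl iq_pi_add.
Qed.

HB.instance Definition _ := GRing.Zmodule_isLmodule.Build K ideal_quot
  iq_scaleA iq_scale1 iq_scaleDr iq_scaleDl.

End IdealQuotient.

(* A (x)_B W, for A viewed as a right B-module through phi : B -> A. *)
Section ExtensionOfScalars.
Variables (A B : pzRingType) (phi : B -> A) (W : lmodType B).

Inductive tensor_rel : {malg int[(A * W)%type]} -> Prop :=
| tensor_addl a a' w :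
    tensor_rel (<< (a + a', w) >> - << (a, w) >> - << (a', w) >>)
| tensor_addr a w w' :
    tensor_rel (<< (a, w + w') >> - << (a, w) >> - << (a, w') >>)
| tensor_bal a b w :
    tensor_rel (<< (a * phi b, w) >> - << (a, b *: w) >>).

Definition tensor : Type := Quotient.quot (zspan_pred tensor_rel).

HB.instance Definition _ := GRing.Zmodule.on tensor.
HB.instance Definition _ := EqQuotient.on tensor.

Definition tens (a : A) (w : W) : tensor := \pi_tensor << (a, w) >>.

Definition free_act (a : A) (t : {malg int[(A * W)%type]}) : {malg int[(A * W)%type]} :=
  \sum_(k <- msupp t) << t@_k *g (a * k.1, k.2) >>.

Lemma free_actEw a (d : {fset (A * W)%type}) t : (msupp t `<=` d)%fset ->
  free_act a t = \sum_(k <- d) << t@_k *g (a * k.1, k.2) >>.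
Proof.
move=> le; rewrite /free_act (big_fset_incl _ le) //= => x _ /mcoeff_outdom ->.
by rewrite raddf0.
Qed.

Lemma free_actB a : {morph free_act a : x y / x - y}.
Proof.
move=> x y; rewrite !(@free_actEw a (msupp x `|` msupp y)%fset).
- by rewrite -sumrB; apply: eq_bigr => k _; rewrite mcoeffB raddfB.
- exact: fsubsetUr.
- exact: fsubsetUl.
- exact: msuppB_le.
Qed.

HB.instance Definition _ a := GRing.isZmodMorphism.Build
  {malg int[(A * W)%type]} {malg int[(A * W)%type]} (free_act a) (@free_actB a).

Lemma free_actU a n k : free_act a << n *g k >> = << n *g (a * k.1, k.2) >>.
Proof. by rewrite (free_actEw a msuppU_le) big_seq_fset1 mcoeffUU. Qed.

Lemma free_act_rel a x :
  x \in zspan_pred tensor_rel -> free_act a x \in zspan_pred tensor_rel.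
Proof.
move=> /asboolP Hx; apply/asboolP; elim: Hx => [y Hy||y z _ IHy _ IHz].
- apply: zspan_gen; case: Hy => [b b' w|b w w'|b c w].
  + by rewrite !raddfB /= !free_actU /= mulrDr; exact: tensor_addl.
  + by rewrite !raddfB /= !free_actU /=; exact: tensor_addr.
  + by rewrite !raddfB /= !free_actU /= mulrA; exact: tensor_bal.
- by rewrite raddf0; exact: zspan0.
- by rewrite raddfB; exact: zspanB.
Qed.

Definition tensor_scale (a : A) (z : tensor) : tensor := \pi_tensor (free_act a (repr z)).

Lemma tensorE (x y : {malg int[(A * W)%type]}) :
  (x == y %[mod tensor]) = (x - y \in zspan_pred tensor_rel).
Proof. by rewrite -Quotient.idealrBE. Qed.

Lemma tensor_pi_add (x y : {malg int[(A * W)%type]}) :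
  \pi_tensor (x + y) = \pi x + \pi y.
Proof. by rewrite piE. Qed.

Lemma tensor_pi_scale a x : \pi_tensor (free_act a x) = tensor_scale a (\pi x).
Proof.
apply/esym/eqP; rewrite tensorE -raddfB free_act_rel //.
by rewrite -tensorE reprK.
Qed.

Lemma tens_scale a b w : tensor_scale a (tens b w) = tens (a * b) w.
Proof. by rewrite /tens -tensor_pi_scale free_actU. Qed.

Lemma tens_addl a b w : tens (a + b) w = tens a w + tens b w.
Proof.
rewrite /tens -tensor_pi_add; apply/eqP; rewrite tensorE opprD addrA.
by apply/asboolP; apply: zspan_gen; exact: tensor_addl.
Qed.

Lemma tensor_ind (Q : tensor -> Prop) :
  (forall a w, Q (tens a w)) -> Q 0 -> (forall x y, Q x -> Q y -> Q (x - y)) ->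
  forall z, Q z.
Proof.
move=> Qt Q0 QB z; rewrite -[z]reprK.
have pi0 : \pi_tensor 0 = 0 by rewrite piE.
have piB x y : \pi_tensor (x - y) = \pi x - \pi y by rewrite !piE.
have QD x y : Q x -> Q y -> Q (x + y).
  by move=> Qx Qy; rewrite -[y]opprK; apply: (QB) => //; rewrite -sub0r; exact: QB.
have QU n k : Q (\pi << n *g k >>).
  have Qn n' : Q (\pi << Posz n' *g k >>).
    elim: n' => [|n' IH]; first by rewrite raddf0 pi0.
    by rewrite intS raddfD /= tensor_pi_add; apply: (QD) => //; case: (k) => a w; exact: Qt.
  case: n => n; first exact: Qn.
  by rewrite NegzE raddfN -sub0r piB pi0; apply: (QB) => //; exact: Qn.
rewrite (monalgE (repr z)); elim/big_ind: _ => [|x y Qx Qy|k _] //.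
- by rewrite pi0.
- by rewrite tensor_pi_add; exact: QD.
Qed.

Lemma tensor_scaleDr : right_distributive tensor_scale +%R.
Proof.
move=> a; elim/quotW=> x; elim/quotW=> y.
by rewrite -(tensor_pi_add x y) -!tensor_pi_scale raddfD /= tensor_pi_add.
Qed.

Lemma tensor_scaleBr a x y :
  tensor_scale a (x - y) = tensor_scale a x - tensor_scale a y.
Proof.
by apply/eqP; rewrite eq_sym subr_eq -tensor_scaleDr subrK.
Qed.

Lemma tensor_scale0 a : tensor_scale a 0 = 0.
Proof. by rewrite -[X in tensor_scale a X](subrr 0) tensor_scaleBr subrr. Qed.

Lemma tensor_scaleA a b z :
  tensor_scale a (tensor_scale b z) = tensor_scale (a * b) z.
Proof.
elim/tensor_ind: z => [c w||x y IHx IHy]; first by rewrite !tens_scale mulrA.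
- by rewrite !tensor_scale0.
- by rewrite !tensor_scaleBr IHx IHy.
Qed.

Lemma tensor_scale1 : left_id 1 tensor_scale.
Proof.
elim/tensor_ind => [c w||x y IHx IHy]; first by rewrite tens_scale mul1r.
- by rewrite tensor_scale0.
- by rewrite tensor_scaleBr IHx IHy.
Qed.

Lemma tensor_scaleDl z : {morph tensor_scale^~ z : a b / a + b}.
Proof.
move=> a b; elim/tensor_ind: z => [c w||x y IHx IHy] /=.
- by rewrite !tens_scale mulrDl tens_addl.
- by rewrite !tensor_scale0 addr0.
- by rewrite !tensor_scaleBr IHx IHy opprD addrACA.
Qed.

HB.instance Definition _ := GRing.Zmodule_isLmodule.Build A tensor
  tensor_scaleA tensor_scale1 tensor_scaleDr tensor_scaleDl.

End ExtensionOfScalars.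

Section GradedModules.
Variables (G : finZmodType) (A : pzRingType) (Z : lmodType A).
Variable gr : G -> Z -> Prop.

Definition graded_submodule (M : Z -> Prop) : Prop :=
  [/\ M 0, forall x y, M x -> M y -> M (x + y), forall a x, M x -> M (a *: x)
    & forall x, M x -> exists c : G -> Z,
        (forall g, gr g (c g) /\ M (c g)) /\ x = \sum_g c g].

Definition graded_simple : Prop :=
  (exists z : Z, z <> 0) /\
  forall M, graded_submodule M -> (forall x, M x -> x = 0) \/ (forall x, M x).

End GradedModules.

Definition bicharacter (F : fieldType) (G : finZmodType) (bc : G -> G -> F) : Prop :=
  [/\ forall a b, bc a b * bc b a = 1,
      forall a b c, bc (a + b) c = bc a c * bc b c
    & forall a b c, bc a (b + c) = bc a b * bc a c].

(* The root eps_i - eps_j is encoded by the pair (i, j), i <> j. *)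
Section Roots.
Variables (F : fieldType) (m : nat).
Local Notation idx := ('I_m * 'I_m)%type.

(* eps_i - eps_j in coordinates on H^*, dual to the basis (e_ii) of H. *)
Definition root_vec (x : idx) : 'rV[F]_m := delta_mx 0 x.1 - delta_mx 0 x.2.

Definition opp_root (x : idx) : idx := (x.2, x.1).

Definition roots_gl : {set idx} := [set x | x.1 != x.2].

Definition pos_roots : {set idx} := [set x : idx | (x.1 < x.2)%N].

Definition additive_roots (P : {set idx}) : Prop :=
  forall x y z, x \in P -> y \in P -> z \in roots_gl ->
    root_vec z = root_vec x + root_vec y -> z \in P.

(* A system of positive roots, characterised inside Phi since H^* over F carries
   no ordering: an additive P with Phi the disjoint union of P and -P. *)
Definition pos_system (P : {set idx}) : Prop :=
  [/\ P \subset roots_gl,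
      forall x, x \in roots_gl -> (x \in P) (+) (opp_root x \in P)
    & additive_roots P].

Definition simple_in (P : {set idx}) (x : idx) : Prop :=
  x \in P /\ forall y z, y \in P -> z \in P -> root_vec x <> root_vec y + root_vec z.

Definition fp_triple (delta : seq idx) : Prop :=
  [/\ uniq delta, [set x in delta] = pos_roots
    & forall s d t, delta = s ++ d :: t ->
        let P := [set opp_root x | x in s] :|: [set x in d :: t] in
        [/\ pos_system P, simple_in P d
          & additive_roots [set opp_root x | x in rcons s d]]].

End Roots.

(* gl(m, Gamma) is 'M[F]_m, acting on columns, where the i-th basis vector of V
   has degree deg i. *)
Section ColorGl.
Variables (F : fieldType) (G : finZmodType) (m : nat).
Variables (bc : G -> G -> F) (deg : 'I_m -> G) (p : nat).
Variable chi : {scalar 'M[F]_m}.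
Local Notation idx := ('I_m * 'I_m)%type.

Definition mx_homog (a : G) (x : 'M[F]_m) : Prop :=
  forall i j, x i j != 0 -> deg i - deg j = a.

Definition color_bracket (a b : G) (x y : 'M[F]_m) : 'M[F]_m :=
  x *m y - bc a b *: (y *m x).

Definition nplus (x : 'M[F]_m) : Prop := forall i j, x i j != 0 -> (i < j)%N.
Definition nminus (x : 'M[F]_m) : Prop := forall i j, x i j != 0 -> (j < i)%N.

Definition standard_semisimple : Prop :=
  (forall a x, a != 0 -> mx_homog a x -> chi x = 0) /\
  (forall x, nplus x \/ nminus x -> chi x = 0).

Definition pbar (d : idx) : nat :=
  if bc (deg d.1 - deg d.2) (deg d.1 - deg d.2) == 1 then p else 2.

(* For a set S of pairs spanning a restricted subalgebra L = (+)_(S) F e_ij,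
   the tensor algebra of L is the free algebra on the basis e_ij, (i,j) in S. *)
Definition unit_idx (S : {set idx}) : Type := {x : idx | x \in S}.
HB.instance Definition _ S := Finite.on (unit_idx S).

Definition tensor_alg (S : {set idx}) : Type := {malg F[{fmonom unit_idx S}]}.
HB.instance Definition _ S := GRing.Lalgebra.on (tensor_alg S).

Definition in_sub (S : {set idx}) (x : 'M[F]_m) : Prop :=
  forall i j, x i j != 0 -> (i, j) \in S.

Definition iotaT (S : {set idx}) (x : 'M[F]_m) : tensor_alg S :=
  \sum_(k : unit_idx S) x (val k).1 (val k).2 *: << fmu k >>.

Inductive uchi_rel (S : {set idx}) : tensor_alg S -> Prop :=
| uchi_bracket a b x y of in_sub S x & in_sub S y & mx_homog a x & mx_homog b y :
    uchi_rel (iotaT S x * iotaT S y - bc a b *: (iotaT S y * iotaT S x)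
              - iotaT S (color_bracket a b x y))
| uchi_pth a x of in_sub S x & mx_homog a x & bc a a = 1 :
    uchi_rel (iotaT S x ^+ p - iotaT S (x ^+ p) - (chi x ^+ p)%:A).

Definition uchi (S : {set idx}) : Type := ideal_quot (@uchi_rel S).
HB.instance Definition _ S := GRing.PzRing.on (uchi S).
HB.instance Definition _ S := GRing.Lmodule.on (uchi S).
HB.instance Definition _ S := EqQuotient.on (uchi S).

Definition iota (S : {set idx}) (x : 'M[F]_m) : uchi S := \pi_(uchi S) (iotaT S x).

Definition gS : {set idx} := [set: idx]%SET.
Definition bS : {set idx} := [set x : idx | (x.1 <= x.2)%N].
Definition hS : {set idx} := [set x : idx | x.1 == x.2].

Definition free_mor (S : {set idx}) (A : nzRingType) (f : F -> A)
    (g : idx -> A) (t : tensor_alg S) : A :=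
  mmap f (fun w : {fmonom unit_idx S} => \prod_(k <- w) g (val k)) t.

(* The algebra homomorphism u_chi(S) -> u_chi(T) induced by S \subset T. *)
Definition uchi_incl (S T : {set idx}) (x : uchi S) : uchi T :=
  \pi_(uchi T) (free_mor (fun c => c%:A : tensor_alg T)
        (fun k => iotaT T (delta_mx k.1 k.2)) (repr x)).

(* The algebra homomorphism u_chi(H) -> F induced by lam; it does not depend on
   the representative when lam(e_ii)^p - lam(e_ii) = chi(e_ii)^p for all i. *)
Definition weight_eval (lam : {scalar 'rV[F]_m}) (x : uchi hS) : F :=
  free_mor idfun (fun k => lam (delta_mx 0 k.1)) (repr x).

Definition word_deg (S : {set idx}) (w : {fmonom unit_idx S}) : G :=
  \sum_(k <- w) (deg (val k).1 - deg (val k).2).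

Definition uchi_homog (S : {set idx}) (a : G) (x : uchi S) : Prop :=
  exists t : tensor_alg S, (forall w, w \in msupp t -> word_deg w = a) /\ x = \pi_(uchi S) t.

Definition nil_elt (x : uchi gS) : Prop :=
  (exists n y, nminus n /\ x = iota gS n * y) \/
  (exists y n, nplus n /\ x = y * iota gS n).

(* Projection of u_chi(g) = u_chi(H) (+) (N^- u_chi(g) + u_chi(g) N^+) onto
   its first summand. *)
Definition harish_chandra (x : uchi gS) : uchi hS :=
  xget 0 [set h | zspan nil_elt (x - uchi_incl gS h)]%classic.

Definition f_elt (delta : seq idx) : uchi hS :=
  harish_chandra
    (\prod_(d <- delta) iota gS (delta_mx d.1 d.2) ^+ (pbar d).-1 *
     \prod_(d <- delta) iota gS (delta_mx d.2 d.1) ^+ (pbar d).-1).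

(* h in H is diag_mx of its coordinates in the basis (e_ii). *)
Definition weight_line (lam : {scalar 'rV[F]_m}) (W : lmodType (uchi bS)) (v : W)
    : Prop :=
  [/\ v <> 0, forall w : W, exists c : F, w = (c *: (1 : uchi bS)) *: v,
      forall n, nplus n -> iota bS n *: v = 0
    & forall h, iota bS (diag_mx h) *: v = (lam h *: (1 : uchi bS)) *: v].

Definition baby_verma (W : lmodType (uchi bS)) : Type :=
  tensor (@uchi_incl bS gS) W.
HB.instance Definition _ W := GRing.Lmodule.on (baby_verma W).

(* The line W sits in degree d. *)
Definition baby_verma_gr (W : lmodType (uchi bS)) (d a : G) :
    baby_verma W -> Prop :=
  zspan (fun z => exists x w, uchi_homog (a - d) x /\
                              z = tens (@uchi_incl bS gS) x w).

End ColorGl.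

(* Main.v *)
Require Import Defs.
From HB Require Import structures.
From mathcomp Require Import all_boot all_order all_algebra.
From mathcomp Require Import finmap boolp classical_sets zify ring.
From mathcomp.multinomials Require Import monalg.

(* Only one property of the ordering delta_1, ..., delta_N is needed: it lists every
   positive root exactly once.  Write e and f for the products of the powers
   e_delta^(pbar - 1) and f_delta^(pbar - 1), and Z for the baby Verma module.

   Reordering products of the e_ij in u_chi(g) preserves the height (e_ij has height
   j - i) up to shorter products, and e, f have the extreme heights.  Hence f v spans
   the lowest height of Z, N^- kills f v, and e f v = f(lambda) v by definition of the
   Harish-Chandra projection.  If f(lambda) = 0, then u_chi(g) f v is a graded submodule
   which does not contain v: writing products with positive factors on the left and
   negative ones on the right, the functional which is 1 at v and vanishes on N^- Z
   vanishes on all of u_chi(g) f v.  If f(lambda) <> 0, then v lies in every nonzero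
   submodule, because every nonzero N^- -stable subspace contains f v.

   The functional, f v <> 0 and the last claim require a PBW basis of Z.  It comes from
   a model of Z built by induction on m: gl(m) acts by colour differential operators of
   order at most two on the truncated colour polynomials in x_1, ..., x_(m-1) (the
   variable x_k standing for f_(eps_0 - eps_k)) with coefficients in a model for
   gl(m - 1).  Its dimension is the product of the pbar, the number of reordered
   products which span Z, so that Z embeds into the model. *)

Set Implicit Arguments.
Unset Strict Implicit.
Unset Printing Implicit Defensive.

Import Order.TTheory GRing.Theory Num.Theory.
Local Open Scope ring_scope.

(** Since u_chi(g) is given by generators and relations, reordering products yields spanning sets
    only; independence, and already the fact that the algebra is not zero, needs a module in which
    the relations can be checked by hand. Splitting off the index 0 makes this feasible: the e_(k0)
    with k > 0 commute up to the bicharacter, so they can act as multiplications by variables, and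
    an operator commuting with the variables up to scalars is determined by its values on constants.
    The relations are checked on the e_ij alone; Jacobson's formula extends the p-th power relation
    to all homogeneous elements of degree in Gamma^+. Reordering is controlled by integral heights
    and not by weights: weights take values in F and see multiples of a root only modulo p, whereas
    the lowest height is attained by a single ordered product of negative root vectors with
    exponents below pbar. *)

Section Bicharacter.
Variables (F : fieldType) (G : finZmodType) (bc : G -> G -> F).
Hypothesis bcP : bicharacter bc.
Implicit Types a b c : G.

Lemma bcDl a b c : bc (a + b) c = bc a c * bc b c. Proof. by case: bcP. Qed.
Lemma bcDr a b c : bc a (b + c) = bc a b * bc a c. Proof. by case: bcP. Qed.
Lemma bc_sym a b : bc a b * bc b a = 1. Proof. by case: bcP. Qed.

Lemma bc_neq0 a b : bc a b != 0.
Proof.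
by apply/eqP => h; move: (bc_sym a b); rewrite h mul0r => /eqP; rewrite eq_sym oner_eq0.
Qed.

Lemma bc0l b : bc 0 b = 1.
Proof. by apply: (mulfI (bc_neq0 0 b)); rewrite -bcDl addr0 mulr1. Qed.

Lemma bc0r b : bc b 0 = 1.
Proof. by apply: (mulfI (bc_neq0 b 0)); rewrite -bcDr addr0 mulr1. Qed.

Lemma bcNl a b : bc (- a) b = (bc a b)^-1.
Proof. by apply: (mulfI (bc_neq0 a b)); rewrite -bcDl subrr bc0l divff // bc_neq0. Qed.

Lemma bcNr a b : bc a (- b) = (bc a b)^-1.
Proof. by apply: (mulfI (bc_neq0 a b)); rewrite -bcDr subrr bc0r divff // bc_neq0. Qed.

Lemma bcC a b : bc b a = (bc a b)^-1.
Proof. by apply: (mulfI (bc_neq0 a b)); rewrite bc_sym divff // bc_neq0. Qed.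

Lemma bc_self a : bc a a = if bc a a == 1 then 1 else -1.
Proof.
have /eqP := bc_sym a a; rewrite -expr2 sqrf_eq1 => /orP[] /eqP ->; first by rewrite eqxx.
by case: ifP => // /eqP.
Qed.

End Bicharacter.

(** * Truncated colour polynomials *)

(* {ffun 'I_P -> T} is T[x]/(x^P): the value at n is the coefficient of x^n. *)
Section AdjoinVariable.
Variables (F : fieldType) (P : nat) (T : vectType F).
Local Notation T1 := {ffun 'I_P -> T}.

(** Coefficients are read at every natural exponent, with value 0 from P on, so that shifts of
    exponents need no bound in their types. *)
Definition fcoef (n : nat) (u : T1) : T := if insub n is Some i then u i else 0.

Local Notation fev u n := (fcoef n u).

Lemma fevE u (i : 'I_P) : fev u i = u i.
Proof. by rewrite /fcoef valK. Qed.

Lemma fev_ge u n : (P <= n)%N -> fev u n = 0.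
Proof. by move=> h; rewrite /fcoef insubF // ltnNge h. Qed.

Lemma fev_linear n : linear (fcoef n).
Proof.
move=> c u w; rewrite /fcoef; case: insub => [i|]; last by rewrite scaler0 addr0.
by rewrite !ffunE.
Qed.
HB.instance Definition _ n := GRing.isLinear.Build F T1 T _ (fcoef n) (fev_linear n).

Lemma fev_ffun (f : nat -> T) n : fev [ffun i => f (val i)] n = if (n < P)%N then f n else 0.
Proof.
case: ltnP => h; last by rewrite fev_ge.
by rewrite -[n]/(val (Ordinal h)) fevE ffunE.
Qed.

Lemma fevP u w : (forall n, (n < P)%N -> fev u n = fev w n) -> u = w.
Proof. by move=> h; apply/ffunP => i; have := h i (ltn_ord i); rewrite !fevE. Qed.

Definition adj_x (u : T1) : T1 := [ffun i : 'I_P => (if val i is n.+1 then fev u n else 0) : T].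
Definition adj_d (u : T1) : T1 := [ffun i : 'I_P => (val i).+1%:R *: fev u (val i).+1].
(** The colour extension of A to polynomials: A acts on coefficients and pays a factor q for each x
    that it passes. *)
Definition adj_ext (q : F) (A : 'End(T)) (u : T1) : T1 := [ffun i : 'I_P => q ^+ i *: A (u i)].
Definition adj_at (k : nat) (m : T) : T1 := [ffun i : 'I_P => (if val i == k then m else 0) : T].

Lemma adj_x_linear : linear adj_x.
Proof.
move=> c u w; apply/ffunP => i; rewrite !ffunE; case: (val i) => [|n] /=.
  by rewrite scaler0 addr0.
by rewrite linearP.
Qed.
HB.instance Definition _ := GRing.isLinear.Build F T1 T1 _ adj_x adj_x_linear.

Lemma adj_d_linear : linear adj_d.
Proof.
by move=> c u w; apply/ffunP => i; rewrite !ffunE linearP scalerDr !scalerA mulrC.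
Qed.
HB.instance Definition _ := GRing.isLinear.Build F T1 T1 _ adj_d adj_d_linear.

Lemma adj_ext_linear q A : linear (adj_ext q A).
Proof.
by move=> c u w; apply/ffunP => i; rewrite !ffunE linearP scalerDr !scalerA mulrC.
Qed.
HB.instance Definition _ q A := GRing.isLinear.Build F T1 T1 _ (adj_ext q A) (adj_ext_linear q A).

Lemma adj_at_linear k : linear (adj_at k).
Proof.
by move=> c u w; apply/ffunP => i; rewrite !ffunE; case: ifP; rewrite ?scaler0 ?addr0.
Qed.
HB.instance Definition _ k := GRing.isLinear.Build F T T1 _ (adj_at k) (adj_at_linear k).

Lemma fev_x u n : (n < P)%N -> fev (adj_x u) n = if n is k.+1 then fev u k else 0.
Proof. by move=> h; rewrite (fev_ffun (fun n => if n is k.+1 then fev u k else 0)) h. Qed.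

Lemma fev_d u n : fev (adj_d u) n = n.+1%:R *: fev u n.+1.
Proof.
rewrite (fev_ffun (fun n => n.+1%:R *: fev u n.+1)); case: ltnP => // h.
by rewrite fev_ge ?scaler0 // leqW.
Qed.

Lemma fev_ext q A u n : fev (adj_ext q A u) n = q ^+ n *: A (fev u n).
Proof.
case: (ltnP n P) => h; last by rewrite !fev_ge // linear0 scaler0.
by rewrite -[n]/(val (Ordinal h)) !fevE ffunE.
Qed.

Lemma fev_at k m n : (n < P)%N -> fev (adj_at k m) n = if n == k then m else 0.
Proof. by move=> h; rewrite (fev_ffun (fun n => if n == k then m else 0)) h. Qed.

Local Notation fevS := (fev_x, fev_d, fev_ext, fev_at).

Lemma adj_ext_x q A u : adj_ext q A (adj_x u) = q *: adj_x (adj_ext q A u).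
Proof.
apply: fevP => n h; rewrite linearZ /= !fevS //; case: n h => [|n] h.
  by rewrite linear0 !scaler0.
by rewrite fev_ext exprS scalerA.
Qed.

Lemma adj_d_ext q A u : adj_d (adj_ext q A u) = q *: adj_ext q A (adj_d u).
Proof.
apply: fevP => n h; rewrite linearZ /= !fevS !linearZ /= !scalerA exprS; congr (_ *: _).
by ring.
Qed.

Lemma adj_ext_at q A k m : (k < P)%N -> adj_ext q A (adj_at k m) = q ^+ k *: adj_at k (A m).
Proof.
move=> hk; apply: fevP => n h; rewrite linearZ /= !fevS //.
by case: eqP => [->//|_]; rewrite linear0 !scaler0.
Qed.

Lemma adj_d_at0 m : adj_d (adj_at 0 m) = 0.
Proof.
apply: fevP => n h; rewrite linear0 fevS.
case: (ltnP n.+1 P) => h'; last by rewrite fev_ge ?scaler0.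
by rewrite fev_at // scaler0.
Qed.

Lemma adj_x_atP m : adj_x (adj_at P.-1 m) = 0.
Proof.
apply: fevP => n h; rewrite linear0 fev_x //; case: n h => // n h.
rewrite fev_at ?(ltnW h) //; case: eqP => // e.
by lia.
Qed.

Lemma fev_iter_x k u n : (n < P)%N ->
  fev (iter k adj_x u) n = if (k <= n)%N then fev u (n - k) else 0.
Proof.
elim: k n => [|k IH] n h; first by rewrite subn0.
by rewrite iterS fev_x //; case: n h => [//|n] h; rewrite IH // ltnW.
Qed.

Lemma adj_x_pow u : iter P adj_x u = 0.
Proof. by apply: fevP => n h; rewrite fev_iter_x // leqNgt h linear0. Qed.

Lemma adj_gen (Q : T1 -> Prop) : (forall u w, Q u -> Q w -> Q (u + w)) ->
  (forall m, Q (adj_at 0 m)) -> (forall u, Q u -> Q (adj_x u)) -> forall u, Q u.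
Proof.
move=> QD Qat Qx u.
have Q0 : Q 0 by have := Qat 0; rewrite linear0.
have -> : u = \sum_(i < P) iter i adj_x (adj_at 0 (u i)).
  apply: fevP => n h; rewrite linear_sum /= (bigD1 (Ordinal h)) //= big1 => [|i ne].
    rewrite addr0 fev_iter_x //= leqnn subnn fev_at ?(leq_ltn_trans _ h) //=.
    exact: (fevE u (Ordinal h)).
  rewrite fev_iter_x //; case: leqP => // le.
  rewrite fev_at ?(leq_ltn_trans _ h) ?leq_subr // subn_eq0.
  case: leqP => // le'; case/negP: ne; apply/eqP/val_inj/eqP.
  by rewrite /= eqn_leq le le'.
elim/big_ind: _ => // i _; elim: (val i) => [|k IH] //=; exact: Qx.
Qed.

(** With n the lowest exponent of u, multiplication by x^(P-1-n) moves the lowest term to the top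
    and kills all the others. *)
Lemma adj_socle u : u != 0 -> exists k m, m != 0 /\ iter k adj_x u = adj_at P.-1 m.
Proof.
move=> une.
have ex : exists n, fev u n != 0.
  case: (pickP (fun i : 'I_P => u i != 0)) => [i hi|h]; first by exists i; rewrite fevE.
  by case/eqP: une; apply/ffunP => i; rewrite ffunE; apply/eqP/negPn; rewrite h.
case: (ex_minnP ex) => n hn hmin.
have nP : (n < P)%N by rewrite ltnNge; apply: contraNN hn => h; rewrite fev_ge.
have P_gt0 : (0 < P)%N by apply: leq_trans nP.
exists (P.-1 - n)%N, (fev u n); split=> //; apply: fevP => i hi.
rewrite fev_iter_x // fev_at //; case: leqP => h; last first.
  by case: eqP h => // -> ; rewrite ltnNge leq_subr.
case: eqP => [->|ne]; first by rewrite subKn // -ltnS prednK.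
apply/eqP/negPn/negP => /hmin; rewrite leqNgt => /negP; apply.
have iP : (i < P.-1)%N by rewrite ltn_neqAle -ltnS prednK // hi andbT; apply/eqP.
by lia.
Qed.

End AdjoinVariable.

(** * Polynomials in several colour variables *)

Section Fock.
Variables (F : fieldType) (p : nat) (pcharF : p \in [pchar F]).
Variables (G : finZmodType) (bc : G -> G -> F).
Hypothesis bcP : bicharacter bc.

Definition color_order (t : G) : nat := if bc t t == 1 then p else 2%N.

Lemma color_order_gt0 t : (0 < color_order t)%N.
Proof. by rewrite /color_order; case: ifP => // _; rewrite prime_gt0 // (pcharf_prime pcharF). Qed.

(** The order of truncation is the one for which this relation survives at the top exponent P - 1,
    where x u loses a term: there the right side has the factor 1 + (p - 1) = 0 in the even case and
    1 - 1 = 0 in the odd case, with P = 2. *)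
Lemma adj_dx (T : vectType F) s (u : {ffun 'I_(color_order s) -> T}) :
  adj_d (adj_x u) = u + bc (- s) s *: adj_x (adj_d u).
Proof.
apply: fevP => n h; rewrite linearD linearZ /= fev_d (fev_x _ h).
have -> : bc (- s) s = if bc s s == 1 then 1 else -1.
  by rewrite bcNl //; case: ifP => [/eqP->|h']; rewrite ?invr1 // (bc_self bcP) h' invrN1.
have -> : (match n with 0%N => 0 | k.+1 => fcoef k (adj_d u) end) = n%:R *: fcoef n u.
  by case: (n) => [|k]; rewrite ?scale0r ?fev_d.
case: (ltnP n.+1 (color_order s)) => h'.
  rewrite fev_x // scalerA -[X in _ = X + _]scale1r -scalerDl; congr (_ *: _).
  move: h'; rewrite /color_order; case: ifP => _ h'; first by rewrite mul1r -natr1 addrC.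
  by case: n {h} h' => // _; rewrite mulr0 addr0.
rewrite fev_ge // scaler0 scalerA -[X in _ = X + _]scale1r -scalerDl.
have {h h'} : n.+1 = color_order s by apply/eqP; rewrite eqn_leq h h'.
move=> en; suff -> : 1 + (if bc s s == 1 then 1 else -1) * n%:R = 0 :> F by rewrite scale0r.
move: en; rewrite /color_order; case: ifP => _; last by case=> ->; rewrite mulr1 subrr.
by rewrite mul1r nat1r => ->; exact: pcharf0.
Qed.

(* T' consists of the truncated colour polynomials over T in variables x_k of degree
   t k; x k is multiplication, d k differentiation, R' extends R colour linearly, io and
   ta embed T as the bottom and top coefficients, pi is the bottom coefficient. *)
Record fock (n : nat) (t : 'I_n -> G) (I : Type) (g : I -> G) (T T' : vectType F)
    (R : I -> 'End(T)) (x d : 'I_n -> 'End(T')) (R' : I -> 'End(T'))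
    (io ta : 'Hom(T, T')) (pi : 'Hom(T', T)) : Prop := Fock {
  fock_gen : forall Q : T' -> Prop, (forall u w, Q u -> Q w -> Q (u + w)) ->
    (forall m, Q (io m)) -> (forall k u, Q u -> Q (x k u)) -> forall u, Q u;
  fock_xx : forall k l u, x k (x l u) = bc (t k) (t l) *: x l (x k u);
  fock_dx : forall k l u,
    d k (x l u) = (k == l)%:R *: u + bc (- t k) (t l) *: x l (d k u);
  fock_Rx : forall i k u, R' i (x k u) = bc (g i) (t k) *: x k (R' i u);
  fock_dio : forall k m, d k (io m) = 0;
  fock_Rio : forall i m, R' i (io m) = io (R i m);
  fock_xpow : forall k u, iter (color_order (t k)) (x k) u = 0;
  fock_piio : forall m, pi (io m) = m;
  fock_pix : forall k u, pi (x k u) = 0;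
  fock_xta : forall k m, x k (ta m) = 0;
  fock_Rta : forall i, exists2 c, c != 0 & forall m, R' i (ta m) = c *: ta (R i m);
  fock_ta0 : forall m, ta m = 0 -> m = 0;
  fock_socle : forall S : T' -> Prop, (forall c u, S u -> S (c *: u)) ->
    (forall k u, S u -> S (x k u)) ->
    forall u, u != 0 -> S u -> exists2 m, m != 0 & S (ta m);
  fock_dim : dim T' = (\prod_(k < n) color_order (t k) * dim T)%N
}.

Section AdjoinStep.
Variables (n : nat) (t : 'I_n.+1 -> G) (I : Type) (g : I -> G) (T T0 : vectType F).
Variables (R : I -> 'End(T)) (x d : 'I_n -> 'End(T0)) (R' : I -> 'End(T0)).
Variables (io ta : 'Hom(T, T0)) (pi : 'Hom(T0, T)).
Hypothesis fk : fock (fun k => t (lift ord0 k)) g R x d R' io ta pi.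

Let s := t ord0.
Let P := color_order s.
Let T1 := {ffun 'I_P -> T0}.

(** The space T1 is T0[x_0] truncated: the operators of T0 act on coefficients, twisted by the
    bicharacter of their degree with that of x_0. *)
Definition step_x (k : 'I_n.+1) : 'End(T1) :=
  if unlift ord0 k is Some j then linfun (adj_ext (bc (t (lift ord0 j)) s) (x j))
  else linfun (@adj_x _ _ _).
Definition step_d (k : 'I_n.+1) : 'End(T1) :=
  if unlift ord0 k is Some j then linfun (adj_ext (bc (- t (lift ord0 j)) s) (d j))
  else linfun (@adj_d _ _ _).
Definition step_R (i : I) : 'End(T1) := linfun (adj_ext (bc (g i) s) (R' i)).
Definition step_io : 'Hom(T, T1) := (linfun (adj_at P 0) \o io)%VF.
Definition step_ta : 'Hom(T, T1) := (linfun (adj_at P P.-1) \o ta)%VF.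
Definition step_pi : 'Hom(T1, T) := (pi \o linfun (fcoef 0))%VF.

Lemma step_x0 : step_x ord0 = linfun (@adj_x _ _ _).
Proof. by rewrite /step_x unlift_none. Qed.
Lemma step_xS j : step_x (lift ord0 j) = linfun (adj_ext (bc (t (lift ord0 j)) s) (x j)).
Proof. by rewrite /step_x liftK. Qed.
Lemma step_d0 : step_d ord0 = linfun (@adj_d _ _ _).
Proof. by rewrite /step_d unlift_none. Qed.
Lemma step_dS j : step_d (lift ord0 j) = linfun (adj_ext (bc (- t (lift ord0 j)) s) (d j)).
Proof. by rewrite /step_d liftK. Qed.

Let P_gt0 : (0 < P)%N := color_order_gt0 s.
Let P1lt : (P.-1 < P)%N. Proof. by rewrite prednK. Qed.

Local Notation fevS := (fev_x, fev_d, fev_ext, fev_at).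
Let stepE := (step_x0, step_xS, step_d0, step_dS).

Lemma fock_step : fock t g R step_x step_d step_R step_io step_ta step_pi.
Proof.
have ioE m : step_io m = adj_at P 0 (io m) by rewrite comp_lfunE lfunE.
have taE m : step_ta m = adj_at P P.-1 (ta m) by rewrite comp_lfunE lfunE.
have piE u : step_pi u = pi (fcoef 0 u) by rewrite comp_lfunE lfunE.
split.
- move=> Q QD Qio Qx; apply: adj_gen => // [m|u Qu]; last first.
    by have := Qx ord0 _ Qu; rewrite step_x0 lfunE.
  elim/(fock_gen fk): m => [u w|m|k u Qu]; first by rewrite linearD; exact: QD.
    by rewrite -ioE.
  have := Qx (lift ord0 k) _ Qu; rewrite step_xS lfunE /= adj_ext_at //.
  by rewrite expr0 scale1r.
- move=> k l u; case: (unliftP ord0 k) => [k'|] ->; case: (unliftP ord0 l) => [l'|] ->;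
    rewrite !stepE !lfunE /=.
  + apply: fevP => a h; rewrite !fevS !linearZ /= !fevS !linearZ /= (fock_xx fk) !scalerA.
    congr (_ *: _); ring.
  + by rewrite adj_ext_x.
  + by rewrite adj_ext_x scalerA bc_sym // scale1r.
  (* For an odd variable the relation is x_0^2 = - x_0^2; it holds because the truncation order is
     2, so that x_0^2 = 0. *)
  + rewrite bc_self //; case: ifP => [_|odd_s]; first by rewrite scale1r.
    suff -> : adj_x (adj_x u) = 0 by rewrite scaler0.
    apply: fevP => a h; rewrite fev_x // linear0; case: a h => // a h.
    rewrite fev_x ?(ltnW h) //; case: a h => // a h.
    suff P2 : P = 2%N by exfalso; move: h; rewrite P2.
    by rewrite /P /color_order odd_s.
- move=> k l u; case: (unliftP ord0 k) => [k'|] ->; case: (unliftP ord0 l) => [l'|] ->;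
    rewrite !stepE !lfunE /=.
  + rewrite (inj_eq (lift_inj)); apply: fevP => a h; rewrite !fevS linearD !linearZ /= !fevS.
    rewrite linearZ /= (fock_dx fk) scalerDr !linearZ /= !scalerA.
    rewrite scalerDr !scalerA; congr (_ *: _ + _ *: _); last by ring.
    case: eqP => [->|_]; last by rewrite !mulr0n mul0r mulr0.
    by rewrite mul1r -exprMn bcNl // mulVf ?bc_neq0 // expr1n.
  + rewrite scale0r add0r.
    by rewrite adj_ext_x.
  + by rewrite scale0r add0r adj_d_ext bcNl // bcC // invrK.
  + by rewrite scale1r; exact: adj_dx.
- move=> i k u; rewrite /step_R; case: (unliftP ord0 k) => [k'|] ->;
    rewrite !stepE !lfunE /=; last by rewrite adj_ext_x.
  apply: fevP => a h; rewrite linearZ /= !fevS !linearZ /= (fock_Rx fk) !scalerA.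
  congr (_ *: _); ring.
- move=> k m; rewrite ioE; case: (unliftP ord0 k) => [k'|] ->;
    rewrite !stepE !lfunE /= ?adj_d_at0 //.
  by rewrite adj_ext_at // (fock_dio fk) !linear0.
- by move=> i m; rewrite !ioE lfunE /= adj_ext_at // (fock_Rio fk) scale1r.
- move=> k u; case: (unliftP ord0 k) => [k'|] ->; rewrite !stepE.
    have E j : iter j (linfun (adj_ext (bc (t (lift ord0 k')) s) (x k'))) u =
      [ffun i : 'I_P => bc (t (lift ord0 k')) s ^+ (i * j) *: iter j (x k') (u i)].
      elim: j => [|j IH] /=; first by apply/ffunP => i; rewrite ffunE muln0 scale1r.
      rewrite IH lfunE; apply/ffunP => i; rewrite !ffunE linearZ /= scalerA mulnS exprD.
      by [].
    by rewrite E; apply/ffunP => i; rewrite !ffunE (fock_xpow fk) scaler0.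
  have E j : iter j (linfun (@adj_x F P T0)) u = iter j (@adj_x F P T0) u.
    by elim: j => //= j ->; rewrite lfunE.
  by rewrite E adj_x_pow.
- by move=> m; rewrite ioE piE fev_at // (fock_piio fk).
- move=> k u; rewrite piE; case: (unliftP ord0 k) => [k'|] ->; rewrite !stepE lfunE /= fevS //.
    by rewrite linearZ /= (fock_pix fk) scaler0.
  by rewrite linear0.
- move=> k m; rewrite taE; case: (unliftP ord0 k) => [k'|] ->;
    rewrite !stepE lfunE /= ?adj_x_atP //.
  by rewrite adj_ext_at // (fock_xta fk) !linear0.
- move=> i; have [c c0 hc] := fock_Rta fk i.
  exists (bc (g i) s ^+ P.-1 * c) => [|m]; first by rewrite mulf_neq0 // expf_neq0 // bc_neq0.
  by rewrite !taE lfunE /= adj_ext_at // hc linearZ scalerA.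
- move=> m; rewrite taE => /(congr1 (fcoef P.-1)); rewrite linear0 fev_at // eqxx.
  exact: (fock_ta0 fk).
(* First reach the top power of x_0, then apply the induction hypothesis to the coefficients there;
   on the top power the twists are nonzero constants, which [SZ] removes. *)
- move=> S SZ Sx u u0 Su; have [k [m [m0 em]]] := adj_socle u0.
  have Sm : S (adj_at P P.-1 m).
    rewrite -em; elim: k {em} => //= k; move: (iter _ _ _) => w Sw.
    by have := Sx ord0 _ Sw; rewrite stepE lfunE.
  have [||m' m'0 Sm'] := fock_socle fk (S := fun m => S (adj_at P P.-1 m)) _ _ m0 Sm.
  + by move=> c w Sw; rewrite linearZ; exact: SZ.
  + move=> j w /(Sx (lift ord0 j)); rewrite stepE lfunE /= adj_ext_at //.
    move/(SZ (bc (t (lift ord0 j)) s ^+ P.-1)^-1); rewrite scalerA mulVf ?scale1r //.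
    by rewrite expf_neq0 // bc_neq0.
  by exists m' => //; rewrite taE.
- rewrite big_ord_recl -mulnA -(fock_dim fk).
  have -> : dim T1 = (#|'I_P| * dim T0)%N by [].
  by rewrite card_ord.
Qed.

End AdjoinStep.

Lemma fock_exists (n : nat) (t : 'I_n -> G) (I : Type) (g : I -> G) (T : vectType F)
    (R : I -> 'End(T)) :
  exists (T' : vectType F) (x d : 'I_n -> 'End(T')) (R' : I -> 'End(T'))
    (io ta : 'Hom(T, T')) (pi : 'Hom(T', T)), fock t g R x d R' io ta pi.
Proof.
elim: n t => [|n IH] t; last first.
  have [T0 [x [d [R' [io [ta [pi /fock_step]]]]]]] := IH (fun k => t (lift ord0 k)).
  by move=> fk; do 7!eexists; exact: fk.
exists T, (fun=> \1%VF), (fun=> \1%VF), R, \1%VF, \1%VF, \1%VF.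
split; try by [move=> []|move=> ? []].
- by move=> Q _ Qio _ u; have := Qio u; rewrite id_lfunE.
- by move=> i m; rewrite !id_lfunE.
- by move=> m; rewrite !id_lfunE.
- by move=> i; exists 1 => [|m]; rewrite ?oner_eq0 // scale1r !id_lfunE.
- by move=> m; rewrite id_lfunE.
- by move=> S _ _ u u0 Su; exists u => //; rewrite id_lfunE.
- by rewrite big_ord0 mul1n.
Qed.

End Fock.

(** * Linear identities in modules *)

Section LinearExpressions.
Variables (F : comPzRingType) (V : lmodType F).

(** Noncommutative monomials become atoms, so that an identity between their combinations splits
    into commutative identities between coefficients. *)
Inductive lexpr := LAtom of nat | LZero | LAdd of lexpr & lexpr | LOpp of lexpr
  | LScale of F & lexpr.

Fixpoint leval (env : seq V) (e : lexpr) : V :=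
  match e with
  | LAtom i => nth 0 env i
  | LZero => 0
  | LAdd a b => leval env a + leval env b
  | LOpp a => - leval env a
  | LScale c a => c *: leval env a
  end.

(** Indices are compared with [Nat.eqb] because [cbn] evaluates it on numerals. *)
Fixpoint lcoef (e : lexpr) (i : nat) : F :=
  match e with
  | LAtom j => if Nat.eqb i j then 1 else 0
  | LZero => 0
  | LAdd a b => lcoef a i + lcoef b i
  | LOpp a => - lcoef a i
  | LScale c a => c * lcoef a i
  end.

Lemma nat_eqbE i j : Nat.eqb i j = (i == j).
Proof. by apply/idP/eqP => /PeanoNat.Nat.eqb_eq. Qed.

Lemma levalE env e : leval env e = \sum_(i < size env) lcoef e i *: env`_i.
Proof.
elim: e => [j||a IHa b IHb|a IHa|c a IHa] /=; rewrite ?IHa ?IHb.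
- case: (ltnP j (size env)) => h.
    rewrite (bigD1 (Ordinal h)) //= nat_eqbE eqxx scale1r big1 ?addr0 // => i ne.
    rewrite nat_eqbE; case: eqP => [e|_]; last by rewrite scale0r.
    by case/eqP: ne; apply: val_inj.
  rewrite nth_default // big1 // => i _; rewrite nat_eqbE.
  by case: eqP h => [<-|_]; rewrite ?scale0r // leqNgt ltn_ord.
- by rewrite big1 // => i _; rewrite scale0r.
- by rewrite -big_split; apply: eq_bigr => i _; rewrite scalerDl.
- by rewrite -sumrN; apply: eq_bigr => i _; rewrite scaleNr.
- by rewrite scaler_sumr; apply: eq_bigr => i _; rewrite scalerA.
Qed.

Fixpoint lcheck (n : nat) (a b : lexpr) : Prop :=
  if n is k.+1 then lcoef a k = lcoef b k /\ lcheck k a b else True.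

Lemma lcheckP env a b : lcheck (size env) a b -> leval env a = leval env b.
Proof.
move=> h; rewrite !levalE; apply: eq_bigr => i _; congr (_ *: _).
elim: (size env) i h => [[]//|n IH] i /= [e h]; case: (ltngtP i n) => [lt|gt|->] //.
  exact: (IH (Ordinal lt)).
by have := ltn_ord i; rewrite ltnS leqNgt gt.
Qed.

End LinearExpressions.

Ltac lin_find x l :=
  match l with
  | ?y :: _ => let _ := match goal with _ => unify x y end in constr:(0%nat)
  | _ :: ?l' => let n := lin_find x l' in constr:(S n)
  end.
Ltac lin_mem x l :=
  match l with
  | ?y :: _ => let _ := match goal with _ => unify x y end in constr:(true)
  | _ :: ?l' => lin_mem x l'
  | _ => constr:(false)
  end.
Ltac lin_atoms t acc :=
  lazymatch t with
  | (?a + ?b)%R => let acc := lin_atoms a acc in lin_atoms b acc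
  | (- ?a)%R => lin_atoms a acc
  | (_ *: ?a)%R => lin_atoms a acc
  | 0%R => acc
  | _ => let b := lin_mem t acc in
         lazymatch b with true => acc | false => constr:(t :: acc) end
  end.
Ltac lin_reify F t env :=
  lazymatch t with
  | (?a + ?b)%R => let a := lin_reify F a env in let b := lin_reify F b env in
                   constr:(LAdd a b)
  | (- ?a)%R => let a := lin_reify F a env in constr:(LOpp a)
  | (?c *: ?a)%R => let a := lin_reify F a env in constr:(@LScale F c a)
  | 0%R => constr:(@LZero F)
  | _ => let n := lin_find t env in constr:(@LAtom F n)
  end.
(* Reduces an identity in an F-module to one ring identity in F for each atom. *)
Ltac lin_ring F :=
  lazymatch goal with
  | |- @eq ?V ?a ?b =>
    let l := lin_atoms a (@nil V) in
    let l := lin_atoms b l in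
    let ra := lin_reify F a l in
    let rb := lin_reify F b l in
    apply: (@lcheckP _ _ l ra rb); cbn [lcheck lcoef size Nat.eqb]; do ?split
  end.

Section LfunLinear.
Variables (F : fieldType) (U V : vectType F) (f : 'Hom(U, V)).
Lemma lfun_add u w : f (u + w) = f u + f w. Proof. exact: linearD. Qed.
Lemma lfun_scale (k : F) u : f (k *: u) = k *: f u. Proof. exact: linearZ. Qed.
End LfunLinear.

(** * Representations of the colour algebra gl *)

Section Endo.
Variables (F : fieldType) (T : vectType F) (T_gt0 : (0 < dim T)%N).

(* The proof that T is nonzero gives 'End(T) the structure of a nontrivial ring. *)
Definition endo of (0 < dim T)%N : Type := 'End(T).
Local Notation E := (endo T_gt0).

HB.instance Definition _ := Vector.copy E 'End(T).
HB.instance Definition _ := GRing.Zmodule_isNzRing.Build E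
  (@comp_lfunA _ _ _ _ _) (@comp_lfun1l _ _ _) (@comp_lfun1r _ _ _)
  (@comp_lfunDl _ _ _ _) (@comp_lfunDr _ _ _ _) (lfun1_neq0 T_gt0).
HB.instance Definition _ := GRing.Lmodule_isLalgebra.Build F E
  (fun k (x y : E) => comp_lfunZl k x y).
HB.instance Definition _ := GRing.Lalgebra_isAlgebra.Build F E
  (fun k (x y : E) => comp_lfunZr k x y).

Definition endo_app (f : E) (u : T) : T := fun_of_lfun f u.
(** The lock keeps the operators opaque during simplification; only [to_endoE] opens them. *)
Definition to_endo (f : 'End(T)) : E := locked (f : E).
HB.instance Definition _ f := GRing.Linear.copy (endo_app f) (fun_of_lfun f).

Lemma endoM f g u : endo_app (f * g) u = endo_app f (endo_app g u).
Proof. exact: comp_lfunE. Qed.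
Lemma endo1 u : endo_app 1 u = u. Proof. exact: id_lfunE. Qed.
Lemma endo0 u : endo_app 0 u = 0. Proof. exact: zero_lfunE. Qed.
Lemma endoD f g u : endo_app (f + g) u = endo_app f u + endo_app g u.
Proof. exact: add_lfunE. Qed.
Lemma endoN f u : endo_app (- f) u = - endo_app f u.
Proof. exact: opp_lfunE. Qed.
Lemma endoZ c f u : endo_app (c *: f) u = c *: endo_app f u.
Proof. exact: scale_lfunE. Qed.
Lemma endo_sum I (r : seq I) P (f : I -> E) u :
  endo_app (\sum_(i <- r | P i) f i) u = \sum_(i <- r | P i) endo_app (f i) u.
Proof. exact: sum_lfunE. Qed.
Lemma endoX f k u : endo_app (f ^+ k) u = iter k (endo_app f) u.
Proof. by elim: k => [|k IH]; rewrite ?endo1 // exprS endoM IH. Qed.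
Lemma endoP f g : endo_app f =1 endo_app g -> f = g.
Proof. by move=> h; apply/lfunP. Qed.
Lemma to_endoE f u : endo_app (to_endo f) u = f u.
Proof. by rewrite /to_endo -lock. Qed.

Lemma endo_addr f u w : endo_app f (u + w) = endo_app f u + endo_app f w.
Proof. exact: linearD. Qed.
Lemma endo_scaler f c u : endo_app f (c *: u) = c *: endo_app f u.
Proof. exact: linearZ. Qed.
Lemma endo_zero f : endo_app f 0 = 0. Proof. exact: linear0. Qed.

End Endo.
Definition endoE := (endoM, endo1, endo0, endoD, endoN, endoZ, to_endoE).

Section ColorJacobi.
Variables (F : fieldType) (A : algType F).

(** The scalars are named after the pairs of arguments whose bicharacter they stand for. In
    brackets: bc [[X,Z],Y] + [X,[Y,Z]] = [[X,Y],Z]. *)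
Lemma color_jacobi_identity (X Y Z : A) (ab ac bc cb : F) : bc * cb = 1 ->
  bc *: ((X * Z - ac *: (Z * X)) * Y - (ab * cb) *: (Y * (X * Z - ac *: (Z * X))))
  + (X * (Y * Z - bc *: (Z * Y)) - (ab * ac) *: ((Y * Z - bc *: (Z * Y)) * X))
  = (X * Y - ab *: (Y * X)) * Z - (ac * bc) *: (Z * (X * Y - ab *: (Y * X))).
Proof.
move=> h; rewrite !(mulrDl, mulrDr, mulNr, mulrN, scalerDr) -!(scalerAl, scalerAr) !mulrA.
by lin_ring F; ring: h.
Qed.

End ColorJacobi.

(* The colour bracket with parameter c is x * y - c *: (y * x); J measures how far L is
   from preserving it. *)
Section BracketDefect.
Variables (F : fieldType) (A B : algType F) (L : {linear B -> A}).

Definition bracket_defect (c : F) (x y : B) : A :=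
  L x * L y - c *: (L y * L x) - L (x * y - c *: (y * x)).
Local Notation J := bracket_defect.

Let LB u w k : L (u - k *: w) = L u - k *: L w. Proof. by rewrite linearB linearZ. Qed.
Let LZ u k : L (k *: u) = k *: L u. Proof. by rewrite linearZ. Qed.
Let LD u w : L (u + w) = L u + L w. Proof. by rewrite linearD. Qed.

Lemma bracket_defectE c x y : J c x y =
  L x * L y - c *: (L y * L x) - (L (x * y) - c *: L (y * x)).
Proof. by rewrite /J LB. Qed.

Lemma bracket_defect_sym c c' x y : c * c' = 1 -> J c' y x = 0 -> J c x y = 0.
Proof.
move=> h J0; suff -> : J c x y = - c *: J c' y x by rewrite J0 scaler0.
by rewrite /J !LB; lin_ring F; ring: h.
Qed.

Lemma bracket_defectDr c x y z : J c x (y + z) = J c x y + J c x z.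
Proof. by rewrite /J LD !mulrDr !mulrDl !LB !LD; lin_ring F; ring. Qed.

Lemma bracket_defectZr c k x y : J c x (k *: y) = k *: J c x y.
Proof. by rewrite /J LZ -!scalerAr -!scalerAl !LB !LZ; lin_ring F; ring. Qed.

Lemma bracket_defectDl c x y z : J c (y + z) x = J c y x + J c z x.
Proof. by rewrite /J LD !mulrDr !mulrDl !LB !LD; lin_ring F; ring. Qed.

Lemma bracket_defectZl c k x y : J c (k *: y) x = k *: J c y x.
Proof. by rewrite /J LZ -!scalerAr -!scalerAl !LB !LZ; lin_ring F; ring. Qed.

(** Compare the colour Jacobi identity of A at L x, L y, L z with the image under L of that of B:
    when the other defects vanish, what remains is the colour bracket of the defect of (x, y) with L
    z. *)
Lemma bracket_defect_commutes ab ac bc cb x y z : bc * cb = 1 ->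
  J ac x z = 0 -> J bc y z = 0 ->
  J (ab * ac) x (y * z - bc *: (z * y)) = 0 ->
  J (ab * cb) (x * z - ac *: (z * x)) y = 0 ->
  J (ac * bc) (x * y - ab *: (y * x)) z = 0 ->
  J ab x y * L z = (ac * bc) *: (L z * J ab x y).
Proof.
move=> h /subr0_eq xz /subr0_eq yz /subr0_eq xyz /subr0_eq xzy /subr0_eq xy_z.
have := color_jacobi_identity (L x) (L y) (L z) ab ac h.
rewrite xz yz xyz xzy -LZ -LD color_jacobi_identity // -xy_z.
move=> e; rewrite /J; set D := L x * L y - _ in e *; set M := L (x * y - _) in e *.
move: D M e => D M e; rewrite !mulrBl !mulrBr.
rewrite (_ : D * L z = (D * L z - (ac * bc) *: (L z * D)) + (ac * bc) *: (L z * D)).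
  by rewrite -e; lin_ring F; ring.
by lin_ring F; ring.
Qed.

End BracketDefect.

Section GlLinear.
Variables (F : fieldType) (n : nat) (A : lmodType F) (E : 'I_n -> 'I_n -> A).

Definition gl_lin (x : 'M[F]_n) : A := \sum_i \sum_j x i j *: E i j.

Lemma gl_lin_linear : linear gl_lin.
Proof.
move=> k x y; rewrite scaler_sumr -big_split; apply: eq_bigr => i _.
rewrite scaler_sumr -big_split; apply: eq_bigr => j _.
by rewrite !mxE scalerDl scalerA.
Qed.
HB.instance Definition _ := GRing.isLinear.Build F 'M[F]_n A _ gl_lin gl_lin_linear.

Lemma gl_lin_delta i j : gl_lin (delta_mx i j) = E i j.
Proof.
rewrite /gl_lin (bigD1 i) //= (bigD1 j) //= big1 => [|j' ne]; last first.
  by rewrite mxE (negbTE ne) andbF scale0r.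
rewrite big1 => [|i' ne]; last first.
  by rewrite big1 // => j' _; rewrite mxE (negbTE ne) scale0r.
by rewrite mxE !eqxx scale1r !addr0.
Qed.

End GlLinear.

(** * Powers in characteristic p *)

Section CommutePower.
Variables (F : fieldType) (p : nat) (pcharF : p \in [pchar F]) (A : algType F).

Lemma pcharA_scale k (a : A) : (p %| k)%N -> k%:R *: a = 0.
Proof. by rewrite (dvdn_pcharf pcharF) => /eqP ->; rewrite scale0r. Qed.

(** A twisted Leibniz formula: the operation x -> E x - q x E dies at its third iterate, so only the
    binomial coefficients of orders 0, 1 and 2 occur. *)
Lemma commute_power_twice (q : F) (E x y w : A) n :
  E * x = q *: (x * E) + y -> E * y = q *: (y * E) + w -> E * w = q *: (w * E) ->
  E ^+ n.+2 * x = q ^+ n.+2 *: (x * E ^+ n.+2) + (n.+2%:R * q ^+ n.+1) *: (y * E ^+ n.+1)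
    + ('C(n.+2, 2)%:R * q ^+ n) *: (w * E ^+ n).
Proof.
move=> hx hy hw; elim: n => [|n IH].
  rewrite (_ : E ^+ 2 * x = E * (E * x)) ?mulrA // -[E * E * x]mulrA hx.
  rewrite mulrDr -scalerAr mulrA hx hy mulrDl -scalerAl -mulrA.
  by rewrite binn !expr1 expr0 !mulr1 expr2; lin_ring F; ring.
have -> : E ^+ n.+3 * x = E * (E ^+ n.+2 * x) by rewrite mulrA -exprS.
have e k : E * E ^+ k = E ^+ k.+1 by rewrite exprS.
have z (a b : A) r k : E * a = q *: (a * E) + b ->
    E * (r *: (a * E ^+ k)) = (r * q) *: (a * E ^+ k.+1) + r *: (b * E ^+ k).
  by move=> h; rewrite -scalerAr mulrA h mulrDl -scalerAl -mulrA e scalerDr scalerA.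
have hw' : E * w = q *: (w * E) + 0 by rewrite addr0.
rewrite IH !mulrDr (z _ _ _ _ hx) (z _ _ _ _ hy) (z _ _ _ _ hw') mul0r scaler0 addr0.
have -> : n.+3%:R = n.+2%:R + 1 :> F by rewrite natr1.
have -> : 'C(n.+3, 2)%:R = 'C(n.+2, 2)%:R + n.+2%:R :> F by rewrite binS bin1 natrD.
move: (n.+2%:R) ('C(n.+2, 2)%:R) => r1 r2.
rewrite [q ^+ n.+3]exprS [q ^+ n.+2]exprS [q ^+ n.+1]exprS.
move: (E ^+ n.+3) (E ^+ n.+2) (E ^+ n.+1) => f3 f2 f1.
by lin_ring F; ring.
Qed.

(** As p > 2, it divides both 'C(p, 1) and 'C(p, 2). *)
Lemma commute_power (q : F) (E x y w : A) : (2 < p)%N ->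
  E * x = q *: (x * E) + y -> E * y = q *: (y * E) + w -> E * w = q *: (w * E) ->
  E ^+ p * x = q ^+ p *: (x * E ^+ p).
Proof.
move=> p2 hx hy hw; have ep : p = p.-2.+2 by case: (p) p2 => [|[]].
rewrite {1}ep (commute_power_twice _ hx hy hw) -ep -!scalerA !pcharA_scale ?addr0 //.
rewrite prime_dvd_bin ?p2 //; exact: pcharf_prime pcharF.
Qed.

Lemma pcharA_addX (s : F) (E : A) : (E + s%:A) ^+ p = E ^+ p + (s ^+ p)%:A.
Proof.
have pA : p \in [pchar A].
  rewrite inE (pcharf_prime pcharF) /= -scaler_nat.
  by rewrite (pcharf0 pcharF) scale0r eqxx.
rewrite -!(pFrobenius_autE pA) pFrobenius_autD_comm; last first.
  by rewrite /GRing.comm -scalerAl -scalerAr mul1r mulr1.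
by rewrite !pFrobenius_autE exprZn expr1n.
Qed.

End CommutePower.

Section GlRep.
Variables (F : fieldType) (p : nat).
Variables (G : finZmodType) (bc : G -> G -> F).

(** For an odd root vector, E^2 = 0 is contained in [gl_bracket]: its bracket with itself is 2 E^2,
    and p is odd. *)
Record gl_rep (n : nat) (deg : 'I_n -> G) (c : 'I_n -> F) (A : algType F)
    (E : 'I_n -> 'I_n -> A) : Prop := GlRep {
  gl_bracket : forall i j k l,
    E i j * E k l - bc (deg i - deg j) (deg k - deg l) *: (E k l * E i j) =
    (j == k)%:R *: E i l
    - bc (deg i - deg j) (deg k - deg l) *: ((l == i)%:R *: E k j);
  gl_power : forall i j, bc (deg i - deg j) (deg i - deg j) = 1 ->
    E i j ^+ p = (i == j)%:R *: (E i j + (c i ^+ p)%:A)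
}.

(* A baby Verma module of highest weight lam: v is the highest weight vector, u0 the
   lowest one, and phi the coefficient of v. *)
Record verma_model (n : nat) (deg : 'I_n -> G) (c lam : 'I_n -> F)
    (T : vectType F) (T_gt0 : (0 < dim T)%N) (E : 'I_n -> 'I_n -> endo T_gt0)
    (v u0 : T) (phi : 'Hom(T, F^o)) : Prop := VermaModel {
  vm_rep : gl_rep deg c E;
  vm_hw : forall i j : 'I_n, (i < j)%N -> endo_app (E i j) v = 0;
  vm_wt : forall i, endo_app (E i i) v = lam i *: v;
  vm_gen : forall Q : T -> Prop, (forall u w, Q u -> Q w -> Q (u + w)) ->
    (forall k u, Q u -> Q (k *: u)) -> Q v ->
    (forall (i j : 'I_n) u, (j < i)%N -> Q u -> Q (endo_app (E i j) u)) ->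
    forall u, Q u;
  vm_phi : phi v = 1;
  vm_phi0 : forall (i j : 'I_n) u, (j < i)%N -> phi (endo_app (E i j) u) = 0;
  vm_u0 : u0 != 0;
  vm_socle : forall S : T -> Prop, (forall k u, S u -> S (k *: u)) ->
    (forall (i j : 'I_n) u, (j < i)%N -> S u -> S (endo_app (E i j) u)) ->
    forall u, u != 0 -> S u -> S u0;
  vm_dim : dim T =
    (\prod_(i < n) \prod_(j < n | (i < j)%N) color_order p bc (deg j - deg i)%R)%N
}.

Variables (pcharF : p \in [pchar F]) (p_gt2 : (2 < p)%N).
Hypothesis bcP : bicharacter bc.

(** * The induction step from gl(m - 1) to gl(m) *)

Section Step.
Variables (n : nat) (deg : 'I_n.+1 -> G) (c lam : 'I_n.+1 -> F).
Hypothesis lamP : forall i, lam i ^+ p - lam i = c i ^+ p.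
Let up (i : 'I_n) : 'I_n.+1 := lift ord0 i.
Variables (T : vectType F) (T_gt0 : (0 < dim T)%N) (E0 : 'I_n -> 'I_n -> endo T_gt0).
Hypothesis rep0 : gl_rep (deg \o up) (c \o up) E0.
Let t k := deg (up k) - deg ord0.
Variables (T' : vectType F) (T'_gt0 : (0 < dim T')%N).
Variables (x d : 'I_n -> 'End(T')) (R' : 'I_n * 'I_n -> 'End(T')).
Variables (io ta : 'Hom(T, T')) (pi : 'Hom(T', T)).
Let g (a : 'I_n * 'I_n) := deg (up a.1) - deg (up a.2).
Hypothesis fk : fock p bc t g (fun a => E0 a.1 a.2 : 'End(T)) x d R' io ta pi.
Local Notation A := (endo T'_gt0).

Let X k : A := to_endo T'_gt0 (x k).
Let D k : A := to_endo T'_gt0 (d k).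
Let R i j : A := to_endo T'_gt0 (R' (i, j)).

Let XX k l : X k * X l = bc (t k) (t l) *: (X l * X k).
Proof. by apply: endoP => u; rewrite !endoE (fock_xx fk). Qed.
Let DX k l : D k * X l = (k == l)%:R%:A + bc (- t k) (t l) *: (X l * D k).
Proof. by apply: endoP => u; rewrite !endoE (fock_dx fk). Qed.
Let RX i j k : R i j * X k = bc (t i - t j) (t k) *: (X k * R i j).
Proof.
apply: endoP => u; rewrite !endoE (fock_Rx fk) /=; congr (bc _ _ *: _).
by rewrite /g /t /= opprB addrA subrK.
Qed.

(** The constants and the x_k generate T', and the vanishing of Z propagates through each x_k. *)
Lemma fock_principle (Z : A) : (forall m, endo_app Z (io m) = 0) ->
  (forall k, exists q, Z * X k = q *: (X k * Z)) -> Z = 0.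
Proof.
move=> Zio ZX; apply: endoP => u; rewrite endo0.
elim/(fock_gen fk): u => [u w hu hw|//|k u hu]; first by rewrite endo_addr hu hw addr0.
have [q h] := ZX k; have := congr1 (fun f => endo_app f u) h.
by rewrite !endoE hu linear0 scaler0.
Qed.

(* The action of gl(m) on T' that makes each e_(k0) the multiplication by x_k; it is
   forced by the brackets with the x_k and by the action on the constants io(T), where
   gl(m - 1) acts through E0 and e_00 by lam 0, and the e_0l vanish. *)
Definition E00 : A := (lam ord0)%:A - \sum_k X k * D k.
Definition E0r (l : 'I_n) : A := E00 * D l - \sum_k bc (t k) (t k) *: (D k * R k l).
Definition Err (k l : 'I_n) : A := X k * D l + R k l.
Definition step_E (i j : 'I_n.+1) : A :=
  match unlift ord0 i, unlift ord0 j with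
  | Some k, Some l => Err k l
  | Some k, None => X k
  | None, Some l => E0r l
  | None, None => E00
  end.

Lemma step_E00 : step_E ord0 ord0 = E00. Proof. by rewrite /step_E unlift_none. Qed.
Lemma step_E0r l : step_E ord0 (up l) = E0r l.
Proof. by rewrite /step_E unlift_none liftK. Qed.
Lemma step_Er0 k : step_E (up k) ord0 = X k.
Proof. by rewrite /step_E unlift_none liftK. Qed.
Lemma step_Err k l : step_E (up k) (up l) = Err k l.
Proof. by rewrite /step_E !liftK. Qed.
Let stepE := (step_E00, step_E0r, step_Er0, step_Err).

Let L : {linear 'M[F]_n.+1 -> A} := gl_lin step_E.
Let e i j : 'M[F]_n.+1 := delta_mx i j.
Let LE i j : L (e i j) = step_E i j. Proof. exact: gl_lin_delta. Qed.
Let LZ k z : L (k *: z) = k *: L z. Proof. exact: linearZ. Qed.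
Let ee i j k l : e i j * e k l = (j == k)%:R *: e i l.
Proof. by rewrite /e -mulmxE mul_delta_mx_cond scaler_nat. Qed.
Let gd i j := deg i - deg j.
Local Notation J i j k l := (bracket_defect L (bc (gd i j) (gd k l)) (e i j) (e k l)).

Let JE i j k l : J i j k l =
  step_E i j * step_E k l - bc (gd i j) (gd k l) *: (step_E k l * step_E i j)
  - ((j == k)%:R *: step_E i l - bc (gd i j) (gd k l) *: ((l == i)%:R *: step_E k j)).
Proof. by rewrite bracket_defectE !ee !LZ !LE. Qed.

Let gd_up i j : gd (up i) (up j) = t i - t j.
Proof. by rewrite /gd /t opprB addrA subrK. Qed.
Let gd_0up j : gd ord0 (up j) = - t j. Proof. by rewrite /gd /t opprB. Qed.
Let gd_up0 j : gd (up j) ord0 = t j. Proof. by []. Qed.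
Let gd_00 : gd ord0 ord0 = 0. Proof. exact: subrr. Qed.
Let up_eq i j : (up i == up j) = (i == j). Proof. exact: (inj_eq lift_inj). Qed.
Let up_0 i : (up i == ord0) = false. Proof. by []. Qed.
Let zero_up i : (ord0 == up i) = false. Proof. by []. Qed.
Let boolE : (false%:R = 0 :> F) * (true%:R = 1 :> F). Proof. by []. Qed.
Let idxE := (gd_up, gd_0up, gd_up0, gd_00, up_eq, up_0, zero_up, eqxx).

Let XDX i j k : X i * D j * X k =
  (j == k)%:R *: X i + bc (t i - t j) (t k) *: (X k * X i * D j).
Proof.
rewrite -mulrA DX mulrDr -!scalerAr !mulrA (XX i k) -scalerAl scalerA mulr1.
by rewrite bcDl // [_ * bc (t i) _]mulrC.
Qed.

Let sum_delta (f : 'I_n -> A) k : \sum_i (i == k)%:R *: f i = f k.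
Proof.
rewrite (bigD1 k) //= eqxx scale1r big1 ?addr0 // => i /negbTE ->.
by rewrite scale0r.
Qed.

Let E00X k : E00 * X k = X k * E00 - X k.
Proof.
rewrite /E00 mulrBl mulrBr mulr_suml mulr_sumr -!scalerAl -!scalerAr mul1r mulr1.
rewrite -addrA; congr (_ + _); rewrite -opprD; congr (- _).
rewrite -[X in _ = _ + X](sum_delta X) -big_split; apply: eq_bigr => i _ /=.
by rewrite XDX subrr bc0l // scale1r mulrA addrC.
Qed.

(** This is the bracket of e_0j with e_k0, which produces e_kj in two pieces: X_k D_j from moving
    X_k past [E00], and R_kj from the term i = k of the sum over D_i R_ij. The quadratic form of
    [E0r] is dictated by it. *)
Let E0rX j k : E0r j * X k = (j == k)%:R *: E00
  + bc (- t j) (t k) *: (X k * E0r j - (X k * D j + R k j)).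
Proof.
rewrite /E0r mulrBl mulr_suml -[E00 * D j * X k]mulrA DX mulrDr -!scalerAr mulr1.
rewrite [E00 * (X k * D j)]mulrA E00X.
have -> : \sum_i bc (t i) (t i) *: (D i * R i j) * X k = bc (- t j) (t k) *: R k j +
    bc (- t j) (t k) *: (X k * \sum_i bc (t i) (t i) *: (D i * R i j)).
  rewrite -[X in X *: R k j + _]mul1r -scalerA -(sum_delta (fun i => bc (- t j) (t k) *: R i j)).
  rewrite scale1r mulr_sumr scaler_sumr -big_split; apply: eq_bigr => i _ /=.
  rewrite -scalerAl -mulrA RX -scalerAr mulrA DX mulrDl -!scalerAl mul1r -scalerAr !scalerA.
  rewrite (bcDl bcP (t i)) (bcNl bcP (t i)) scalerDr !scalerA -[X k * D i * _]mulrA.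
  congr (_ *: _ + _ *: _).
    case: eqP => [->|]; last by rewrite !mulr0 mul0r.
    by ring: (bc_sym bcP (t k) (t k)).
  by field; rewrite bc_neq0.
by move: E00 (\sum_i _) => e0 s0; rewrite mulrBl mulrBr !mulrA; lin_ring F; ring.
Qed.

Let J_X i j k : J i j (up k) ord0 = 0.
Proof.
rewrite JE; apply/eqP; rewrite subr_eq0; apply/eqP.
case: (unliftP ord0 i) => [i'|] ->; case: (unliftP ord0 j) => [j'|] ->;
  rewrite !stepE !idxE ?boolE /Err.
- rewrite mulrDl XDX RX mulrDr !mulrA; lin_ring F; ring.
- rewrite XX; lin_ring F; ring.
- rewrite E0rX; lin_ring F; ring.
- rewrite E00X bc0l //; lin_ring F; ring.
Qed.

Let ioB u w k : io (u - k *: w) = io u - k *: io w. Proof. by rewrite linearB linearZ. Qed.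
Let ioZ u k : io (k *: u) = k *: io u. Proof. by rewrite linearZ. Qed.

Lemma E00_io m : endo_app E00 (io m) = lam ord0 *: io m.
Proof.
rewrite /E00 !endoE endo_sum big1 ?subr0 // => k _.
by rewrite !endoE (fock_dio fk) linear0.
Qed.

Lemma E0r_io l m : endo_app (E0r l) (io m) = 0.
Proof.
rewrite /E0r endoD endoN endoM to_endoE (fock_dio fk) endo_zero add0r.
rewrite endo_sum big1 ?oppr0 // => k _.
by rewrite !endoE (fock_Rio fk) (fock_dio fk) scaler0.
Qed.

Lemma Err_io k l m : endo_app (Err k l) (io m) = io (endo_app (E0 k l) m).
Proof. by rewrite !endoE (fock_dio fk) linear0 add0r (fock_Rio fk). Qed.

(** The side conditions exclude the x_k, the only operators among the e_ij which do not preserve the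
    constants io(T). *)
Let J_io i j k l m : (i == ord0) || (j != ord0) -> (k == ord0) || (l != ord0) ->
  endo_app (J i j k l) (io m) = 0.
Proof.
move=> ij kl; rewrite JE.
have [[h0 h1] h2] := (E00_io, E0r_io, Err_io).
have h3 i' j' k' l' := congr1 (fun f => io (endo_app f m)) (gl_bracket rep0 i' j' k' l').
case: (unliftP ord0 i) ij => [i'|] ->; case: (unliftP ord0 j) => [j'|] -> // _;
case: (unliftP ord0 k) kl => [k'|] ->; case: (unliftP ord0 l) => [l'|] -> // _;
  rewrite !stepE !idxE ?boolE.
all: move: E00 E0r Err h0 h1 h2 => e00 e0r err h0 h1 h2.
all: rewrite !endoE !(h0, h1, h2) ?endo_scaler ?endo_zero.
all: rewrite ?(h0, h1, h2) ?(bc0l bcP) ?(bc0r bcP); try by lin_ring F; ring.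
have := h3 i' j' k' l'; rewrite !endoE !ioB !ioZ /= -!/(gd _ _) !gd_up => <-.
exact: subrr.
Qed.

Let J_Xl i j k : J (up k) ord0 i j = 0.
Proof. by apply: bracket_defect_sym (J_X i j k); rewrite bc_sym. Qed.

(** The order of [step_E i j] as a differential operator: 0 for the x_k, 2 for the e_0l, 1 for the
    others. *)
Let level i j : nat := (i == ord0 :> 'I_n.+1) + (j != ord0 :> 'I_n.+1).

Let defectB (s q r : F) u w z : bracket_defect L s u (q *: w - r *: z) =
  q *: bracket_defect L s u w - r *: bracket_defect L s u z.
Proof. by rewrite bracket_defectDr -scaleNr !bracket_defectZr scaleNr. Qed.
Let defectBl (s q r : F) u w z : bracket_defect L s (q *: w - r *: z) u =
  q *: bracket_defect L s w u - r *: bracket_defect L s z u.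
Proof. by rewrite bracket_defectDl -scaleNr !bracket_defectZl scaleNr. Qed.

Let gdD i j k : gd i j + gd j k = gd i k. Proof. by rewrite /gd addrA subrK. Qed.

(* Induction on the level: by the colour Jacobi identity J(x, y) commutes up to
   scalars with each X k, as the bracket with e k 0 lowers the level. *)
Let J0 N : forall i j k l, (level i j + level k l <= N)%N -> J i j k l = 0.
Proof.
elim: N => [|N IH] i j k l hN.
  case: (unliftP ord0 k) hN => [k'|] ->; last by rewrite /level eqxx addnC.
  case: (unliftP ord0 l) => [l'|] -> hN; first by move: hN; rewrite /level addnC.
  exact: J_X.
case: (boolP ((k == ord0) || (l != ord0))) => [hkl|]; last first.
  rewrite negb_or negbK => /andP[]; case: (unliftP ord0 k) => [k'|] -> // _ /eqP ->.
  exact: J_X.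
case: (boolP ((i == ord0) || (j != ord0))) => [hij|]; last first.
  rewrite negb_or negbK => /andP[]; case: (unliftP ord0 i) => [i'|] -> // _ /eqP ->.
  exact: J_Xl.
apply: fock_principle => [m|k0]; first exact: J_io.
have LX : L (e (up k0) ord0) = X k0 by rewrite LE stepE.
rewrite -LX; eexists.
(* A bracket of matrix units carries Kronecker deltas; a defect in it has to vanish only when its
   delta is 1, and only then is its degree the expected one. *)
have scal0 (b : bool) (s : F) (Z : A) : (b -> Z = 0) -> (s * b%:R) *: Z = 0.
  by case: b => [->|_]; rewrite ?scaler0 // mulr0 scale0r.
have scal1 (b : bool) (Z : A) : (b -> Z = 0) -> b%:R *: Z = 0.
  by move=> h; rewrite -[X in X *: _]mul1r scal0.
apply: (bracket_defect_commutes (bc_sym bcP (gd k l) (gd (up k0) ord0))).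
- exact: J_X.
- exact: J_X.
- rewrite !ee scalerA defectB scal1 ?scal0 ?subrr //.
  + move=> /eqP ek; subst k; rewrite -(bcDr bcP) addrC gdD; apply: IH.
    by move: hN; rewrite /level !idxE; lia.
  + move=> /eqP el; subst l; rewrite -(bcDr bcP) gdD; apply: IH.
    by move: hN; rewrite /level !idxE; lia.
- rewrite !ee scalerA defectBl scal1 ?scal0 ?subrr //.
  + move=> /eqP ei; subst i; rewrite -(bcDl bcP) addrC gdD; apply: IH.
    by move: hN; rewrite /level !idxE; lia.
  + move=> /eqP ej; subst j; rewrite -(bcDl bcP) gdD; apply: IH.
    by move: hN; rewrite /level !idxE; lia.
- rewrite !ee scalerA defectBl scal1 ?scal0 ?subrr //.
  + by move=> /eqP el; rewrite -(bcDl bcP) addrC el gdD J_X.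
  + by move=> /eqP ej; rewrite -(bcDl bcP) ej gdD J_X.
Qed.

Let bracket i j k l : step_E i j * step_E k l =
  bc (gd i j) (gd k l) *: (step_E k l * step_E i j)
  + ((j == k)%:R *: step_E i l - bc (gd i j) (gd k l) *: ((l == i)%:R *: step_E k j)).
Proof.
have := J0 (leqnn (level i j + level k l)); rewrite JE.
by move/eqP; rewrite subr_eq0 subr_eq addrC => /eqP.
Qed.

Let pred_odd : odd p. Proof. by case: (even_prime (pcharf_prime pcharF)) p_gt2 => [->|]. Qed.

(** Bracketing e_k0 twice with e_ij gives a multiple s of e_ij, and s <> 0 only for (i, j) = (0, k),
    the case of sl_2, where s = -2. The equation s = q s makes the second bracket commute with e_ij
    up to q, as [commute_power] requires. *)
Let root_power i j k : i != j -> bc (gd i j) (gd i j) = 1 ->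
  step_E i j ^+ p * X k = bc (gd i j) (t k) ^+ p *: (X k * step_E i j ^+ p).
Proof.
move=> ij even; set q := bc _ (t k).
suff [y [s [ey ew es]]] : exists y s, [/\ step_E i j * X k = q *: (X k * step_E i j) + y,
    step_E i j * y = q *: (y * step_E i j) + s *: step_E i j & s = q * s].
  apply: (commute_power _ _ ey ew) => //.
  by rewrite -scalerAr -scalerAl scalerA -es.
have := bracket i j (up k) ord0; rewrite step_Er0 gd_up0 -/q => ->.
have gdV a b : bc (gd i j) (gd b a) = (bc (gd i j) (gd a b))^-1.
  by rewrite -bcNr // /gd opprB.
case: (eqVneq j (up k)) => [jk|jk]; case: (eqVneq ord0 i) => [i0|i0].
- have q1 : q = 1 by rewrite /q /t -/(gd _ _) -jk i0 gdV even invr1.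
  subst i; subst j; eexists; exists (- 2%:R); split=> //; last by rewrite q1 mul1r.
  rewrite q1 ?eqxx ?boolE !scale1r mulrBr mulrBl.
  rewrite (bracket ord0 (up k) ord0 ord0) (bracket ord0 (up k) (up k) (up k)) !idxE ?boolE.
  rewrite subrr !(bc0r bcP).
  by lin_ring F; ring.
- exists (step_E i ord0), 0; split; rewrite ?mulr0 //.
    by rewrite !boolE; lin_ring F; ring.
  rewrite bracket (negbTE i0) eq_sym (negbTE ij) !boolE.
  have -> : bc (gd i j) (gd i ord0) = q.
    by rewrite -(gdD i j ord0) bcDr // even mul1r /q jk.
  by lin_ring F; ring.
- exists (- q *: step_E (up k) j), 0; split; rewrite ?mulr0 //.
    by rewrite !boolE; lin_ring F; ring.
  rewrite -scalerAr bracket (negbTE jk) [j == i]eq_sym (negbTE ij) !boolE.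
  have -> : bc (gd i j) (gd (up k) j) = q.
    by rewrite -(gdD (up k) i j) bcDr // even mulr1 /q -i0.
  by rewrite -scalerAl; lin_ring F; ring.
- exists 0, 0; rewrite !mulr0 mul0r; split=> //; rewrite ?boolE; lin_ring F; ring.
Qed.

(** The variable X_k is an eigenvector of ad e_ii with eigenvalue s in {0, 1, -1}. By Frobenius,
    moving X_k past e_ii^p - e_ii adds s^p - s, which is 0 as s lies in the prime field. *)
Let diag_power i k :
  (step_E i i ^+ p - step_E i i) * X k = X k * (step_E i i ^+ p - step_E i i).
Proof.
pose s : F := (i == up k)%:R - (ord0 == i)%:R.
have sp : s ^+ p = s.
  rewrite /s; case: eqP => [->|_]; first by rewrite zero_up subr0 expr1n.
  case: eqP => _; last by rewrite subrr expr0n gtn_eqF // prime_gt0 // (pcharf_prime pcharF).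
  by rewrite sub0r -signr_odd pred_odd.
have EX : step_E i i * X k = X k * (step_E i i + s%:A).
  rewrite -step_Er0 bracket {1}/gd subrr (bc0l bcP) mulrDr -scalerAr mulr1.
  rewrite {1}/gd subrr (bc0l bcP) /s.
  case: (eqVneq i (up k)) => [->|_]; first by rewrite zero_up !boolE step_Er0; lin_ring F; ring.
  by case: (ord0 =P i) => [<-|_]; rewrite !boolE step_Er0; lin_ring F; ring.
have EXr r : step_E i i ^+ r * X k = X k * (step_E i i + s%:A) ^+ r.
  elim: r => [|r IH]; first by rewrite !expr0 mulr1 mul1r.
  by rewrite exprSr -mulrA EX mulrA IH -mulrA -exprSr.
rewrite mulrBl EXr EX (pcharA_addX pcharF) sp !mulrDr mulrN.
by lin_ring F; ring.
Qed.

(** The power relations hold on the constants, by induction for gl(m - 1), and [fock_principle]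
    carries them to T'. *)
Lemma step_rep : gl_rep deg c step_E.
Proof.
split=> [i j k l|i j even]; first by rewrite -!/(gd _ _) bracket; lin_ring F; ring.
have p0 : (0 < p)%N by rewrite prime_gt0 // (pcharf_prime pcharF).
case: (eqVneq i j) even => [<-|ij] even; last first.
  rewrite boolE scale0r; case: (unliftP ord0 i) (ij) => [i'|] ei; last first.
    move=> _; apply: fock_principle => [m|k]; last by eexists; exact: root_power.
    case: (unliftP ord0 j) ij => [j'|] -> //; rewrite ei // => _.
    by rewrite stepE endoX -(prednK p0) iterSr E0r_io -endoX endo_zero.
  case: (unliftP ord0 j) => [j'|] ej; last first.
    move=> _; rewrite ei ej stepE; apply: endoP => u; rewrite endoX endo0.
    have -> : iter p (endo_app (X i')) u = iter p (x i') u.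
      by elim: p => //= r ->; rewrite to_endoE.
    rewrite -[RHS](fock_xpow fk i' u) /color_order.
    by move: even; rewrite ei ej -/(gd _ _) gd_up0 => ->; rewrite eqxx.
  move=> _; apply: fock_principle => [m|k]; last by eexists; exact: root_power.
  rewrite ei ej stepE endoX.
  have -> : iter p (endo_app (Err i' j')) (io m) = io (iter p (endo_app (E0 i' j')) m).
    by elim: p => //= r ->; rewrite Err_io.
  rewrite -endoX (gl_power rep0) /=; last by rewrite -[RHS]even ei ej.
  move: ij; rewrite ei ej up_eq => /negbTE ->.
  by rewrite boolE scale0r endo0 linear0.
rewrite scale1r; apply/eqP; rewrite -subr_eq0 opprD addrA; apply/eqP.
apply: fock_principle => [m|k]; last first.
  exists 1; rewrite scale1r mulrBl diag_power [RHS]mulrBr; congr (_ - _).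
  by rewrite -scalerAl -scalerAr mul1r mulr1.
rewrite !endoE endoX; case: (unliftP ord0 i) => [i'|] ->; rewrite stepE.
  have -> : iter p (endo_app (Err i' i')) (io m) = io (iter p (endo_app (E0 i' i')) m).
    by elim: p => //= r ->; rewrite Err_io.
  rewrite -endoX (gl_power rep0) /=; last by rewrite subrr bc0l.
  rewrite eqxx scale1r Err_io endoD endoZ endo1 linearD linearZ /=.
  by lin_ring F; ring.
have -> : iter p (endo_app E00) (io m) = lam ord0 ^+ p *: io m.
  elim: p => [|r IH] /=; first by rewrite scale1r.
  by rewrite IH endo_scaler E00_io scalerA exprSr.
(* On constants e_00 is the scalar lam 0, so its power relation is exactly the condition on the
   weight. *)
by rewrite E00_io -lamP; lin_ring F; ring.
Qed.

Variables (v u0 : T) (phi : 'Hom(T, F^o)).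
Hypothesis vm : verma_model (deg \o up) (c \o up) (lam \o up) E0 v u0 phi.

Let up_lt i j : (up i < up j)%N = (i < j)%N. Proof. by rewrite /up !lift0. Qed.

(** The highest weight vector lies in the bottom coefficient and the lowest one in the top
    coefficient; on either of them e_ij with i, j > 0 acts as in the model of gl(m - 1), up to a
    nonzero scalar. *)
Lemma step_model : verma_model deg c lam step_E (io v) (ta u0) (phi \o pi)%VF.
Proof.
split.
- exact: step_rep.
- move=> i j; case: (unliftP ord0 j) => [j'|] -> //; case: (unliftP ord0 i) => [i'|] ->.
    by rewrite stepE up_lt => h; rewrite Err_io (vm_hw vm) // linear0.
  by rewrite stepE E0r_io.
- move=> i; case: (unliftP ord0 i) => [i'|] ->; rewrite stepE; last exact: E00_io.
  by rewrite Err_io (vm_wt vm) lfun_scale.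
- move=> Q QD QZ Qv QE; apply: (fock_gen fk) => // [m|k u Qu]; last first.
    by have := QE (up k) ord0 u isT Qu; rewrite stepE to_endoE.
  elim/(vm_gen vm): m => [u w|k u|//|i j u ij]; rewrite ?lfun_add ?lfun_scale; first exact: QD.
    exact: QZ.
  by move=> Qu; rewrite -Err_io -step_Err; apply: QE => //; rewrite up_lt.
- by rewrite comp_lfunE (fock_piio fk) (vm_phi vm).
- move=> i j u; rewrite comp_lfunE; case: (unliftP ord0 i) => [i'|] -> //.
  case: (unliftP ord0 j) => [j'|] ->; rewrite stepE; last first.
    by rewrite to_endoE (fock_pix fk) linear0.
  rewrite up_lt => ij; rewrite /Err !endoE (lfun_add pi) (fock_pix fk) add0r.
  have -> : pi (R' (i', j') u) = endo_app (E0 i' j') (pi u); last exact: (vm_phi0 vm).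
  elim/(fock_gen fk): u => [u w hu hw|m|k u hu].
  + by rewrite !lfun_add hu hw endo_addr.
  + by rewrite (fock_Rio fk) !(fock_piio fk).
  + by rewrite (fock_Rx fk) lfun_scale !(fock_pix fk) scaler0 endo_zero.
- by apply: contraNneq (vm_u0 vm) => /(fock_ta0 fk) ->.
- move=> S SZ SE u un0 Su.
  have [|m m0 Sm] := fock_socle fk SZ _ un0 Su.
    by move=> k w Sw; have := SE (up k) ord0 w isT Sw; rewrite stepE to_endoE.
  apply: (vm_socle vm (S := fun m => S (ta m))) Sm => // [k w Sw|i j w ij Sw].
    by rewrite lfun_scale; exact: SZ.
  have [q q0 hq] := fock_Rta fk (i, j).
  have /(SE (up i) (up j) _) : S (ta w) by [].
  rewrite up_lt => /(_ ij); rewrite stepE /Err !endoE hq.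
  (* As i <> j, x_i and d_j commute up to a nonzero scalar, and x_i kills the top coefficient. *)
  have -> : x i (d j (ta w)) = 0.
    have := fock_dx fk j i (ta w); rewrite (fock_xta fk) linear0.
    rewrite (_ : (j == i) = false) ?scale0r ?add0r; last by apply/negbTE; rewrite -val_eqE ltn_eqF.
    by move/esym/eqP; rewrite scaler_eq0 (negbTE (bc_neq0 bcP _ _)) => /eqP.
  by rewrite add0r => /(SZ q^-1); rewrite scalerA mulVf // scale1r.
- rewrite (fock_dim fk) (vm_dim vm) big_ord_recl; congr (_ * _)%N.
    by rewrite [RHS]big_mkcond big_ord_recl /= mul1n.
  apply: eq_bigr => i _; rewrite [RHS]big_mkcond big_ord_recl /= mul1n [LHS]big_mkcond.
  by apply: eq_bigr => j _; rewrite -/(up i) -/(up j) up_lt.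
Qed.

End Step.

Lemma verma_model_exists (n : nat) (deg : 'I_n -> G) (c lam : 'I_n -> F) :
  (forall i, lam i ^+ p - lam i = c i ^+ p) ->
  exists (T : vectType F) (T_gt0 : (0 < dim T)%N) (E : 'I_n -> 'I_n -> endo T_gt0)
    (v u0 : T) (phi : 'Hom(T, F^o)), verma_model deg c lam E v u0 phi.
Proof.
elim: n deg c lam => [|n IH] deg c lam lamP.
  have F_gt0 : (0 < dim F^o)%N by [].
  exists F^o, F_gt0, (fun _ _ => 0), 1, 1, \1%VF.
  split; try by case.
  - by split; case.
  - by move=> Q _ QZ Q1 _ u; rewrite -[u]mulr1; exact: QZ.
  - by rewrite id_lfunE.
  - exact: oner_neq0.
  - by move=> S SZ _ u u0 Su; rewrite -(mulVf u0); exact: SZ.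
  - by rewrite big_ord0.
pose up := lift (@ord0 n).
have [|T [T_gt0 [E0 [v [u0 [phi vm]]]]]] := IH (deg \o up) (c \o up) (lam \o up).
  by move=> i; exact: lamP.
have [T' [x [d [R' [io [ta [pi fk]]]]]]] := fock_exists pcharF bcP
  (fun k => deg (up k) - deg ord0) (fun a : 'I_n * 'I_n => deg (up a.1) - deg (up a.2))
  (fun a => E0 a.1 a.2 : 'End(T)).
have T'_gt0 : (0 < dim T')%N.
  by rewrite (fock_dim fk) muln_gt0 T_gt0 andbT prodn_gt0 // => k; exact: color_order_gt0.
by do 6!eexists; exact: (step_model lamP (vm_rep vm) T'_gt0 fk vm).
Qed.

End GlRep.

(** * Reordering products of operators *)

Section LinearSpan.
Variables (F : fieldType) (T : lmodType F).

Inductive fspan (Q : T -> Prop) : T -> Prop :=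
| fspan_gen x of Q x : fspan Q x
| fspan0 : fspan Q 0
| fspanD x y of fspan Q x & fspan Q y : fspan Q (x + y)
| fspanZ c x of fspan Q x : fspan Q (c *: x).

Lemma fspan_sub (Q R : T -> Prop) z : (forall y, Q y -> fspan R y) -> fspan Q z -> fspan R z.
Proof.
move=> QR; elim=> [y /QR//||x y _ hx _ hy|c x _ hx]; first exact: fspan0.
  exact: fspanD.
exact: fspanZ.
Qed.

End LinearSpan.

Lemma fspan_image (F : fieldType) (T T' : lmodType F) (f : {linear T -> T'})
    (Q : T -> Prop) (R : T' -> Prop) z :
  (forall y, Q y -> fspan R (f y)) -> fspan Q z -> fspan R (f z).
Proof.
move=> QR; elim=> [y /QR//||x y _ hx _ hy|c x _ hx].
- by rewrite linear0; exact: fspan0.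
- by rewrite linearD; exact: fspanD.
- by rewrite linearZ; exact: fspanZ.
Qed.

Section Straightening.
Variables (F : fieldType) (K : eqType) (T : lmodType F) (X : K -> {linear T -> T}).
Variables (ht : K -> int) (P : K -> nat).

Definition act (w : seq K) (z : T) : T := foldr (fun k u => X k u) z w.
Definition word_ht (w : seq K) : int := \sum_(k <- w) ht k.
(** The error terms of a reordering: shorter words of the same height, disposed of by induction on
    the length. *)
Definition short (n : nat) (h : int) (z : T) : T -> Prop :=
  fspan (fun y => exists w, [/\ (size w < n)%N, word_ht w = h & y = act w z]).

Hypothesis swapP : forall k l, exists c, forall z,
  fspan (fun y => exists2 j, ht j = ht k + ht l & y = X j z) (X k (X l z) - c *: X l (X k z)).
Hypothesis powP : forall k z, short (P k) (ht k *+ P k) z (iter (P k) (X k) z).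

Lemma act_cat u w z : act (u ++ w) z = act u (act w z).
Proof. exact: foldr_cat. Qed.

Lemma act_linear w : linear (act w).
Proof. by move=> c u z; elim: w => //= k w ->; rewrite linearP. Qed.
HB.instance Definition _ w := GRing.isLinear.Build F T T _ (act w) (act_linear w).

Let XB k u c v : X k (u - c *: v) = X k u - c *: X k v.
Proof. by rewrite linearB linearZ. Qed.

Lemma act_nseq n k z : act (nseq n k) z = iter n (X k) z.
Proof. by elim: n => //= n ->. Qed.

Lemma word_ht_cons k w : word_ht (k :: w) = ht k + word_ht w.
Proof. exact: big_cons. Qed.

Lemma word_ht1 k : word_ht [:: k] = ht k.
Proof. exact: big_seq1. Qed.

Lemma word_ht_cat u w : word_ht (u ++ w) = word_ht u + word_ht w.
Proof. exact: big_cat. Qed.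

Lemma word_ht_nseq n k : word_ht (nseq n k) = ht k *+ n.
Proof. by elim: n => [|n IH]; rewrite ?mulr0n ?mulrS -?IH ?word_ht_cons // /word_ht big_nil. Qed.

Lemma short_act n h z u y : short n h z y ->
  short (size u + n) (word_ht u + h) z (act u y).
Proof.
apply: fspan_image => _ [w [sw <- ->]]; apply: fspan_gen; exists (u ++ w).
by rewrite size_cat ltn_add2l sw word_ht_cat act_cat.
Qed.

Lemma short_le n n' h z y : (n <= n')%N -> short n h z y -> short n' h z y.
Proof.
move=> le; apply: fspan_sub => _ [w [sw hw ->]]; apply: fspan_gen.
by exists w; split=> //; exact: leq_trans le.
Qed.

Lemma act_insert u1 k u2 z : exists c,
  short (size (k :: u1 ++ u2)) (word_ht (k :: u1 ++ u2)) z
    (act (k :: u1 ++ u2) z - c *: act (u1 ++ k :: u2) z).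
Proof.
elim: u1 => [|l u1 [c IH]]; first by exists 1; rewrite scale1r subrr; exact: fspan0.
have [c' swap] := swapP k l; exists (c' * c).
rewrite [X in short _ _ _ X](_ : _ =
    (X k (X l (act (u1 ++ u2) z)) - c' *: X l (X k (act (u1 ++ u2) z)))
    + c' *: act [:: l] (act (k :: u1 ++ u2) z - c *: act (u1 ++ k :: u2) z)); last first.
  by rewrite /= XB; lin_ring F; ring.
apply: fspanD; last first.
  apply: fspanZ; rewrite [word_ht _](_ : _ = word_ht [:: l] + word_ht (k :: u1 ++ u2)).
    exact: (short_act [:: l] IH).
  by rewrite word_ht1 /= !word_ht_cons addrCA.
apply: fspan_sub (swap _) => _ [j hj ->]; apply: fspan_gen; exists (j :: u1 ++ u2).
by rewrite /= !word_ht_cons hj addrA.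
Qed.

Lemma act_perm w w' z : perm_eq w w' ->
  exists c, short (size w) (word_ht w) z (act w z - c *: act w' z).
Proof.
elim: w w' => [|k w IH] w' pw.
  have -> : w' = [::] by apply: perm_nilP; rewrite perm_sym.
  by exists 1; rewrite scale1r subrr; exact: fspan0.
have /splitPr ek : k \in w' by rewrite -(perm_mem pw) mem_head.
case: {w'} ek pw => u1 u2 pw.
have pw' : perm_eq w (u1 ++ u2).
  by rewrite -(perm_cons k) (perm_trans pw) // perm_catC /= perm_cons perm_catC.
have [c hc] := IH _ pw'; have [c' hc'] := act_insert u1 k u2 z.
exists (c * c'); rewrite [X in short _ _ _ X](_ : _ = act [:: k] (act w z - c *: act (u1 ++ u2) z)
  + c *: (act (k :: u1 ++ u2) z - c' *: act (u1 ++ k :: u2) z)); last first.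
  by rewrite /= XB; lin_ring F; ring.
apply: fspanD.
  by rewrite word_ht_cons -word_ht1; exact: (short_act [:: k] hc).
apply: fspanZ; rewrite word_ht_cons [word_ht w](_ : _ = word_ht (u1 ++ u2)) -?word_ht_cons.
  by rewrite /= (perm_size pw').
exact: perm_big.
Qed.

Definition block_word (ks : seq K) (a : K -> nat) : seq K := flatten [seq nseq (a k) k | k <- ks].

Lemma block_word_cat s1 s2 a : block_word (s1 ++ s2) a = block_word s1 a ++ block_word s2 a.
Proof. by rewrite /block_word map_cat flatten_cat. Qed.

Lemma block_word_cons k s a : block_word (k :: s) a = nseq (a k) k ++ block_word s a.
Proof. by []. Qed.

Lemma count_block_word ks a k : uniq ks ->
  count_mem k (block_word ks a) = if k \in ks then a k else 0.
Proof.
elim: ks => //= l ks IH /andP[lks /IH e]; rewrite block_word_cons count_cat e count_nseq in_cons /=.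
by case: (eqVneq l k) lks => [->|ne] /=; rewrite ?mul1n ?mul0n // => /negbTE ->; rewrite addn0.
Qed.

(** Sort the letters into blocks, which costs shorter words; a block of length at least P k is then
    replaced by shorter words through [powP]. *)
Lemma act_block_word ks w z : uniq ks -> (forall k, k \in ks) ->
  fspan (fun y => exists a, [/\ forall k, (a k < P k)%N, word_ht (block_word ks a) = word_ht w
    & y = act (block_word ks a) z]) (act w z).
Proof.
move=> uks allks; have [n] := ubnP (size w); elim: n w => // n IH w sw.
pose a k := count_mem k w.
have pw : perm_eq w (block_word ks a).
  by apply/allP => k _ /=; rewrite count_block_word // allks.
have IHs h y : short n h z y -> fspan (fun y => exists a, [/\ forall k, (a k < P k)%N,
    word_ht (block_word ks a) = h & y = act (block_word ks a) z]) y.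
  by apply: fspan_sub => _ [u [su <- ->]]; exact: IH.
have [c hc] := act_perm z pw.
rewrite -[act w z](subrK (c *: act (block_word ks a) z)); apply: fspanD.
  by apply: IHs; apply: short_le hc; rewrite -ltnS.
apply: fspanZ.
case: (boolP (all (fun k => a k < P k)%N ks)) => [/allP small|/allPn[k kks]].
  apply: fspan_gen; exists a; split=> //; first by move=> k; exact: small.
  by apply/esym/perm_big.
rewrite -leqNgt => big.
have [s1 [s2 eks]] : exists s1 s2, ks = s1 ++ k :: s2.
  by case/splitPr: kks => s1 s2; exists s1, s2.
have e : block_word ks a = block_word s1 a ++ nseq (P k) k ++ nseq (a k - P k) k ++ block_word s2 a.
  by rewrite eks block_word_cat block_word_cons -{1}(subnKC big) nseqD -!catA.
apply: IHs; rewrite [word_ht w](_ : _ = word_ht (block_word ks a)); last exact: perm_big.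
move: (perm_size pw); rewrite e !size_cat !size_nseq => sz.
rewrite !act_cat act_nseq; set y := act _ (act _ z).
apply: fspan_image (powP k y) => _ [u [su hu ->]]; apply: fspan_gen.
exists (block_word s1 a ++ u ++ nseq (a k - P k) k ++ block_word s2 a).
rewrite !act_cat !word_ht_cat hu !word_ht_nseq /y; split=> //.
rewrite !size_cat !size_nseq; move: sw; rewrite sz ltnS.
apply: leq_trans; rewrite -addnS leq_add2l -addSn leq_add2r //.
Qed.

End Straightening.

(** * Jacobson's formula *)

Section IteratedCommutator.
Variable R : nzRingType.
Implicit Types u v : R.

Definition ad u v : R := u * v - v * u.

Definition sbin (n i : nat) : int := (-1) ^+ i * 'C(n, i)%:Z.

Lemma sbinS n i : sbin n.+1 i.+1 = sbin n i.+1 - sbin n i.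
Proof. by rewrite /sbin binS PoszD exprS; ring. Qed.

(** Left and right multiplication by u commute, so this is the binomial expansion of the n-th power
    of their difference. *)
Lemma iter_ad u v n : iter n (ad u) v =
  \sum_(i < n.+1) (u ^+ (n - i) * v * u ^+ i) *~ sbin n i.
Proof.
elim: n => [|n IH]; first by rewrite big_ord1 !expr0 mul1r mulr1.
rewrite iterS IH /ad mulr_sumr mulr_suml.
under eq_bigr => i _ do rewrite mulrzAr !mulrA -exprS -(subSn (leq_ord i)).
under [X in _ - X]eq_bigr => i _ do rewrite mulrzAl -!mulrA -exprSr mulrA.
rewrite [RHS]big_ord_recl /= expr0 subn0.
under [X in _ = _ + X]eq_bigr => i _ do rewrite /bump /= add1n subSS sbinS mulrzBr.
rewrite sumrB addrA; congr (_ - _).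
rewrite big_ord_recl subn0; congr (_ + _); first by rewrite /sbin !bin0 expr0 mulr1.
rewrite [RHS]big_ord_recr /= (_ : sbin n n.+1 = 0) ?mulr0z ?addr0; last first.
  by rewrite /sbin bin_small // mulr0.
by apply: eq_bigr => i _; rewrite /bump /= add1n subSS.
Qed.

Lemma deriv_exp (q : {poly R}) n :
  (q ^+ n)^`() = \sum_(i < n) q ^+ (n.-1 - i) * q^`() * q ^+ i.
Proof.
elim: n => [|n IH]; first by rewrite big_ord0 expr0 derivC.
rewrite exprSr derivM IH big_ord_recl /= subn0 expr0 mulr1 addrC; congr (_ + _).
rewrite mulr_suml; apply: eq_bigr => i _.
rewrite -mulrA -exprSr /bump /= add1n; congr (q ^+ _ * _ * _); lia.
Qed.

End IteratedCommutator.

(** The signed binomials (-1)^i 'C(p - 1, i) are all 1 modulo p: consecutive ones differ by a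
    multiple of 'C(p, i + 1). *)
Lemma iter_ad_pchar (R : nzRingType) p (u v : R) : p \in [pchar R] ->
  iter p.-1 (ad u) v = \sum_(i < p) u ^+ (p.-1 - i) * v * u ^+ i.
Proof.
move=> pcharR; have p_pr := pcharf_prime pcharR.
rewrite iter_ad prednK ?prime_gt0 //; apply: eq_bigr => i _.
suff [k ->] : exists k, sbin p.-1 i = 1 + k * p%:Z.
  rewrite mulrzDr mulr1z mulrC mulrzA -pmulrn -mulr_natr (pcharf0 pcharR) mulr0 mul0rz.
  by rewrite addr0.
case: i => i /=; elim: i => [_|i IH lt]; first by exists 0; rewrite /sbin expr0 bin0 mul0r addr0.
have [k ek] := IH (ltnW lt).
have /dvdnP [r er] : (p %| 'C(p, i.+1))%N by rewrite prime_dvd_bin // lt.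
exists (k + (-1) ^+ i.+1 * r%:Z).
have := sbinS p.-1 i; rewrite prednK ?prime_gt0 // ek => /eqP.
rewrite eq_sym subr_eq => /eqP ->; rewrite /sbin er PoszM; ring.
Qed.

Section LinearPencil.
Variable R : nzRingType.
Variables x y : R.

Definition pencil : {poly R} := x%:P * 'X + y%:P.

Lemma coef_pencilM (q : {poly R}) i :
  (pencil * q)`_i = (if i is j.+1 then x * q`_j else 0) + y * q`_i.
Proof.
rewrite /pencil mulrDl coefD coefCM -mulrA coefCM coefXM.
by case: i => [|i] //=; rewrite mulr0.
Qed.

Lemma coef_mul_pencil (q : {poly R}) i :
  (q * pencil)`_i = (if i is j.+1 then q`_j * x else 0) + q`_i * y.
Proof.
rewrite /pencil mulrDr coefD coefMC mulrA coefMX coefMC.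
by case: i.
Qed.

Lemma coef_pencil_ad (q : {poly R}) i :
  (ad pencil q)`_i = (if i is j.+1 then ad x q`_j else 0) + ad y q`_i.
Proof.
rewrite /ad coefB coef_pencilM coef_mul_pencil; case: i => [|i]; first by rewrite !add0r.
by rewrite opprD addrACA.
Qed.

Lemma coef_pencil_exp_gt n i : (n < i)%N -> (pencil ^+ n)`_i = 0.
Proof.
elim: n i => [|n IH] [|i] // h; first by rewrite expr0 coef1.
by rewrite exprS coef_pencilM !IH ?mulr0 ?addr0 // ltnW.
Qed.

Lemma coef_pencil_exp_top n : (pencil ^+ n)`_n = x ^+ n.
Proof.
elim: n => [|n IH]; first by rewrite !expr0 coef1.
by rewrite exprS coef_pencilM IH coef_pencil_exp_gt // mulr0 addr0 -exprS.
Qed.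

Lemma coef_pencil_exp0 n : (pencil ^+ n)`_0 = y ^+ n.
Proof.
elim: n => [|n IH]; first by rewrite !expr0 coef1.
by rewrite exprS coef_pencilM IH add0r -exprS.
Qed.

Lemma sum_coef_pencil_exp n : (x + y) ^+ n = \sum_(i < n.+1) (pencil ^+ n)`_i.
Proof.
elim: n => [|n IH]; first by rewrite big_ord1 !expr0 coef1.
rewrite !exprS IH; under [RHS]eq_bigr => i _ do rewrite coef_pencilM.
rewrite big_split /= [X in _ = X + _]big_ord_recl add0r [X in _ = _ + X]big_ord_recr /=.
by rewrite coef_pencil_exp_gt // mulr0 addr0 mulrDl !mulr_sumr.
Qed.

Lemma deriv_pencil_exp p : p \in [pchar R] ->
  (pencil ^+ p)^`() = iter p.-1 (ad pencil) x%:P.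
Proof.
move=> pcharR; have pcharP : p \in [pchar {poly R}].
  by rewrite inE (pcharf_prime pcharR) -polyC_natr (pcharf0 pcharR) eqxx.
rewrite deriv_exp iter_ad_pchar //; apply: eq_bigr => i _; congr (_ * _ * _).
by rewrite /pencil derivD derivM derivX !derivC mul0r add0r mulr1 addr0.
Qed.

End LinearPencil.

(* Jacobson's formula: the coefficients of (xT + y)^p other than the extreme ones
   are, up to the factors 1, ..., p - 1, those of the iterated bracket
   ad(xT + y)^(p-1)(x), which is the derivative of (xT + y)^p with respect to T. *)
Section Jacobson.
Variables (F : fieldType) (p : nat) (pcharF : p \in [pchar F]).
Variables (A B : algType F) (L : {linear B -> A}) (H : nat -> B -> Prop).
Hypothesis HD : forall k u w, H k u -> H k w -> H k (u + w).
Hypothesis H0 : forall k, H k 0.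
Hypothesis H_ad : forall k u w, H 0 u -> H k w -> H k.+1 (ad u w).
Hypothesis L_ad : forall k u w, H 0 u -> H k w -> L (ad u w) = ad (L u) (L w).

(** The predicate [H k] holds of the brackets of k + 1 factors; it is applied to matrices of degree
    (k + 1) a. Only brackets with an element of [H 0] on the left occur in the iterated bracket, and
    L preserves those, so the middle coefficients cancel. *)
Lemma jacobson_transfer x y : H 0 x -> H 0 y ->
  (L x + L y) ^+ p - L ((x + y) ^+ p) = (L x ^+ p - L (x ^+ p)) + (L y ^+ p - L (y ^+ p)).
Proof.
move=> Hx Hy; have p_gt0 : (0 < p)%N by rewrite prime_gt0 // (pcharf_prime pcharF).
have coefs k i : H k (iter k (ad (pencil x y)) x%:P)`_i /\
    L (iter k (ad (pencil x y)) x%:P)`_i =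
    (iter k (ad (pencil (L x) (L y))) (L x)%:P)`_i.
  elim: k i => [|k IH] i.
    by rewrite /= !coefC; case: i => [|i] //=; rewrite linear0; split.
  rewrite !iterS !coef_pencil_ad linearD; case: i => [|i] /=.
    rewrite linear0 !add0r; have [h1 h2] := IH 0%N.
    by rewrite (L_ad Hy h1) h2; split=> //; exact: H_ad.
  have [h1 h2] := IH i; have [h3 h4] := IH i.+1.
  rewrite (L_ad Hx h1) (L_ad Hy h3) h2 h4; split=> //.
  by apply: HD; exact: H_ad.
have pcharA C : p \in [pchar (C : algType F)].
  by rewrite inE (pcharf_prime pcharF) -scaler_nat (pcharf0 pcharF) scale0r eqxx.
have mid i : (i.+1 < p)%N ->
    L (pencil x y ^+ p)`_i.+1 = (pencil (L x) (L y) ^+ p)`_i.+1.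
  move=> ip; have := (coefs p.-1 i).2; rewrite -!deriv_pencil_exp ?pcharA // !coef_deriv.
  rewrite linearMn -!scaler_nat; apply: scalerI.
  by rewrite -(dvdn_pcharf pcharF) gtnNdvd.
have ends (V : zmodType) (f : nat -> V) :
    \sum_(i < p.+1) f i = f 0%N + \sum_(i < p.-1) f i.+1 + f p.
  by rewrite big_ord_recr -(prednK p_gt0) big_ord_recl.
rewrite (sum_coef_pencil_exp (L x)) (sum_coef_pencil_exp x) linear_sum.
rewrite (ends _ (fun i => (pencil (L x) (L y) ^+ p)`_i)).
rewrite (ends _ (fun i => L (pencil x y ^+ p)`_i)) !coef_pencil_exp_top !coef_pencil_exp0.
rewrite (eq_bigr (fun i : 'I__ => L (pencil x y ^+ p)`_i.+1)) => [|i _]; last first.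
  by rewrite mid //; have := ltn_ord i; lia.
by lin_ring F; ring.
Qed.

End Jacobson.

Lemma scaler_comm (K : nzRingType) (R : lalgType K) (c : K) (c' u z : R) :
  (forall w, c *: w = c' * w) -> u * c' = c' * u -> u * (c *: z) = c *: (u * z).
Proof. by move=> h e; rewrite !h !mulrA e. Qed.

(** * Enveloping algebras *)

Section TensorAlgebra.
Variables (F : fieldType) (m : nat) (S : {set 'I_m * 'I_m}).
Local Notation TA := (tensor_alg F S).
Implicit Types (t : TA) (k : unit_idx S).

Definition tvar k : TA := << fmu k >>.

Lemma tensor_alg_ind (Q : TA -> Prop) : (forall x y, Q x -> Q y -> Q (x + y)) ->
  (forall c x, Q x -> Q (c *: x)) -> Q 1 -> (forall k x, Q x -> Q (tvar k * x)) ->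
  forall t, Q t.
Proof.
move=> QD QZ Q1 QX t.
have Q0 : Q 0 by rewrite -(scale0r (1 : TA)); exact: QZ.
rewrite (monalgE t); elim/big_ind: _ => // w _.
have -> : << t@_w *g w >> = t@_w *: << w >> :> TA.
  by apply/malgP => k; rewrite mcoeffZ !mcoeffU mulr_natr.
apply: QZ; case: w => w; elim: w => [|k w IH]; first by rewrite -fmoneE.
have -> : << FMonom (k :: w) >> = tvar k * << FMonom w >> :> TA; last exact: QX.
by rewrite /tvar malgM_def fgmulUU mulr1 fmuE /mmul /= fmmulE.
Qed.

Lemma tensor_scalerAr c (x y : TA) : x * (c *: y) = c *: (x * y).
Proof.
move: x; apply: tensor_alg_ind => [x z hx hz|a x hx||k x hx].
- by rewrite !mulrDl hx hz scalerDr.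
- by rewrite -!scalerAl hx !scalerA mulrC.
- by rewrite !mul1r.
- rewrite -!mulrA hx; move: (x * y) => z.
  have e : tvar k * malgC c = malgC c * tvar k.
    apply: etrans (fgmulUU _ _ _ _) _; apply/esym.
    by apply: etrans (fgmulUU _ _ _ _) _; rewrite mulr1 mul1r mulm1 mul1m.
  apply: (scaler_comm (c' := malgC c : TA)) e => u; apply/esym; exact: mul_malgC.
Qed.

Variables (A : nzRingType) (f : {rmorphism F -> A}) (g : 'I_m * 'I_m -> A).
Hypothesis fC : forall c a, f c * a = a * f c.
Local Notation fm := (@free_mor F m S A f g).

Definition word_val (w : {fmonom unit_idx S}) : A := \prod_(k <- w) g (val k).

Lemma word_val_morph : mmorphism word_val.
Proof.
split=> [u w|]; rewrite /word_val; last by rewrite fm1 big_nil.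
by rewrite fmM big_cat.
Qed.
HB.instance Definition _ := isMultiplicative.Build _ A word_val word_val_morph.

Lemma free_morD x y : fm (x + y) = fm x + fm y.
Proof. exact: (@mmapD _ _ _ f word_val x y). Qed.
Lemma free_morB x y : fm (x - y) = fm x - fm y.
Proof. exact: (@mmapB _ _ _ f word_val x y). Qed.
Lemma free_mor0 : fm 0 = 0.
Proof. exact: (@mmap0 _ _ _ f word_val). Qed.
Lemma free_morZ c x : fm (c *: x) = f c * fm x.
Proof. exact: (@mmapZ _ _ _ f word_val c x). Qed.
Lemma free_mor1 : fm 1 = 1.
Proof. exact: (@mmap1 _ _ _ f word_val). Qed.
Lemma free_morM x y : fm (x * y) = fm x * fm y.
Proof.
have [h _] := @commr_mmap_is_multiplicative _ _ _ f word_val (fun x w w' => fC x@_w (word_val w')).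
exact: h.
Qed.
Lemma free_morU k : fm (tvar k) = g (val k).
Proof.
transitivity (f 1 * word_val (fmu k)); first exact: (@mmapU _ _ _ f).
by rewrite rmorph1 mul1r /word_val fmuE /= big_seq1.
Qed.
Lemma free_morX x n : fm (x ^+ n) = fm x ^+ n.
Proof. by elim: n => [|n IH]; rewrite ?expr0 ?free_mor1 // !exprS free_morM IH. Qed.

End TensorAlgebra.

(** * From matrix units to homogeneous matrices *)

Section HomogeneousMatrices.
Variables (F : fieldType) (G : finZmodType) (m : nat) (deg : 'I_m -> G).

Lemma mx_homog_ind (a : G) (Q : 'M[F]_m -> Prop) : Q 0 ->
  (forall x y, Q x -> Q y -> Q (x + y)) -> (forall c x, Q x -> Q (c *: x)) ->
  (forall i j, deg i - deg j = a -> Q (delta_mx i j)) ->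
  forall x, mx_homog deg a x -> Q x.
Proof.
move=> Q0 QD QZ Qd x hx; rewrite (matrix_sum_delta x).
elim/big_ind: _ => // i _; elim/big_ind: _ => // j _.
case: (eqVneq (x i j) 0) => [->|ne]; first by rewrite scale0r.
by apply: QZ; apply: Qd; exact: hx.
Qed.

Lemma mx_homog_delta i j : mx_homog deg (deg i - deg j) (delta_mx i j : 'M[F]_m).
Proof. by move=> k l; rewrite mxE; case: andP => [[/eqP -> /eqP ->]|]; rewrite ?eqxx. Qed.

Lemma mx_homogD a (x y : 'M[F]_m) :
  mx_homog deg a x -> mx_homog deg a y -> mx_homog deg a (x + y).
Proof.
move=> hx hy i j; rewrite mxE; case: (eqVneq (x i j) 0) => [->|ne _]; last exact: hx.
by rewrite add0r; exact: hy.
Qed.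

Lemma mx_homogZ a c (x : 'M[F]_m) : mx_homog deg a x -> mx_homog deg a (c *: x).
Proof. by move=> hx i j; rewrite mxE mulf_eq0 negb_or => /andP[_ /hx]. Qed.

Lemma mx_homog0 a : mx_homog deg a (0 : 'M[F]_m).
Proof. by move=> i j; rewrite mxE eqxx. Qed.

Lemma mulmx_neq0 (x y : 'M[F]_m) i j : (x *m y) i j != 0 ->
  exists2 k, x i k != 0 & y k j != 0.
Proof.
rewrite mxE => ne; case: (pickP (fun k => x i k * y k j != 0)) => [k|h].
  by rewrite mulf_eq0 negb_or => /andP[]; exists k.
by case/eqP: ne; apply: big1 => k _; apply/eqP/negPn; rewrite h.
Qed.

Lemma mx_homogM a b (x y : 'M[F]_m) :
  mx_homog deg a x -> mx_homog deg b y -> mx_homog deg (a + b) (x *m y).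
Proof.
move=> hx hy i j /mulmx_neq0 [k /hx <- /hy <-].
by rewrite addrA subrK.
Qed.

End HomogeneousMatrices.

Lemma delta_mx_exp (R : comNzRingType) n (i j : 'I_n) q : (1 < q)%N ->
  delta_mx i j ^+ q = (i == j)%:R *: delta_mx i j :> 'M[R]_n.
Proof.
case: q => [|[|q]] // _; elim: q => [|q IH].
  by rewrite expr2 -mulmxE mul_delta_mx_cond scaler_nat eq_sym.
rewrite exprS IH -mulmxE -scalemxAr mul_delta_mx_cond eq_sym -scaler_nat scalerA.
by case: eqP => _; rewrite ?mulr1 ?mul0r.
Qed.

Section GlRepExtends.
Variables (F : fieldType) (p : nat) (pcharF : p \in [pchar F]).
Variables (G : finZmodType) (bc : G -> G -> F).
Hypothesis bcP : bicharacter bc.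
Variables (A : algType F) (n : nat).
Local Notation MM := 'M[F]_n.+1.
Variables (deg : 'I_n.+1 -> G) (c : 'I_n.+1 -> F) (E : 'I_n.+1 -> 'I_n.+1 -> A).
Hypothesis rep : gl_rep p bc deg c E.
Let L : {linear MM -> A} := gl_lin E.
Let LE i j : L (delta_mx i j) = E i j. Proof. exact: gl_lin_delta. Qed.
Let LZ u k : L (k *: u) = k *: L u. Proof. by rewrite linearZ. Qed.

Lemma gl_rep_defect a b x y : mx_homog deg a x -> mx_homog deg b y ->
  bracket_defect L (bc a b) x y = 0.
Proof.
move=> hx hy; move: x hx; apply: mx_homog_ind => [|x z hx hz|k x hx|i j ij].
- by rewrite -(scale0r 0) bracket_defectZl scale0r.
- by rewrite bracket_defectDl hx hz addr0.
- by rewrite bracket_defectZl hx scaler0.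
move: y hy; apply: mx_homog_ind => [|y z hy hz|k y hy|k l kl].
- by rewrite -(scale0r 0) bracket_defectZr scale0r.
- by rewrite bracket_defectDr hy hz addr0.
- by rewrite bracket_defectZr hy scaler0.
rewrite bracket_defectE !LE -ij -kl (gl_bracket rep) -!mulmxE !mul_delta_mx_cond.
by rewrite -!scaler_nat !LZ !LE subrr.
Qed.

Lemma gl_rep_bracket a b x y : mx_homog deg a x -> mx_homog deg b y ->
  L x * L y - bc a b *: (L y * L x) = L (color_bracket bc a b x y).
Proof. by move=> hx hy; apply/subr0_eq; exact: gl_rep_defect. Qed.

Variable chi : {scalar MM}.
Hypothesis chiP : standard_semisimple deg chi.
Hypothesis cE : forall i, c i = chi (delta_mx i i).

(** The relation is not linear in x, so sums need Jacobson's formula. For a in Gamma^+ the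
    bicharacter of a with its multiples is 1, and the colour brackets that occur there are ordinary
    commutators. *)
Lemma gl_rep_power a x : mx_homog deg a x -> bc a a = 1 ->
  L x ^+ p - L (x ^+ p) = (chi x ^+ p)%:A.
Proof.
move=> hx even; have p_gt1 : (1 < p)%N by rewrite prime_gt1 // (pcharf_prime pcharF).
pose H k (x : MM) := mx_homog deg (a *+ k.+1) x.
have evenk k : bc a (a *+ k.+1) = 1.
  by elim: k => // k IH; rewrite mulrS bcDr // even IH mulr1.
have H_ad k u w : H 0 u -> H k w -> H k.+1 (ad u w).
  move=> hu hw; rewrite /H mulrS /ad; apply: mx_homogD.
    exact: (mx_homogM hu hw).
  by rewrite -scaleN1r; apply: mx_homogZ; rewrite addrC; exact: (mx_homogM hw hu).
have L_ad k u w : H 0 u -> H k w -> L (ad u w) = ad (L u) (L w).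
  move=> hu hw; have := gl_rep_defect hu hw.
  by rewrite evenk /bracket_defect !scale1r => /subr0_eq.
suff [_ ->] : mx_homog deg a x /\ L x ^+ p - L (x ^+ p) = (chi x ^+ p)%:A by [].
move: x hx; apply: mx_homog_ind => [|x y [hx ex] [hy ey]|k x [hx ex]|i j ij].
- split; first exact: mx_homog0.
  by rewrite !linear0 !expr0n gtn_eqF ?(ltnW p_gt1) //= linear0 subr0 scale0r.
- split; first exact: mx_homogD.
  have HD k u w : H k u -> H k w -> H k (u + w) by exact: mx_homogD.
  have H0 k : H k 0 by exact: mx_homog0.
  rewrite !linearD (jacobson_transfer pcharF HD H0 H_ad L_ad hx hy) ex ey -scalerDl.
  by rewrite -!(pFrobenius_autE pcharF) pFrobenius_autD_comm //; exact: mulrC.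
- split; first exact: mx_homogZ.
  by rewrite !linearZ /= !exprZn linearZ /= -scalerBr ex exprMn scalerA.
split; first by rewrite -ij; exact: mx_homog_delta.
rewrite LE (gl_power rep) ?ij // delta_mx_exp //.
case: (eqVneq i j) => [->|ne].
  by rewrite !scale1r LE addrAC subrr add0r cE.
rewrite !scale0r linear0 subr0 (_ : chi _ = 0).
  by rewrite expr0n gtn_eqF ?(ltnW p_gt1) //= scale0r.
apply: chiP.2; case: (ltngtP i j) => h.
- by left=> k l; rewrite mxE; case: andP => [[/eqP -> /eqP ->]|] //; rewrite eqxx.
- by right=> k l; rewrite mxE; case: andP => [[/eqP -> /eqP ->]|] //; rewrite eqxx.
- by case/eqP: ne; exact: val_inj.
Qed.

End GlRepExtends.

(** The matrix ring of size 0 is trivial and falls outside the preceding section, hence the separate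
    case. *)
Lemma gl_rep_relations (F : fieldType) (p : nat) (pcharF : p \in [pchar F])
    (G : finZmodType) (bc : G -> G -> F) (bcP : bicharacter bc) (A : algType F) (m : nat)
    (deg : 'I_m -> G) (chi : {scalar 'M[F]_m}) (E : 'I_m -> 'I_m -> A) :
  standard_semisimple deg chi -> gl_rep p bc deg (fun i => chi (delta_mx i i)) E ->
  (forall a b x y, mx_homog deg a x -> mx_homog deg b y ->
    gl_lin E x * gl_lin E y - bc a b *: (gl_lin E y * gl_lin E x)
      = gl_lin E (color_bracket bc a b x y)) /\
  (forall a x, mx_homog deg a x -> bc a a = 1 ->
    gl_lin E x ^+ p - gl_lin E (x ^+ p) = (chi x ^+ p)%:A).
Proof.
case: m deg chi E => [|n] deg chi E chiP rep.
  have L0 x : gl_lin E x = 0 by rewrite /gl_lin big_ord0.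
  split=> [a b x y _ _|a x _ _]; rewrite !L0; first by rewrite mul0r scaler0 subr0.
  rewrite [x]flatmx0 (linear0 chi) !expr0n gtn_eqF ?prime_gt0 ?(pcharf_prime pcharF) //.
  by rewrite subr0 scale0r.
split=> [a b x y hx hy|a x hx even]; first exact: (gl_rep_bracket rep).
exact: (gl_rep_power pcharF bcP rep chiP (fun=> erefl) hx even).
Qed.

(** * The algebras u_chi and the maps between them *)

Section Uchi.
Variables (F : fieldType) (p : nat) (pcharF : p \in [pchar F]).
Variables (G : finZmodType) (bc : G -> G -> F).
Variables (m : nat) (deg : 'I_m -> G) (chi : {scalar 'M[F]_m}).
Local Notation U S := (uchi bc deg p chi S).
Local Notation TA S := (tensor_alg F S).
Local Notation rel S := (@uchi_rel F G m bc deg p chi S).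
Local Notation idx := ('I_m * 'I_m)%type.
Implicit Types S : {set idx}.

Definition upi S (t : TA S) : U S := (\pi_(ideal_quot (rel S)) t)%qT.

Lemma upiM S (x y : TA S) : upi (x * y) = upi x * upi y.
Proof. exact: iq_pi_mul. Qed.
Lemma upiD S (x y : TA S) : upi (x + y) = upi x + upi y.
Proof. exact: iq_pi_add. Qed.
Lemma upiZ S k (x : TA S) : upi (k *: x) = k *: upi x.
Proof. exact: iq_pi_scale. Qed.
Lemma upi1 S : upi (1 : TA S) = 1.
Proof. by []. Qed.
Lemma upi_repr S (x : U S) : upi (repr x) = x.
Proof. exact: reprK. Qed.
Lemma upiB S (x y : TA S) : upi (x - y) = upi x - upi y.
Proof. by rewrite -scaleN1r upiD upiZ scaleN1r. Qed.
Lemma upi0 S : upi (0 : TA S) = 0.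
Proof. by rewrite -(scale0r 0) upiZ scale0r. Qed.
Lemma upiX S (x : TA S) n : upi (x ^+ n) = upi x ^+ n.
Proof. by elim: n => // n IH; rewrite !exprS upiM IH. Qed.
Lemma upiP S (x y : TA S) : upi x = upi y <-> x - y \in zspan_pred (ideal_elt (rel S)).
Proof. by rewrite -ideal_quotE; split=> /eqP. Qed.

Lemma uchi_scaleAl S k (x y : U S) : k *: (x * y) = (k *: x) * y.
Proof. by rewrite -[x]upi_repr -[y]upi_repr -upiM -!upiZ -upiM -scalerAl. Qed.
Lemma uchi_scaleAr S k (x y : U S) : k *: (x * y) = x * (k *: y).
Proof. by rewrite -[x]upi_repr -[y]upi_repr -upiM -!upiZ -upiM tensor_scalerAr. Qed.

Lemma iotaT_linear S : linear (@iotaT F m S).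
Proof.
move=> k x y; rewrite scaler_sumr -big_split; apply: eq_bigr => i _.
by rewrite !mxE scalerDl scalerA.
Qed.
HB.instance Definition _ S :=
  GRing.isLinear.Build F 'M[F]_m (TA S) _ (@iotaT F m S) (iotaT_linear S).

Lemma iotaT_delta S (k : unit_idx S) : iotaT S (delta_mx (val k).1 (val k).2) = tvar F k.
Proof.
rewrite /iotaT (bigD1 k) //= mxE !eqxx scale1r big1 ?addr0 // => l ne.
rewrite mxE; case: andP => [[/eqP e1 /eqP e2]|_]; last by rewrite scale0r.
case/eqP: ne; apply: val_inj; move: e1 e2; rewrite /=.
by case: (val l) (val k) => [a b] [a' b'] /= -> ->.
Qed.

Definition uiota S (x : 'M[F]_m) : U S := Defs.iota bc deg p chi S x.
Lemma iota_linear S : linear (uiota S).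
Proof. by move=> k x y; rewrite /uiota /Defs.iota linearP -/(upi _) upiD upiZ. Qed.
HB.instance Definition _ S := GRing.isLinear.Build F 'M[F]_m (U S) _ (uiota S) (iota_linear S).

Lemma uiotaE S x : uiota S x = upi (iotaT S x). Proof. by []. Qed.

Lemma uchi_ind S (Q : U S -> Prop) : (forall x y, Q x -> Q y -> Q (x + y)) ->
  (forall k x, Q x -> Q (k *: x)) -> Q 1 ->
  (forall i j x, (i, j) \in S -> Q x -> Q (uiota S (delta_mx i j) * x)) -> forall x, Q x.
Proof.
move=> QD QZ Q1 QM x; rewrite -[x]upi_repr; move: (repr x).
apply: tensor_alg_ind => [y z|k y||k y] /=.
- by rewrite upiD; exact: QD.
- by rewrite upiZ; exact: QZ.
- by rewrite upi1.
- rewrite upiM -iotaT_delta -uiotaE; case: k => [[i j] ij] /=; exact: QM.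
Qed.

Lemma uchi_bracketE S a b x y : in_sub S x -> in_sub S y ->
  mx_homog deg a x -> mx_homog deg b y ->
  uiota S x * uiota S y - bc a b *: (uiota S y * uiota S x) = uiota S (color_bracket bc a b x y).
Proof.
move=> Sx Sy hx hy; rewrite !uiotaE -!upiM -upiZ -upiB; apply/upiP/asboolP; apply: zspan_gen.
exists 1, (iotaT S x * iotaT S y - bc a b *: (iotaT S y * iotaT S x)
  - iotaT S (color_bracket bc a b x y)), 1.
by split; [exact: uchi_bracket|rewrite mul1r mulr1].
Qed.

Lemma uchi_powerE S a x : in_sub S x -> mx_homog deg a x -> bc a a = 1 ->
  uiota S x ^+ p = uiota S (x ^+ p) + (chi x ^+ p) *: (1 : U S).
Proof.
move=> Sx hx even; rewrite !uiotaE -upiX -upi1 -upiZ -upiD; apply/upiP/asboolP; apply: zspan_gen.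
exists 1, (iotaT S x ^+ p - iotaT S (x ^+ p) - (chi x ^+ p)%:A), 1.
split; first exact: (@uchi_pth F G m bc deg p chi S a x).
by rewrite mul1r mulr1 opprD addrA.
Qed.

Section Lift.
Variables (S : {set idx}) (A : nzRingType) (f : {rmorphism F -> A}) (g : idx -> A).
Hypothesis fC : forall c a, f c * a = a * f c.
Local Notation fm := (@free_mor F m S A f g).

Lemma free_mor_iotaT x : fm (iotaT S x) = \sum_(k in S) f (x k.1 k.2) * g k.
Proof.
rewrite big_sub /iotaT; elim/big_rec2: _ => [|k y z _ <-]; first exact: free_mor0.
by rewrite free_morD (free_morZ f g) free_morU.
Qed.

(** The target N is left open for two uses: the defining ideal of a larger u_chi, which gives the
    inclusions, and the zero ideal, which gives the action on the model. *)
Lemma free_mor_ideal (N : A -> Prop) : N 0 -> (forall x y, N x -> N y -> N (x - y)) ->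
  (forall a r b, N r -> N (a * r * b)) -> (forall r, rel S r -> N (fm r)) ->
  forall x, x \in zspan_pred (ideal_elt (rel S)) -> N (fm x).
Proof.
move=> N0 NB NM Nr x /asboolP; elim=> [_ [a [r [b [hr ->]]]]||y z _ hy _ hz].
- by rewrite !(free_morM g fC); apply: NM; exact: Nr.
- by rewrite free_mor0.
- by rewrite free_morB; exact: NB.
Qed.

End Lift.

Section Inclusion.
Variables (S T : {set idx}).
Hypothesis ST : S \subset T.
Hypothesis S_trans : forall i j k, (i, j) \in S -> (j, k) \in S -> (i, k) \in S.

Lemma in_sub_mul (x y : 'M[F]_m) : in_sub S x -> in_sub S y -> in_sub S (x *m y).
Proof. by move=> hx hy i j /mulmx_neq0 [k /hx h1 /hy]; exact: S_trans. Qed.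

Lemma in_sub_bracket a b (x y : 'M[F]_m) :
  in_sub S x -> in_sub S y -> in_sub S (color_bracket bc a b x y).
Proof.
move=> hx hy i j; rewrite !mxE; case: (eqVneq ((x *m y) i j) 0) => [e|ne _].
  rewrite mxE in e; rewrite e add0r oppr_eq0 mulf_eq0 negb_or => /andP[_ ne].
  by apply: (in_sub_mul hy hx); rewrite mxE.
exact: (in_sub_mul hx hy).
Qed.

Lemma in_sub_exp (x : 'M[F]_m) n : in_sub S x -> in_sub S (x ^+ n.+1).
Proof.
move=> hx; elim: n => [|n IH]; first by rewrite expr1.
by rewrite exprS; exact: in_sub_mul.
Qed.

Local Notation A := (tensor_alg F T).
Local Notation inA := (@GRing.in_alg F A).
Definition incl_mor : TA S -> TA T :=
  free_mor (fun c => c%:A : tensor_alg F T) (fun k => iotaT T (delta_mx k.1 k.2)).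

Let inC c (a : A) : inA c * a = a * inA c.
Proof. by rewrite /GRing.in_alg /= -scalerAl mul1r tensor_scalerAr mulr1. Qed.

Lemma incl_morM x y : incl_mor (x * y) = incl_mor x * incl_mor y.
Proof. exact: (free_morM (f := inA) _ inC). Qed.
Lemma incl_morD x y : incl_mor (x + y) = incl_mor x + incl_mor y.
Proof. exact: (free_morD inA). Qed.
Lemma incl_morB x y : incl_mor (x - y) = incl_mor x - incl_mor y.
Proof. exact: (free_morB inA). Qed.
Lemma incl_morZ k x : incl_mor (k *: x) = k *: incl_mor x.
Proof. by apply: etrans (free_morZ inA _ k x) _; rewrite /= -scalerAl mul1r. Qed.
Lemma incl_mor1 : incl_mor 1 = 1.
Proof. exact: (@free_mor1 F m S A inA). Qed.
Lemma incl_morX x n : incl_mor (x ^+ n) = incl_mor x ^+ n.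
Proof. exact: (free_morX (f := inA) _ inC). Qed.

Lemma incl_mor_bracket x y z x' y' z' k :
  incl_mor x = x' -> incl_mor y = y' -> incl_mor z = z' ->
  incl_mor (x * y - k *: (y * x) - z) = x' * y' - k *: (y' * x') - z'.
Proof. by move=> <- <- <-; rewrite !incl_morB incl_morZ !incl_morM. Qed.
Lemma incl_mor_power x y x' y' n k : incl_mor x = x' -> incl_mor y = y' ->
  incl_mor (x ^+ n - y - k%:A) = x' ^+ n - y' - k%:A.
Proof. by move=> <- <-; rewrite !incl_morB incl_morZ incl_mor1 incl_morX. Qed.

Lemma incl_mor_iotaT x : in_sub S x -> incl_mor (iotaT S x) = iotaT T x.
Proof.
move=> Sx; transitivity (\sum_(k in S) inA (x k.1 k.2) * iotaT T (delta_mx k.1 k.2)).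
  exact: (@free_mor_iotaT S A inA).
rewrite {2}(matrix_sum_delta x) pair_bigA linear_sum /= big_mkcond /=.
apply: eq_bigr => -[i j] _ /=; rewrite linearZ /= -scalerAl mul1r.
case: ifP => // /negbT; apply: contraNeq; rewrite eq_sym scaler_eq0 negb_or => /andP[ne _].
exact: Sx.
Qed.

Lemma incl_mor_ideal x :
  x \in zspan_pred (ideal_elt (rel S)) -> incl_mor x \in zspan_pred (ideal_elt (rel T)).
Proof.
have inST y : in_sub S y -> in_sub T y.
  by move=> h i j /h; exact: (fintype.subsetP ST).
have p0 : (0 < p)%N by rewrite prime_gt0 // (pcharf_prime pcharF).
pose N z := z \in zspan_pred (ideal_elt (rel T)).
have N0 : N 0 by exact: rpred0.
have NB y z : N y -> N z -> N (y - z) by exact: rpredB.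
have NM a r b : N r -> N (a * r * b) by move=> hr; apply: ideal_mulr; exact: ideal_mull.
have Nr r : rel S r -> N (incl_mor r).
  move=> hr; apply/asboolP; apply: zspan_gen; exists 1, (incl_mor r), 1.
  split; last by rewrite mul1r mulr1.
  case: hr => [a b y z Sy Sz hy hz|a y Sy hy even].
    have Syz := @in_sub_bracket a b _ _ Sy Sz.
    rewrite (incl_mor_bracket _ (incl_mor_iotaT Sy) (incl_mor_iotaT Sz) (incl_mor_iotaT Syz)).
    by apply: uchi_bracket => //; exact: inST.
  have Syp : in_sub S (y ^+ p) by rewrite -(prednK p0); exact: in_sub_exp.
  rewrite (incl_mor_power _ _ (incl_mor_iotaT Sy) (incl_mor_iotaT Syp)).
  by apply: (@uchi_pth F G m bc deg p chi T a y) => //; exact: inST.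
exact: (@free_mor_ideal S A inA (fun k => iotaT T (delta_mx k.1 k.2)) inC N).
Qed.

(** This frees [uchi_incl], defined through [repr], from the choice of a representative. *)
Lemma uchi_inclE (t : TA S) :
  @uchi_incl F G m bc deg p chi S T (upi t) = upi (incl_mor t).
Proof.
apply/upiP; rewrite -incl_morB; apply: incl_mor_ideal; apply/upiP.
exact: upi_repr.
Qed.

End Inclusion.

End Uchi.

(** * Highest weight modules *)

Section GlModules.
Variables (F : fieldType) (p : nat) (pcharF : p \in [pchar F]).
Variables (G : finZmodType) (bc : G -> G -> F).
Hypothesis bcP : bicharacter bc.
Variables (m : nat) (deg : 'I_m -> G) (c : 'I_m -> F).
Local Notation idx := ('I_m * 'I_m)%type.

Definition unit_ht (k : idx) : int := (k.2 : nat)%:Z - (k.1 : nat)%:Z.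
Definition unit_order (k : idx) : nat :=
  if k.1 == k.2 then p else color_order p bc (deg k.1 - deg k.2).

(** What reordering needs to know about the operators, in a form shared by the model and by the
    modules over u_chi(g). *)
Record gl_module (T : lmodType F) (X : idx -> {linear T -> T}) : Prop := GlModule {
  glm_bracket : forall i j k l z,
    X (i, j) (X (k, l) z) - bc (deg i - deg j) (deg k - deg l) *: X (k, l) (X (i, j) z) =
    (j == k)%:R *: X (i, l) z
    - bc (deg i - deg j) (deg k - deg l) *: ((l == i)%:R *: X (k, j) z);
  glm_root : forall i j z, i != j -> iter (unit_order (i, j)) (X (i, j)) z = 0;
  glm_diag : forall i z, iter p (X (i, i)) z = X (i, i) z + c i ^+ p *: z
}.

Lemma unit_order_gt0 k : (0 < unit_order k)%N.
Proof.
rewrite /unit_order; case: ifP => _; last exact: color_order_gt0.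
by rewrite prime_gt0 // (pcharf_prime pcharF).
Qed.

Lemma unit_order_gt1 k : (1 < unit_order k)%N.
Proof.
by rewrite /unit_order /color_order; do 2?case: ifP => _ //;
  rewrite prime_gt1 // (pcharf_prime pcharF).
Qed.

Lemma unit_order_opp k : unit_order (opp_root k) = unit_order k.
Proof.
rewrite /unit_order /opp_root /color_order /= eq_sym -(opprB (deg k.1)).
by rewrite bcNl // bcNr // invrK.
Qed.

Section Straighten.
Variables (T : lmodType F) (X : idx -> {linear T -> T}) (glm : gl_module X).

Lemma glm_straighten ks w z : uniq ks -> (forall k, k \in ks) ->
  fspan (fun y => exists a, [/\ forall k, (a k < unit_order k)%N,
    word_ht unit_ht (block_word ks a) = word_ht unit_ht w
    & y = act X (block_word ks a) z]) (act X w z).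
Proof.
apply: act_block_word => [[i j] [k l]|[i j] u].
  exists (bc (deg i - deg j) (deg k - deg l)) => u; rewrite (glm_bracket glm).
  apply: fspanD; last first.
    rewrite -scaleNr; apply: fspanZ.
    case: (l =P i) => [->|_]; last by rewrite scale0r; exact: fspan0.
    rewrite scale1r; apply: fspan_gen; exists (k, j) => //.
    by rewrite /unit_ht /=; lia.
  case: (j =P k) => [->|_]; last by rewrite scale0r; exact: fspan0.
  rewrite scale1r; apply: fspan_gen; exists (i, l) => //.
  by rewrite /unit_ht /=; lia.
case: (eqVneq i j) => [<-|ne]; last by rewrite (glm_root glm) //; exact: fspan0.
have -> : iter (unit_order (i, i)) (X (i, i)) u = X (i, i) u + c i ^+ p *: u.
  by rewrite -(glm_diag glm) /unit_order eqxx.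
rewrite /unit_ht /= subrr mul0rn.
apply: fspanD; last apply: fspanZ; apply: fspan_gen.
  by exists [:: (i, i)]; rewrite unit_order_gt1 word_ht1 /unit_ht /= subrr.
by exists [::]; rewrite unit_order_gt0 /word_ht big_nil.
Qed.

End Straighten.

Variable delta : seq idx.
Hypotheses (delta_uniq : uniq delta) (deltaE : delta =i [pred x : idx | (x.1 < x.2)%N]).

Definition neg : seq idx := [seq opp_root x | x <- delta].
Definition diag : seq idx := [seq (i, i) | i <- enum 'I_m].

Lemma opp_rootK : involutive (@opp_root m). Proof. by case. Qed.

Lemma mem_neg k : (k \in neg) = (k.2 < k.1)%N.
Proof.
by rewrite -[k]opp_rootK mem_map ?deltaE //; exact: inv_inj opp_rootK.
Qed.

Lemma mem_diag k : (k \in diag) = (k.1 == k.2).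
Proof.
apply/mapP/eqP => [[i _ ->]//|]; case: k => i j /= <-.
by exists i; rewrite ?mem_enum.
Qed.

Lemma neg_uniq : uniq neg.
Proof. by rewrite map_inj_uniq //; exact: inv_inj opp_rootK. Qed.

Lemma diag_uniq : uniq diag.
Proof. by rewrite map_inj_uniq ?enum_uniq // => i j []. Qed.

Lemma ndp_uniq : uniq (neg ++ diag ++ delta).
Proof.
rewrite !cat_uniq neg_uniq diag_uniq delta_uniq /= andbT; apply/andP; split.
  apply/hasPn => k; rewrite mem_cat mem_diag deltaE mem_neg inE /=.
  by case/orP => [/eqP ->|h]; rewrite ?ltnn // -leqNgt ltnW.
by apply/hasPn => k; rewrite mem_diag deltaE inE /= => h; rewrite -val_eqE ltn_eqF.
Qed.

Lemma pdn_perm : perm_eq (delta ++ diag ++ neg) (neg ++ diag ++ delta).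
Proof. by rewrite perm_catC -catA perm_catCA. Qed.

Lemma pdn_uniq : uniq (delta ++ diag ++ neg).
Proof. by rewrite (perm_uniq pdn_perm) ndp_uniq. Qed.

Lemma ndp_all k : k \in neg ++ diag ++ delta.
Proof.
rewrite !mem_cat mem_neg mem_diag deltaE inE /= -val_eqE /=.
by case: ltngtP.
Qed.

Lemma pdn_all k : k \in delta ++ diag ++ neg.
Proof. by rewrite (perm_mem pdn_perm) ndp_all. Qed.

Lemma block_word_ht (h : idx -> int) ks a :
  word_ht h (block_word ks a) = \sum_(k <- ks) h k *+ a k.
Proof.
elim: ks => [|k ks IH]; first by rewrite /word_ht !big_nil.
by rewrite block_word_cons word_ht_cat word_ht_nseq IH big_cons.
Qed.

(** All letters have positive height, so the total is strictly monotone in each exponent and equal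
    totals force equal words. The negative roots are covered by changing the sign of the height. *)
Lemma block_word_ht_max (h : idx -> int) ks (a b : idx -> nat) :
  (forall k, k \in ks -> 0 < h k) -> (forall k, (a k <= b k)%N) ->
  word_ht h (block_word ks a) <= word_ht h (block_word ks b) /\
  (word_ht h (block_word ks a) = word_ht h (block_word ks b) ->
    block_word ks a = block_word ks b).
Proof.
move=> + ab; rewrite !block_word_ht; elim: ks => [|k ks IH] hk; first by rewrite !big_nil.
have [|le eq] := IH; first by move=> l lks; apply: hk; rewrite in_cons lks orbT.
have k0 : 0 < h k by apply: hk; rewrite mem_head.
have ek : h k *+ b k = h k *+ a k + h k *+ (b k - a k) by rewrite -mulrnDr subnKC.
have le_k : h k *+ a k <= h k *+ b k by rewrite ek lerDl mulrn_wge0 // ltW.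
rewrite !big_cons; split=> [|e]; first exact: lerD.
have e1 : h k *+ a k = h k *+ b k.
  by apply/le_anti; rewrite le_k /= -(lerD2r (\sum_(j <- ks) h j *+ a j)) e lerD2l.
rewrite !block_word_cons eq; last by apply: (addrI (h k *+ a k)); rewrite e e1.
congr (nseq _ _ ++ _); apply/eqP; rewrite eqn_leq ab /= leqNgt; apply/negP => lt.
have := pmulrn_rgt0 (b k - a k)%N k0; rewrite subn_gt0 lt.
by rewrite -(ltrD2l (h k *+ a k)) -ek e1 addr0 ltxx.
Qed.

Definition top_exp (k : idx) : nat := (unit_order k).-1.
Definition bot_word : seq idx := block_word neg top_exp.
Definition top_word : seq idx := block_word delta top_exp.
Local Notation wht := (word_ht unit_ht).

Lemma le_top_exp (a : idx -> nat) k : (forall k, (a k < unit_order k)%N) -> (a k <= top_exp k)%N.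
Proof. by move=> /(_ k); rewrite /top_exp; case: (unit_order k). Qed.

Lemma wht_opp w : word_ht (fun k => - unit_ht k) w = - wht w.
Proof. by rewrite /word_ht sumrN. Qed.

Lemma wht_neg_min a : (forall k, (a k < unit_order k)%N) ->
  wht bot_word <= wht (block_word neg a) /\
  (wht (block_word neg a) = wht bot_word -> block_word neg a = bot_word).
Proof.
move=> ha; have := @block_word_ht_max (fun k => - unit_ht k) neg a top_exp.
rewrite !wht_opp; case=> [k||le eq].
- by rewrite mem_neg /unit_ht /= => h; lia.
- by move=> k; exact: le_top_exp.
- by split=> [|e]; [rewrite -lerN2|apply: eq; rewrite e].
Qed.

Lemma wht_pos_max a : (forall k, (a k < unit_order k)%N) ->
  wht (block_word delta a) <= wht top_word /\
  (wht (block_word delta a) = wht top_word -> block_word delta a = top_word).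
Proof.
move=> ha; apply: block_word_ht_max => k; last exact: le_top_exp.
by rewrite deltaE inE /unit_ht; lia.
Qed.

Lemma wht_top_bot : wht top_word + wht bot_word = 0.
Proof.
rewrite /top_word /bot_word !block_word_ht /neg big_map -big_split big1 // => k _.
by rewrite /= /top_exp unit_order_opp -mulrnDl /unit_ht /=; lia.
Qed.

Lemma mem_block_word (ks : seq idx) a k : k \in block_word ks a -> k \in ks.
Proof. by case/flatten_mapP => l lks; rewrite mem_nseq => /andP[_ /eqP ->]. Qed.

Lemma wht_diag (w : seq idx) : {subset w <= diag} -> wht w = 0.
Proof.
move=> h; rewrite /word_ht big_seq big1 // => k /h; rewrite mem_diag /unit_ht => /eqP ->.
exact: subrr.
Qed.

Section HighestWeight.
Variables (T : lmodType F) (X : idx -> {linear T -> T}) (glm : gl_module X).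
Variables (v : T) (lam : 'I_m -> F).
Hypothesis hw : forall i j : 'I_m, (i < j)%N -> X (i, j) v = 0.
Hypothesis wt : forall i, X (i, i) v = lam i *: v.

Lemma act_pos (w : seq idx) : {subset w <= delta} -> w != [::] -> act X w v = 0.
Proof.
case/lastP: w => // w k h _; rewrite -cats1 act_cat /=.
have : k \in delta by apply: h; rewrite mem_rcons mem_head.
by case: k {h} => i j; rewrite deltaE inE /= => /hw ->; rewrite linear0.
Qed.

Lemma act_diag (w : seq idx) : {subset w <= diag} -> exists k, act X w v = k *: v.
Proof.
elim: w => [|[i j] w IH] h; first by exists 1; rewrite scale1r.
have [|k e] := IH; first by move=> l lw; apply: h; rewrite in_cons lw orbT.
have /eqP /= <- : i == j by rewrite -(mem_diag (i, j)); apply: h; rewrite mem_head.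
by exists (k * lam i); rewrite /= e linearZ /= wt scalerA.
Qed.

(** In the order N^-, H, N^+ a nonempty positive part kills v, and the diagonal part then acts on v
    by a scalar. *)
Lemma neg_span w : fspan (fun y => exists a, [/\ forall k, (a k < unit_order k)%N,
  wht (block_word neg a) = wht w & y = act X (block_word neg a) v]) (act X w v).
Proof.
apply: fspan_sub (glm_straighten glm w v ndp_uniq ndp_all) => _ [a [ha <- ->]].
have subw ks : {subset block_word ks a <= ks} by move=> k; exact: mem_block_word.
rewrite !block_word_cat !act_cat; case: (eqVneq (block_word delta a) [::]) => [e|ne].
  rewrite e !word_ht_cat (wht_diag (subw diag)) /word_ht big_nil !addr0 /=.
  have [k ->] := act_diag (subw diag); rewrite linearZ; apply: fspanZ.
  by apply: fspan_gen; exists a.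
by rewrite (act_pos (subw delta)) // !linear0; exact: fspan0.
Qed.

Lemma fspan_line (Q : T -> Prop) u z :
  (forall y, Q y -> exists k, y = k *: u) -> fspan Q z -> exists k, z = k *: u.
Proof.
move=> h; elim=> [y /h//||x y _ [k ->] _ [l ->]|l x _ [k ->]].
- by exists 0; rewrite scale0r.
- by exists (k + l); rewrite scalerDl.
- by exists (l * k); rewrite scalerA.
Qed.

Definition bot_vec : T := act X bot_word v.

Lemma act_below w : wht w < wht bot_word -> act X w v = 0.
Proof.
move=> lt; have [|k ->] := fspan_line (u := 0) _ (neg_span w); last exact: scaler0.
by move=> y [a [/wht_neg_min [le _] e _]]; move: lt; rewrite -e ltNge le.
Qed.

Lemma act_bot w : wht w = wht bot_word -> exists k, act X w v = k *: bot_vec.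
Proof.
move=> e; apply: fspan_line (neg_span w) => _ [a [/wht_neg_min [_ h] ea ->]].
by exists 1; rewrite scale1r h // ea.
Qed.

Lemma wht_neg_lt0 (w : seq idx) : {subset w <= neg} -> w != [::] -> wht w < 0.
Proof.
elim: w => // k w IH h _; rewrite word_ht_cons.
have : unit_ht k < 0.
  have : k \in neg by apply: h; rewrite mem_head.
  by rewrite mem_neg /unit_ht /= => lt; lia.
case: (eqVneq w [::]) => [->|ne]; first by rewrite /word_ht big_nil addr0.
have /IH -/(_ ne) : {subset w <= neg} by move=> l lw; apply: h; rewrite in_cons lw orbT.
by lia.
Qed.

Lemma act_ht0 w : wht w = 0 -> exists k, act X w v = k *: v.
Proof.
move=> e; apply: fspan_line (neg_span w) => _ [a [_ ea ->]]; rewrite e in ea.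
case: (eqVneq (block_word neg a) [::]) => [->|ne]; first by exists 1; rewrite scale1r.
by have := wht_neg_lt0 (fun k => @mem_block_word neg a k) ne; rewrite ea ltxx.
Qed.

Variable phi : {linear T -> F^o}.
Hypothesis phi_neg : forall (i j : 'I_m) z, (j < i)%N -> phi (X (i, j) z) = 0.

Lemma phi_act_lt0 w : wht w < 0 -> phi (act X w v) = 0.
Proof.
move=> lt; have : fspan (fun y => y = 0) (phi (act X w v)); last first.
  by elim=> [y ->//|//|x y _ -> _ ->|k x _ ->]; rewrite ?addr0 ?scaler0.
apply: fspan_image (neg_span w) => _ [a [_ ea ->]]; apply: fspan_gen.
have := fun k => @mem_block_word neg a k; case: (block_word neg a) ea => [|[i j] w'] ea h.
  by move: lt; rewrite -ea /word_ht big_nil ltxx.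
by rewrite /= phi_neg // -(mem_neg (i, j)); apply: h; rewrite mem_head.
Qed.

(** Use the order N^+, H, N^-. The part from H and N^- sends [bot_vec] to 0 or to a multiple of
    itself, by height. The positive part on the left is then either [top_word], which gives 0 by
    hypothesis, or it leaves a vector of negative height, on which [phi] vanishes. *)
Lemma phi_act_bot w : act X top_word bot_vec = 0 -> phi (act X w bot_vec) = 0.
Proof.
move=> EF0; have : fspan (fun y => y = 0) (phi (act X w bot_vec)); last first.
  by elim=> [y ->//|//|x y _ -> _ ->|k x _ ->]; rewrite ?addr0 ?scaler0.
apply: fspan_image (glm_straighten glm w bot_vec pdn_uniq pdn_all) => _ [a [ha _ ->]].
apply: fspan_gen; pose u := (block_word diag a ++ block_word neg a) ++ bot_word.
have -> : act X (block_word (delta ++ diag ++ neg) a) bot_vec =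
    act X (block_word delta a) (act X u v) by rewrite !block_word_cat !act_cat.
have htu : wht u = wht (block_word neg a) + wht bot_word.
  by rewrite /u !word_ht_cat (@wht_diag (block_word diag a)) ?add0r // => k; exact: mem_block_word.
have le0 : wht (block_word neg a) <= 0.
  case: (eqVneq (block_word neg a) [::]) => [->|ne]; first by rewrite /word_ht big_nil.
  by apply/ltW/wht_neg_lt0 => // k; exact: mem_block_word.
case: (ltrP (wht u) (wht bot_word)) => [lt|ge]; first by rewrite (act_below lt) !linear0.
have [|k ->] := @act_bot u; first by lia.
have [le eq] := wht_pos_max ha; have tb := wht_top_bot.
rewrite linearZ linearZ /= /bot_vec -act_cat.
case: (eqVneq (wht (block_word delta a)) (wht top_word)) => [/eq ->|ne].
  by rewrite act_cat EF0 linear0 scaler0.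
rewrite phi_act_lt0 ?scaler0 // word_ht_cat.
by move/eqP: ne; lia.
Qed.

End HighestWeight.

End GlModules.

(* The structure map of an F-algebra which is only known to be a pzRingType, as are
   the u_chi. *)
Record scalars (F : fieldType) (U : pzRingType) := Scalars {
  scal :> F -> U;
  scalD : forall a b, scal (a + b) = scal a + scal b;
  scalM : forall a b, scal (a * b) = scal a * scal b;
  scal1 : scal 1 = 1;
  scalC : forall a u, u * scal a = scal a * u
}.

Section RestrictScalars.
Variables (F : fieldType) (U : pzRingType) (sc : scalars F U) (N : lmodType U).

(** The structure map is recorded in the type, so that the F-module structure can be inferred from
    it. *)
Definition resF of scalars F U : Type := N.
Local Notation R := (resF sc).
HB.instance Definition _ := GRing.Zmodule.on R.

Definition umul (u : U) (z : R) : R := u *: (z : N).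

Lemma umulM u w z : umul (u * w) z = umul u (umul w z).
Proof. exact: (esym (scalerA u w (z : N))). Qed.
Lemma umulD u w z : umul (u + w) z = umul u z + umul w z.
Proof. exact: (scalerDl (z : N) u w). Qed.
Lemma umulDr u x y : umul u (x + y) = umul u x + umul u y.
Proof. exact: (scalerDr u (x : N) (y : N)). Qed.
Lemma umulN u z : umul (- u) z = - umul u z.
Proof. exact: (scaleNr u (z : N)). Qed.
Lemma umul1 z : umul 1 z = z.
Proof. exact: (scale1r (z : N)). Qed.
Lemma umul0 z : umul 0 z = 0.
Proof. exact: (scale0r (z : N)). Qed.
Lemma umulX u n z : umul (u ^+ n) z = iter n (umul u) z.
Proof. by elim: n => [|n IH]; rewrite ?umul1 // exprS umulM IH. Qed.

Definition res_scale (k : F) (z : R) : R := umul (sc k) z.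

Lemma res_scaleA k l z : res_scale k (res_scale l z) = res_scale (k * l) z.
Proof. by rewrite /res_scale scalM umulM. Qed.
Lemma res_scale1 : left_id 1 res_scale.
Proof. by move=> z; rewrite /res_scale scal1 umul1. Qed.
Lemma res_scaleDr : right_distributive res_scale +%R.
Proof. by move=> k x y; exact: umulDr. Qed.
Lemma res_scaleDl z : {morph res_scale^~ z : a b / a + b}.
Proof. by move=> a b; rewrite /res_scale scalD umulD. Qed.

HB.instance Definition _ := GRing.Zmodule_isLmodule.Build F R
  res_scaleA res_scale1 res_scaleDr res_scaleDl.

Lemma res_scaleE k (z : R) : k *: z = umul (sc k) z. Proof. by []. Qed.
Lemma umulZ k u z : umul (sc k * u) z = k *: umul u z.
Proof. by rewrite umulM. Qed.

Lemma umul_linear u : linear (umul u).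
Proof. by move=> k x y; rewrite umulDr !res_scaleE -!umulM scalC. Qed.
HB.instance Definition _ u := GRing.isLinear.Build F R R _ (umul u) (umul_linear u).

End RestrictScalars.

Section AlgebraOfGl.
Variables (F : fieldType) (p : nat) (G : finZmodType) (bc : G -> G -> F).
Variables (m : nat) (deg : 'I_m -> G) (c : 'I_m -> F).
Local Notation idx := ('I_m * 'I_m)%type.
Variables (U : pzRingType) (sc : scalars F U) (g : idx -> U).

(** Relations and generation only: the study of highest weight modules below does not look into the
    quotient that defines u_chi(g). *)
Record gl_algebra : Prop := GlAlgebra {
  gla_bracket : forall i j k l,
    g (i, j) * g (k, l) - sc (bc (deg i - deg j) (deg k - deg l)) * (g (k, l) * g (i, j)) =
    sc (j == k)%:R * g (i, l)
    - sc (bc (deg i - deg j) (deg k - deg l)) * (sc (l == i)%:R * g (k, j));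
  gla_root : forall i j, i != j -> g (i, j) ^+ unit_order p bc deg (i, j) = 0;
  gla_diag : forall i, g (i, i) ^+ p = g (i, i) + sc (c i ^+ p);
  gla_ind : forall Q : U -> Prop, (forall x y, Q x -> Q y -> Q (x + y)) ->
    (forall k x, Q x -> Q (sc k * x)) -> Q 1 -> (forall k x, Q x -> Q (g k * x)) ->
    forall x, Q x
}.

Hypothesis gla : gl_algebra.

Definition gen_act (N : lmodType U) (k : idx) : {linear resF N sc -> resF N sc} := umul (g k).

Lemma resF_gl_module (N : lmodType U) : gl_module p bc deg c (gen_act N).
Proof.
split=> [i j k l z|i j z ij|i z]; rewrite /gen_act /=.
- have := congr1 (fun u => umul (sc := sc) (N := N) u z) (gla_bracket gla i j k l).
  by rewrite !(umulD, umulN, umulZ) !umulM.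
- by rewrite -umulX (gla_root gla) // umul0.
- by rewrite -umulX (gla_diag gla) umulD -[sc _]mulr1 umulZ umul1.
Qed.

End AlgebraOfGl.

Lemma fspan_coef (F : fieldType) (V : lmodType F) (I : eqType) (s : seq I) (f : I -> V) z :
  fspan (fun y => exists2 i, i \in s & y = f i) z ->
  exists k : 'I_(size s) -> F, z = \sum_i k i *: f (tnth (in_tuple s) i).
Proof.
elim=> [_ [i si ->]||x y _ [k ->] _ [l ->]|a x _ [k ->]].
- have si' := si; rewrite -index_mem in si'; exists (fun j => (j == Ordinal si')%:R).
  rewrite (bigD1 (Ordinal si')) //= eqxx scale1r big1 ?addr0 => [|j /negbTE ->].
    by rewrite (tnth_nth i) /= nth_index.
  by rewrite scale0r.
- by exists (fun=> 0); rewrite big1 // => i _; rewrite scale0r.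
- by exists (fun i => k i + l i); rewrite -big_split; apply: eq_bigr => i _; rewrite scalerDl.
- by exists (fun i => a * k i); rewrite scaler_sumr; apply: eq_bigr => i _; rewrite scalerA.
Qed.

Section BlockWords.
Variables (K : eqType) (P : K -> nat).

Definition block_words (ks : seq K) : seq (seq K) :=
  foldr (fun k ws => [seq nseq i k ++ w | i <- iota 0 (P k), w <- ws]) [:: [::]] ks.

Lemma size_block_words ks : size (block_words ks) = (\prod_(k <- ks) P k)%N.
Proof.
elim: ks => [|k ks IH]; first by rewrite big_nil.
by rewrite /= size_allpairs size_iota IH big_cons.
Qed.

Lemma mem_block_words ks a : (forall k, (a k < P k)%N) -> block_word ks a \in block_words ks.
Proof.
move=> ha; elim: ks => // k ks IH; rewrite block_word_cons /=.
by apply: allpairs_f => //; rewrite mem_iota /=.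
Qed.

End BlockWords.

(** * Comparison of a highest weight module with the model *)

Section AbstractVerma.
Variables (F : fieldType) (p : nat) (pcharF : p \in [pchar F]) (p_gt2 : (2 < p)%N).
Variables (G : finZmodType) (bc : G -> G -> F).
Hypothesis bcP : bicharacter bc.
Variables (m : nat) (deg : 'I_m -> G) (c lam : 'I_m -> F).
Local Notation idx := ('I_m * 'I_m)%type.
Variable delta : seq idx.
Hypotheses (delta_uniq : uniq delta) (deltaE : delta =i [pred x : idx | (x.1 < x.2)%N]).
Local Notation neg := (neg delta).
Local Notation order := (unit_order p bc deg).

Section Model.
Variables (T : vectType F) (T_gt0 : (0 < dim T)%N) (E : 'I_m -> 'I_m -> endo T_gt0).
Variables (vT u0 : T) (phi : 'Hom(T, F^o)).
Hypothesis vm : verma_model p bc deg c lam E vT u0 phi.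

Definition model_act (k : idx) : {linear T -> T} := endo_app (E k.1 k.2).
Local Notation XT := model_act.

Lemma model_gl_module : gl_module p bc deg c XT.
Proof.
have rep := vm_rep vm; split=> [i j k l z|i j z ij|i z]; rewrite /XT /=.
- have := congr1 (fun f => endo_app f z) (gl_bracket rep i j k l).
  by rewrite !endoE.
- rewrite /unit_order /= (negbTE ij) /color_order -endoX; case: ifP => [/eqP even|odd].
    by rewrite (gl_power rep) // (negbTE ij) scale0r endo0.
  have := congr1 (fun f => endo_app f z) (gl_bracket rep i j i j).
  rewrite eq_sym (negbTE ij) bc_self // odd !endoE.
  rewrite !scale0r scaler0 subr0 scaleN1r opprK -mulr2n -scaler_nat.
  move/eqP; rewrite scaler_eq0 => /orP[|/eqP //].
  by rewrite -(dvdn_pcharf pcharF) => /dvdn_leq; lia.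
- have even : bc (deg i - deg i) (deg i - deg i) = 1 by rewrite subrr bc0l.
  by rewrite -endoX (gl_power rep) // eqxx scale1r !endoE.
Qed.

Let hwT (i j : 'I_m) : (i < j)%N -> XT (i, j) vT = 0. Proof. exact: (vm_hw vm). Qed.
Let wtT i : XT (i, i) vT = lam i *: vT. Proof. exact: (vm_wt vm). Qed.

Lemma model_span u :
  fspan (fun y => exists2 w, w \in block_words order neg & y = act XT w vT) u.
Proof.
have : fspan (fun y => exists w, y = act XT w vT) u.
  elim/(vm_gen vm): u => [x y hx hy|k x hx||i j x ij hx].
  - exact: fspanD.
  - exact: fspanZ.
  - by apply: fspan_gen; exists [::].
  - apply: (fspan_image (f := XT (i, j))) hx => _ [w ->]; apply: fspan_gen.
    by exists ((i, j) :: w).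
apply: fspan_sub => _ [w ->].
have h := neg_span pcharF delta_uniq deltaE model_gl_module hwT wtT w.
apply: fspan_sub h => _ [a [ha _ ->]].
by apply: fspan_gen; exists (block_word neg a) => //; exact: mem_block_words.
Qed.

Lemma size_model_words : size (block_words order neg) = dim T.
Proof.
rewrite size_block_words (vm_dim vm) big_map big_uniq //= pair_big_dep /=.
apply: eq_big => [k|[i j]]; first by rewrite deltaE inE.
rewrite deltaE inE /= => ij; rewrite /unit_order /= ifF //.
by apply/negbTE; rewrite -val_eqE gtn_eqF.
Qed.

Let words := in_tuple (block_words order neg).
Let vecs := [tuple act XT (tnth words i) vT | i < size (block_words order neg)].

(** The vectors span T and their number is dim T. They are indexed by position in the list of
    words. *)
Lemma model_free (k : 'I_(size (block_words order neg)) -> F) :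
  \sum_i k i *: act XT (tnth words i) vT = 0 -> forall i, k i = 0.
Proof.
have fr : free vecs.
  have full : <<vecs>>%VS = fullv.
    apply/eqP; rewrite eqEsubv subvf /=; apply/subvP => u _.
    have [l ->] := fspan_coef (model_span u); apply: rpred_sum => i _; apply: rpredZ.
    have -> : act XT (tnth words i) vT = tnth vecs i by rewrite tnth_mktuple.
    by apply: memv_span; exact: mem_tnth.
  by rewrite /free size_tuple full dimvf -size_model_words.
move=> h; move/freeP: fr; apply; rewrite -[RHS]h; apply: eq_bigr => i _.
by rewrite -tnth_nth tnth_mktuple.
Qed.

Section Verma.
Variables (U : pzRingType) (sc : scalars F U) (g : idx -> U).
Hypothesis gla : gl_algebra p bc deg c sc g.
Variables (N : lmodType U) (v : resF N sc).
Local Notation NF := (resF N sc).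
Local Notation X := (gen_act sc g N).
Hypothesis hwN : forall i j : 'I_m, (i < j)%N -> X (i, j) v = 0.
Hypothesis wtN : forall i, X (i, i) v = lam i *: v.
Hypothesis genN : forall z : NF, exists u, z = umul u v.
Variable Psi : {linear NF -> T}.
Hypothesis Psi_g : forall k z, Psi (X k z) = XT k (Psi z).
Hypothesis Psi_v : Psi v = vT.

Let glm := resF_gl_module gla N.
Local Notation bot := (bot_word p bc deg delta).
Local Notation top := (top_word p bc deg delta).
Local Notation Fv := (bot_vec p bc deg delta X v).

Lemma Psi_act w z : Psi (act X w z) = act XT w (Psi z).
Proof. by elim: w => //= k w IH; rewrite Psi_g IH. Qed.

Lemma umul_span (u : U) (z : NF) : fspan (fun y => exists w, y = act X w z) (umul u z).
Proof.
elim/(gla_ind gla): u => [x y hx hy|k x hx||k x hx].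
- by rewrite umulD; exact: fspanD.
- by rewrite umulZ; exact: fspanZ.
- by rewrite umul1; apply: fspan_gen; exists [::].
- rewrite umulM; apply: (fspan_image (f := X k)) hx => _ [w ->]; apply: fspan_gen.
  by exists (k :: w).
Qed.

(** The words which span N are sent to the linearly independent vectors of [model_free]. *)
Lemma Psi_inj z : Psi z = 0 -> z = 0.
Proof.
have [u ->] := genN z.
have : fspan (fun y => exists2 w, w \in block_words order neg & y = act X w v) (umul u v).
  apply: fspan_sub (umul_span u v) => _ [w ->].
  apply: fspan_sub (neg_span pcharF delta_uniq deltaE glm hwN wtN w) => _ [a [ha _ ->]].
  by apply: fspan_gen; exists (block_word neg a) => //; exact: mem_block_words.
case/fspan_coef => k ->; rewrite linear_sum => e.
rewrite big1 // => i _; rewrite (@model_free k) ?scale0r // -[RHS]e.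
by apply: eq_bigr => j _; rewrite linearZ Psi_act Psi_v.
Qed.

Lemma Fv_neq0 : Fv != 0.
Proof.
apply/eqP => /(congr1 Psi); rewrite linear0 Psi_act Psi_v => e.
have bw : bot \in block_words order neg.
  by apply: mem_block_words => k; rewrite /top_exp prednK // unit_order_gt0.
have := @model_free (fun i => (tnth words i == bot)%:R); rewrite big1 => [|i _]; last first.
  by case: eqP => [->|_]; rewrite ?scale0r // e scaler0.
have lt := bw; rewrite -index_mem in lt; move/(_ erefl (Ordinal lt)).
rewrite (tnth_nth bot) /= nth_index // eqxx => /eqP.
by rewrite oner_eq0.
Qed.

Let phiN z : F^o := phi (Psi z).
Let phiN_linear : linear phiN.
Proof. by move=> k x y; rewrite /phiN !linearP. Qed.
HB.instance Definition _ := GRing.isLinear.Build F NF F^o _ phiN phiN_linear.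

Let phiN_neg (i j : 'I_m) z : (j < i)%N -> phiN (X (i, j) z) = 0.
Proof. by move=> ij; rewrite /phiN Psi_g; exact: (vm_phi0 vm). Qed.

Let phiN_v : phiN v = 1. Proof. by rewrite /phiN Psi_v; exact: (vm_phi vm). Qed.

Lemma neg_Fv (i j : 'I_m) : (j < i)%N -> X (i, j) Fv = 0.
Proof.
move=> ij; rewrite -[X (i, j) _]/(act X ((i, j) :: bot) v).
apply: (act_below pcharF delta_uniq deltaE glm hwN wtN).
by rewrite word_ht_cons /unit_ht /=; lia.
Qed.

Lemma top_Fv : act X top Fv = (phi (Psi (act X top Fv)) : F) *: v.
Proof.
rewrite /bot_vec -act_cat.
have [|k ->] := act_ht0 pcharF delta_uniq deltaE glm hwN wtN (w := top ++ bot).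
  by rewrite word_ht_cat wht_top_bot.
by rewrite -/(phiN _) linearZ /= phiN_v; congr (_ *: _); rewrite -[LHS]mulr1.
Qed.

Lemma v_notin_UFv u : act X top Fv = 0 -> umul u Fv <> v.
Proof.
move=> EF0 e; have : fspan (fun y => y = 0) (phiN (umul u Fv)).
  apply: fspan_image (umul_span u Fv) => _ [w ->]; apply: fspan_gen.
  exact: (phi_act_bot pcharF bcP delta_uniq deltaE glm hwN wtN phiN_neg w EF0).
rewrite e phiN_v => h; have : (1 : F^o) = 0; last by move/eqP; rewrite oner_eq0.
by elim: h => [//|//|x y _ -> _ ->|k x _ ->]; rewrite ?addr0 ?scaler0.
Qed.

(** The socle property is used twice: for the image of M, and for the line through Psi F v, which
    N^- kills. Both contain u0, so some element of M is a nonzero multiple of F v, since Psi is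
    injective; applying the top word to F v then gives a nonzero multiple of v. *)
Lemma submodule_full (M : NF -> Prop) z : (forall x y, M x -> M y -> M (x + y)) ->
  (forall u x, M x -> M (umul u x)) -> act X top Fv <> 0 -> z != 0 -> M z ->
  forall x, M x.
Proof.
move=> MD MU EF0 z0 Mz.
have MZ k x : M x -> M (k *: x) by rewrite res_scaleE; exact: MU.
have Psi_z0 : Psi z != 0 by apply: contraNneq z0 => /Psi_inj ->.
have PsiF0 : Psi Fv != 0 by apply: contraNneq Fv_neq0 => /Psi_inj ->.
have [||y My ey] := vm_socle vm (S := fun t => exists2 y, M y & Psi y = t) _ _ Psi_z0
  (ex_intro2 _ _ z Mz erefl).
- by move=> k _ [y My <-]; exists (k *: y); [exact: MZ|rewrite linearZ].
- by move=> i j _ ij [y My <-]; exists (X (i, j) y); [exact: MU|rewrite Psi_g].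
have [||k ek] := vm_socle vm (S := fun t => exists k, t = k *: Psi Fv) _ _ PsiF0
  (ex_intro _ 1 (esym (scale1r _))).
- by move=> k _ [l ->]; exists (k * l); rewrite scalerA.
- move=> i j _ ij [k ->]; exists 0; rewrite scale0r.
  have e := Psi_g (i, j) (k *: Fv); rewrite !linearZ /= in e.
  by rewrite endo_scaler -e neg_Fv // linear0 scaler0.
have k0 : k != 0 by apply: contraNneq (vm_u0 vm) => k0; rewrite ek k0 scale0r.
have eyF : y = k *: Fv.
  apply/eqP; rewrite -subr_eq0; apply/eqP/Psi_inj.
  by rewrite linearB linearZ /= ey ek subrr.
have MF : M Fv by have := MZ k^-1 _ My; rewrite eyF scalerA mulVf // scale1r.
have MEF : M (act X top Fv) by elim: (top) => //= l w; exact: MU.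
move: EF0 MEF; rewrite top_Fv; set q := phi _ => EF0 /(MZ q^-1).
have q0 : q != 0 by apply/eqP => q0; apply: EF0; rewrite q0 scale0r.
rewrite scalerA mulVf // scale1r => Mv x.
by have [u ->] := genN x; exact: MU.
Qed.

End Verma.

End Model.

End AbstractVerma.

(** * Triangular decomposition *)

Section Triangular.
Variables (F : fieldType) (p : nat) (pcharF : p \in [pchar F]).
Variables (G : finZmodType) (bc : G -> G -> F).
Variables (m : nat) (deg : 'I_m -> G) (c : 'I_m -> F).
Local Notation idx := ('I_m * 'I_m)%type.
Variables (U : pzRingType) (sc : scalars F U) (g : idx -> U).
Hypothesis gla : gl_algebra p bc deg c sc g.
Variable delta : seq idx.
Hypotheses (delta_uniq : uniq delta) (deltaE : delta =i [pred x : idx | (x.1 < x.2)%N]).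

Definition wprod (w : seq idx) : U := \prod_(k <- w) g k.

Lemma wprod_cat u w : wprod (u ++ w) = wprod u * wprod w.
Proof. exact: big_cat. Qed.

Lemma act_wprod (N : lmodType U) w (z : resF N sc) : act (gen_act sc g N) w z = umul (wprod w) z.
Proof.
elim: w => [|k w IH]; first by rewrite /wprod big_nil umul1.
by rewrite /= IH -umulM /wprod big_cons.
Qed.

Lemma wprod_block ks a : wprod (block_word ks a) = \prod_(k <- ks) g k ^+ a k.
Proof.
elim: ks => [|k ks IH]; first by rewrite /wprod !big_nil.
rewrite block_word_cons wprod_cat IH big_cons; congr (_ * _).
by elim: (a k) => [|n IHn]; rewrite /wprod ?big_nil // big_cons exprS -IHn.
Qed.

(** Reordering applied to 1 in the regular module shows that U is the sum of u_chi(H), N^- U and U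
    N^+. *)
Lemma gla_triangular (Q : U -> Prop) : Q 0 -> (forall x y, Q x -> Q y -> Q (x + y)) ->
  (forall k x, Q x -> Q (sc k * x)) ->
  (forall w, all (fun k : idx => k.1 == k.2) w -> Q (wprod w)) ->
  (forall (i j : 'I_m) y, (j < i)%N -> Q (g (i, j) * y)) ->
  (forall (i j : 'I_m) y, (i < j)%N -> Q (y * g (i, j))) -> forall x, Q x.
Proof.
move=> Q0 QD QZ Qdiag Qneg Qpos x.
pose one : resF U^o sc := (1 : U).
have um y : umul y one = y by exact: mulr1.
rewrite -[x]um; have : fspan (fun y : resF U^o sc => Q (y : U)) (umul x one); last first.
  by elim=> // [y z _ hy _ hz|k y _ hy]; [exact: QD|exact: QZ].
apply: fspan_sub (umul_span gla x one) => _ [w ->].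
apply: fspan_sub (glm_straighten pcharF (resF_gl_module gla U^o) w one
  (ndp_uniq delta_uniq deltaE) (ndp_all deltaE)) => _ [a [_ _ ->]].
apply: fspan_gen; rewrite !block_word_cat act_wprod um !wprod_cat.
case en : (block_word (neg delta) a) => [|[i j] w1].
  case/lastP ep : (block_word delta a) => [|w2 [i j]].
    rewrite /wprod !big_nil mul1r mulr1 -/(wprod _); apply: Qdiag; apply/allP => k.
    by move/mem_block_word; rewrite mem_diag.
  have w1 k : wprod [:: k] = g k by exact: big_seq1.
  rewrite -cats1 wprod_cat w1 !mulrA; apply: Qpos.
  have : (i, j) \in delta by apply: (@mem_block_word m delta a); rewrite ep mem_rcons mem_head.
  by rewrite deltaE.
rewrite {1}/wprod big_cons -/(wprod _) -!mulrA; apply: Qneg.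
have : (i, j) \in neg delta by apply: (@mem_block_word m _ a); rewrite en mem_head.
by rewrite (mem_neg deltaE).
Qed.

End Triangular.

(** * Maps out of an induced module *)

Section TensorLift.
Variables (A B : pzRingType) (phi : B -> A) (W : lmodType B) (V : zmodType).
Variable h : A -> W -> V.
Hypothesis hDl : forall a b w, h (a + b) w = h a w + h b w.
Hypothesis hDr : forall a w w', h a (w + w') = h a w + h a w'.
Hypothesis h_bal : forall a b w, h (a * phi b) w = h a (b *: w).
Local Notation Free := {malg int[(A * W)%type]}.

Definition free_lift (t : Free) : V := \sum_(k <- msupp t) h k.1 k.2 *~ t@_k.

Lemma free_liftEw (d : {fset (A * W)%type}) t : (msupp t `<=` d)%fset ->
  free_lift t = \sum_(k <- d) h k.1 k.2 *~ t@_k.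
Proof.
move=> le; rewrite /free_lift (big_fset_incl _ le) //= => x _ /mcoeff_outdom ->.
by rewrite mulr0z.
Qed.

Lemma free_liftB x y : free_lift (x - y) = free_lift x - free_lift y.
Proof.
rewrite !(@free_liftEw (msupp x `|` msupp y)%fset).
- by rewrite -sumrB; apply: eq_bigr => k _; rewrite mcoeffB mulrzBr.
- exact: fsubsetUr.
- exact: fsubsetUl.
- exact: msuppB_le.
Qed.

Lemma free_liftU k : free_lift << k >> = h k.1 k.2.
Proof. by rewrite (free_liftEw msuppU_le) big_seq_fset1 mcoeffUU. Qed.

Lemma tensor_lift : exists L : tensor phi W -> V,
  (forall x y, L (x - y) = L x - L y) /\ (forall a w, L (tens phi a w) = h a w).
Proof.
have lift0 x : x \in zspan_pred (@tensor_rel A B phi W) -> free_lift x = 0.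
  move=> /asboolP; elim=> [_ [a b w|a w w'|a b w]||y z _ hy _ hz].
  - by rewrite !free_liftB !free_liftU /= hDl -addrA -opprD subrr.
  - by rewrite !free_liftB !free_liftU /= hDr -addrA -opprD subrr.
  - by rewrite free_liftB !free_liftU /= h_bal subrr.
  - by rewrite -(subrr 0) free_liftB subrr.
  - by rewrite free_liftB hy hz subrr.
have liftE x y : (\pi_(tensor phi W) x = \pi_(tensor phi W) y)%qT -> free_lift x = free_lift y.
  move=> e; apply/subr0_eq; rewrite -free_liftB; apply: lift0; rewrite -tensorE.
  exact/eqP.
exists (fun z => free_lift (repr z)); split=> [x y|a w]; last first.
  by rewrite -(free_liftU (a, w)); apply: liftE; rewrite reprK.
have piB (a b : Free) : (\pi_(tensor phi W) (a - b) = \pi a - \pi b)%qT by rewrite !piE.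
by rewrite -free_liftB; apply: liftE; rewrite reprK piB !reprK.
Qed.

End TensorLift.

Section VermaMap.
Variables (F : fieldType) (U B : pzRingType) (sc : scalars F U) (scB : scalars F B).
Variables (phi : B -> U) (W : lmodType B) (v : resF W scB).
Hypothesis v0 : v <> 0.
Hypothesis vW : forall w : resF W scB, exists k : F, w = k *: v.
Variables (T : vectType F) (T_gt0 : (0 < dim T)%N) (rho : U -> endo T_gt0) (vT : T).
Hypothesis rhoD : forall x y, rho (x + y) = rho x + rho y.
Hypothesis rhoM : forall x y, rho (x * y) = rho x * rho y.
Hypothesis rho_sc : forall k, rho (sc k) = k%:A.
Hypothesis rho1 : rho 1 = 1.
Hypothesis rho_phi : forall b, exists mu : F,
  umul b v = mu *: v /\ endo_app (rho (phi b)) vT = mu *: vT.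
Local Notation Z := (resF (tensor phi W) sc).

(** Frobenius reciprocity: a map out of the induced module is a vector vT on which B acts by the
    same scalars as on v. *)
Lemma verma_map : exists Psi : {linear Z -> T},
  (forall u z, Psi (umul u z) = endo_app (rho u) (Psi z)) /\
  Psi (tens phi 1 (v : W)) = vT.
Proof.
(* The coordinate on the line W is chosen pointwise; as v <> 0 it is unique, which makes it additive
   and compatible with B. *)
have [coef coefE] : exists coef : W -> F, forall w, (w : resF W scB) = coef w *: v.
  exists (fun w => projT1 (cid (vW w))) => w; exact: projT2 (cid (vW w)).
have inj k l : k *: v = l *: v -> k = l.
  move/eqP; rewrite -subr_eq0 -scalerBl => /eqP e; apply/eqP; rewrite -subr_eq0.
  apply/negPn/negP => ne; apply: v0.
  by rewrite -[v]scale1r -(mulVf ne) -scalerA e scaler0.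
pose h a w := endo_app (rho a) (coef w *: vT).
have [|a w w'|a b w|L [LB LE]] := @tensor_lift U B phi W T h.
- by move=> a b w; rewrite /h rhoD endoD.
- rewrite /h -endo_addr -scalerDl; congr (endo_app _ (_ *: _)); apply: inj.
  by rewrite scalerDl -!coefE.
- have [mu [bv bT]] := rho_phi b.
  rewrite /h rhoM endoM endo_scaler bT scalerA; congr (endo_app _ (_ *: _)); apply: inj.
  by rewrite -scalerA -bv -coefE -linearZ -coefE.
have L0 : L 0 = 0 by have := LB 0 0; rewrite !subrr.
have LN y : L (- y) = - L y by rewrite -(sub0r y) LB L0 sub0r.
have LD x y : L (x + y) = L x + L y by have := LB x (- y); rewrite opprK LN opprK.
have Lu u z : L (u *: z) = endo_app (rho u) (L z).
  elim/tensor_ind: z => [a w||x y hx hy].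
  - by apply: etrans (congr1 L (tens_scale phi u a w)) _; rewrite !LE /h rhoM endoM.
  - by rewrite scaler0 L0 endo_zero.
  - by rewrite scalerBr !LB hx hy -linearB.
have Llin : linear (L : Z -> T).
  move=> k x y; rewrite LD; congr (_ + _).
  apply: etrans (Lu (sc k) x) _; by rewrite rho_sc endoZ endo1.
pose P := HB.pack_for {linear Z -> T} (L : Z -> T) (GRing.isLinear.Build F Z T _ _ Llin).
exists P; split=> [u z|]; first exact: Lu.
rewrite /= LE /h rho1 endo1 (inj (coef v) 1) ?scale1r //.
Qed.

End VermaMap.

Lemma scalar_bracket (F : Type) (V : pzRingType) (s : F -> V -> V) (f : F -> V)
    (fE : forall k x, f k * x = s k x) (a b d e : V) q r t :
  a - s q b = s r d - s q (s t e) -> a - f q * b = f r * d - f q * (f t * e).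
Proof. by rewrite !fE. Qed.

(** * Relations in u_chi(g) and its action on the model *)

Section UchiAlgebra.
Variables (F : fieldType) (p : nat) (pcharF : p \in [pchar F]) (p_gt2 : (2 < p)%N).
Variables (G : finZmodType) (bc : G -> G -> F).
Hypothesis bcP : bicharacter bc.
Variables (m : nat) (deg : 'I_m -> G) (chi : {scalar 'M[F]_m}).
Hypothesis chiP : standard_semisimple deg chi.
Local Notation idx := ('I_m * 'I_m)%type.
Local Notation UU S := (uchi bc deg p chi S).
Local Notation U := (UU (gS m)).
Local Notation ui S := (@uiota F p G bc m deg chi S).
Local Notation pi S := (@upi F p G bc m deg chi S).

Section Scalars.
Variable S : {set idx}.

Definition uchi_scal (k : F) : UU S := k *: (1 : UU S).
Lemma uchi_scalE k (x : UU S) : uchi_scal k * x = k *: x.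
Proof. by rewrite /uchi_scal -uchi_scaleAl mul1r. Qed.
Lemma uchi_scalEr k (x : UU S) : x * uchi_scal k = k *: x.
Proof. by rewrite /uchi_scal -uchi_scaleAr mulr1. Qed.

Definition uchi_scalars : scalars F (UU S) :=
  @Scalars F (UU S) uchi_scal (fun a b => scalerDl (1 : UU S) a b)
    (fun a b => etrans (esym (scalerA a b (1 : UU S))) (esym (uchi_scalE a (uchi_scal b))))
    (scale1r (1 : UU S)) (fun a u => etrans (uchi_scalEr a u) (esym (uchi_scalE a u))).

End Scalars.

Local Notation sc := (uchi_scalars (gS m)).
Definition ugen (k : idx) : U := ui (gS m) (delta_mx k.1 k.2).

Lemma chi_root (i j : 'I_m) : i != j -> chi (delta_mx i j) = 0.
Proof.
move=> ne; apply: chiP.2; case: (ltngtP i j) => h.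
- by left=> k l; rewrite mxE; case: andP => [[/eqP -> /eqP ->]|] //; rewrite eqxx.
- by right=> k l; rewrite mxE; case: andP => [[/eqP -> /eqP ->]|] //; rewrite eqxx.
- by case/eqP: ne; exact: val_inj.
Qed.

Let Sall x : in_sub (gS m) (x : 'M[F]_m). Proof. by move=> i j _; rewrite inE. Qed.
Let uiB x y k : ui (gS m) (x - k *: y) = ui (gS m) x - k *: ui (gS m) y.
Proof. by rewrite linearB linearZ. Qed.
Let ui_delta (i j k l : 'I_m) :
  ui (gS m) (delta_mx i j *m delta_mx k l) = (j == k)%:R *: ui (gS m) (delta_mx i l).
Proof. by rewrite mul_delta_mx_cond -scaler_nat linearZ. Qed.

Lemma uchi_delta_bracket i j k l :
  ugen (i, j) * ugen (k, l)
    - bc (deg i - deg j) (deg k - deg l) *: (ugen (k, l) * ugen (i, j)) =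
  (j == k)%:R *: ugen (i, l)
    - bc (deg i - deg j) (deg k - deg l) *: ((l == i)%:R *: ugen (k, j)).
Proof.
have e := @uchi_bracketE F p G bc m deg chi (gS m) _ _ _ _ (@Sall _) (@Sall _)
  (@mx_homog_delta F G m deg i j) (@mx_homog_delta F G m deg k l).
by apply: etrans e _; rewrite /color_bracket uiB !ui_delta.
Qed.

Let half (x : U) : x *+ 2 = 0 -> x = 0.
Proof.
move=> h; have two : 2%:R != 0 :> F.
  by rewrite -(dvdn_pcharf pcharF); apply/negP => /dvdn_leq; lia.
by rewrite -[x]scale1r -(mulVf two) -scalerA scaler_nat h scaler0.
Qed.

Let sq0 (V : lmodType F) (x y z : V) (q r t : F) : r = 0 -> t = 0 -> q = -1 ->
  x - q *: x = r *: y - q *: (t *: z) -> x *+ 2 = 0.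
Proof. by move=> -> -> ->; rewrite !scale0r scaler0 subr0 scaleN1r opprK -mulr2n. Qed.

Lemma ugen_root i j : i != j -> ugen (i, j) ^+ unit_order p bc deg (i, j) = 0.
Proof.
move=> ij; have dd : delta_mx i j *m delta_mx i j = 0 :> 'M[F]_m.
  by rewrite mul_delta_mx_cond eq_sym (negbTE ij).
rewrite /unit_order /= (negbTE ij) /color_order; case: ifP => [/eqP even|odd].
  apply: etrans (@uchi_powerE F p G bc m deg chi (gS m) _ _ (@Sall _)
    (@mx_homog_delta F G m deg i j) even) _.
  have -> : delta_mx i j ^+ p = 0 :> 'M[F]_m.
    by rewrite -(subnKC p_gt2) !exprS mulrA -mulmxE dd mul0mx.
  rewrite chi_root // expr0n gtn_eqF ?prime_gt0 ?(pcharf_prime pcharF) //.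
  by rewrite linear0 scale0r addr0.
have ji : (j == i) = false by rewrite eq_sym; exact/negbTE.
(* For an odd root the bracket relation of the root vector x with itself reads x^2 + x^2 = 0. *)
apply: half; apply: sq0 (uchi_delta_bracket i j i j); rewrite ?ji //.
by have := bc_self bcP (deg i - deg j); rewrite odd.
Qed.

Lemma ugen_diag i : ugen (i, i) ^+ p = ugen (i, i) + sc (chi (delta_mx i i) ^+ p).
Proof.
have even : bc (deg i - deg i) (deg i - deg i) = 1 by rewrite subrr bc0l.
apply: etrans (@uchi_powerE F p G bc m deg chi (gS m) _ _ (@Sall _)
  (@mx_homog_delta F G m deg i i) even) _.
by rewrite delta_mx_exp ?eqxx ?scale1r // prime_gt1 // (pcharf_prime pcharF).
Qed.

Lemma uchi_gl_algebra : gl_algebra p bc deg (fun i => chi (delta_mx i i)) sc ugen.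
Proof.
split=> [i j k l|||Q QD QZ Q1 QM x].
- exact: (scalar_bracket (@uchi_scalE (gS m)) (uchi_delta_bracket i j k l)).
- exact: ugen_root.
- exact: ugen_diag.
elim/uchi_ind: x => [//|k x hx|//|i j x _ hx]; last exact: (QM (i, j)).
by have := QZ k x hx; rewrite /= uchi_scalE.
Qed.

Section Rho.
Variables (T : vectType F) (T_gt0 : (0 < dim T)%N) (E : 'I_m -> 'I_m -> endo T_gt0).
Hypothesis rep : gl_rep p bc deg (fun i => chi (delta_mx i i)) E.
Local Notation A := (endo T_gt0).
Local Notation inA := (@GRing.in_alg F A).

Let inAC c (a : A) : inA c * a = a * inA c.
Proof. by rewrite /GRing.in_alg /= -scalerAl mul1r -scalerAr mulr1. Qed.

Definition fmE (t : tensor_alg F (gS m)) : A :=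
  free_mor inA (fun k : idx => E k.1 k.2) t.
Definition rho (u : U) : A := fmE (repr u).

Lemma fmE_iotaT x : fmE (iotaT (gS m) x) = gl_lin E x.
Proof.
apply: etrans (@free_mor_iotaT F m (gS m) A inA _ x) _.
rewrite /gl_lin pair_bigA; apply: eq_big => [k|[i j] _]; first by rewrite inE.
by rewrite /GRing.in_alg /= -scalerAl mul1r.
Qed.

Lemma fmE_bracket x y z k : fmE (x * y - k *: (y * x) - z) =
  fmE x * fmE y - k *: (fmE y * fmE x) - fmE z.
Proof.
rewrite /fmE !free_morB (free_morZ inA) !(free_morM (f := inA) _ inAC).
by rewrite /GRing.in_alg /= -scalerAl mul1r.
Qed.

Lemma fmE_power x y n k : fmE (x ^+ n - y - k%:A) = fmE x ^+ n - fmE y - k%:A.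
Proof.
rewrite /fmE !free_morB (free_morZ inA) (free_morX (f := inA) _ inAC) (free_mor1 (gS m) inA).
by rewrite /GRing.in_alg /= mulr1.
Qed.

(** The defining relations hold in the model, so [rho] does not depend on the representative; its
    multiplicativity follows. *)
Lemma rho_upi t : rho (pi (gS m) t) = fmE t.
Proof.
have [brk pow] := gl_rep_relations pcharF bcP chiP rep.
have hN r : uchi_rel bc deg p chi r -> fmE r = 0.
  case=> [a b x y _ _ hx hy|a x _ hx even].
    by rewrite fmE_bracket !fmE_iotaT (brk a b) // subrr.
  by rewrite fmE_power !fmE_iotaT (pow a) // subrr.
apply/subr0_eq; rewrite /rho /fmE -free_morB.
apply: (@free_mor_ideal F p G bc m deg chi (gS m) A inA _ inAC (fun z => z = 0)) => //.
- by move=> x y -> ->; rewrite subrr.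
- by move=> a r b ->; rewrite mulr0 mul0r.
by apply/upiP; rewrite upi_repr.
Qed.

Lemma rhoD x y : rho (x + y) = rho x + rho y.
Proof.
rewrite -{1}[x]upi_repr -{1}[y]upi_repr -upiD rho_upi.
exact: (free_morD inA).
Qed.
Lemma rhoM x y : rho (x * y) = rho x * rho y.
Proof.
rewrite -{1}[x]upi_repr -{1}[y]upi_repr -upiM rho_upi.
exact: (free_morM (f := inA) _ inAC).
Qed.
Lemma rho1 : rho 1 = 1.
Proof. by rewrite -upi1 rho_upi; exact: (free_mor1 (gS m) inA). Qed.
Lemma rho_sc k : rho (sc k) = k%:A.
Proof.
rewrite /= /uchi_scal -upi1 -upiZ rho_upi; apply: etrans (free_morZ inA _ _ _) _.
by rewrite (free_mor1 (gS m) inA) mulr1.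
Qed.
Lemma rho_ui x : rho (ui (gS m) x) = gl_lin E x.
Proof. by rewrite uiotaE rho_upi fmE_iotaT. Qed.
Lemma rho_ugen k : rho (ugen k) = E k.1 k.2.
Proof. by rewrite /ugen rho_ui gl_lin_delta. Qed.

End Rho.

End UchiAlgebra.

(** * Baby Verma modules *)

Lemma umul_scaler (F : fieldType) (B : pzRingType) (sc : scalars F B) (W : lmodType B)
    (x : B) k (z : resF W sc) : umul x (k *: z) = k *: umul x z.
Proof. exact: linearZ. Qed.

Section LineModule.
Variables (F : fieldType) (B : pzRingType) (sc : scalars F B) (W : lmodType B).
Variable v : resF W sc.

Lemma umul_eigen_power (x : B) n (l k : F) : v <> 0 -> umul x v = l *: v ->
  x ^+ n = x + sc k -> l ^+ n - l = k.
Proof.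
move=> v0 xv e; have xn j : umul (x ^+ j) v = l ^+ j *: v.
  elim: j => [|j IH]; first by rewrite umul1 scale1r.
  by rewrite !exprSr umulM xv umul_scaler IH scalerA mulrC.
have /eqP := xn n; rewrite e umulD xv -res_scaleE -scalerDl -subr_eq0 -scalerBl => /eqP h.
apply/eqP; rewrite subr_eq eq_sym addrC -subr_eq0; apply/negPn/negP => ne; apply: v0.
by rewrite -[v]scale1r -(mulVf ne) -scalerA h scaler0.
Qed.

Variables (T : vectType F) (T_gt0 : (0 < dim T)%N) (R : B -> endo T_gt0) (vT : T).
Hypothesis RD : forall x y, R (x + y) = R x + R y.
Hypothesis RM : forall x y, R (x * y) = R x * R y.
Hypothesis Rsc : forall k, R (sc k) = k%:A.

(** The hypothesis [rho_phi] of [verma_map], isolated because it is closed under sums and products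
    and can be checked on generators. *)
Definition common_eigen b := exists mu : F, umul b v = mu *: v /\ endo_app (R b) vT = mu *: vT.

Lemma common_eigenD x y : common_eigen x -> common_eigen y -> common_eigen (x + y).
Proof.
move=> [k [h1 h2]] [l [h3 h4]]; exists (k + l).
by rewrite umulD RD endoD h1 h2 h3 h4 !scalerDl.
Qed.
Lemma common_eigenM x y : common_eigen x -> common_eigen y -> common_eigen (x * y).
Proof.
move=> [k [h1 h2]] [l [h3 h4]]; exists (l * k).
by rewrite umulM RM endoM h3 h4 umul_scaler endo_scaler h1 h2 !scalerA.
Qed.
Lemma common_eigen_sc k : common_eigen (sc k).
Proof. by exists k; rewrite -res_scaleE Rsc endoZ endo1. Qed.

End LineModule.

Section InducedModule.
Variables (F : fieldType) (B U : pzRingType) (scB : scalars F B) (sc : scalars F U).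
Variables (phi : B -> U) (W : lmodType B) (v : resF W scB).
Hypothesis phi_sc : forall k, phi (scB k) = sc k.
Local Notation N := (resF (tensor phi W) sc).
Local Notation vN := (tens phi 1 (v : W) : N).

Lemma tens_bal a b (w : W) : tens phi (a * phi b) w = tens phi a (b *: w).
Proof.
apply/eqP; rewrite /tens tensorE; apply/asboolP; apply: zspan_gen; exact: tensor_bal.
Qed.

Lemma tens_umul u a (w : W) : umul (u : U) (tens phi a w : N) = tens phi (u * a) w.
Proof. exact: tens_scale. Qed.

Lemma tens_eigen b l : umul b v = l *: v -> umul (phi b) vN = l *: vN.
Proof.
move=> e; rewrite res_scaleE !tens_umul !mulr1 -[phi b]mul1r tens_bal -phi_sc.
by rewrite -[phi (scB l)]mul1r tens_bal; congr (tens phi 1 _); exact: e.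
Qed.

Lemma tens_generated : (forall w : resF W scB, exists k : F, w = k *: v) ->
  forall z : N, exists u, z = umul u vN.
Proof.
move=> vW; apply: (@tensor_ind U B phi W) => [a w||x y [u ->] [u' ->]].
- have [k e] := vW w; exists (a * sc k); rewrite tens_umul mulr1 -phi_sc tens_bal.
  by congr tens; exact: e.
- by exists 0; rewrite umul0.
- by exists (u - u'); rewrite umulD umulN.
Qed.

End InducedModule.

Lemma zspanD (V : zmodType) (P : V -> Prop) x y : zspan P x -> zspan P y -> zspan P (x + y).
Proof.
move=> hx hy; rewrite -[y]opprK -[- y]sub0r; apply: zspanB => //; apply: zspanB => //.
exact: zspan0.
Qed.

Section Inclusions.
Variables (F : fieldType) (p : nat) (pcharF : p \in [pchar F]).
Variables (G : finZmodType) (bc : G -> G -> F) (m : nat) (deg : 'I_m -> G).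
Variables (chi : {scalar 'M[F]_m}) (S T : {set 'I_m * 'I_m}).
Hypothesis ST : S \subset T.
Hypothesis S_trans : forall i j k, (i, j) \in S -> (j, k) \in S -> (i, k) \in S.
Local Notation UU S := (uchi bc deg p chi S).
Local Notation incl := (@uchi_incl F G m bc deg p chi S T).
Local Notation piS := (@upi F p G bc m deg chi S).
Local Notation piT := (@upi F p G bc m deg chi T).
Local Notation mor := (@incl_mor F m S T).
Let inclE t : incl (piS t) = piT (mor t) := uchi_inclE pcharF bc deg chi ST S_trans t.

Lemma uchi_inclD x y : incl (x + y) = incl x + incl y.
Proof.
suff h s t : incl (piS s + piS t) = incl (piS s) + incl (piS t).
  by have := h (repr x) (repr y); rewrite (upi_repr x) (upi_repr y).
have -> : piS s + piS t = piS (s + t) by rewrite (upiD p bc deg chi s t).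
rewrite (inclE (s + t)) (inclE s) (inclE t) (incl_morD T s t).
by rewrite (upiD p bc deg chi (mor s) (mor t)).
Qed.
Lemma uchi_inclM x y : incl (x * y) = incl x * incl y.
Proof.
suff h s t : incl (piS s * piS t) = incl (piS s) * incl (piS t).
  by have := h (repr x) (repr y); rewrite (upi_repr x) (upi_repr y).
have -> : piS s * piS t = piS (s * t) by rewrite (upiM p bc deg chi s t).
rewrite (inclE (s * t)) (inclE s) (inclE t) (incl_morM T s t).
by rewrite (upiM p bc deg chi (mor s) (mor t)).
Qed.
Lemma uchi_incl_scal k : incl (uchi_scal p bc deg chi S k) = uchi_scal p bc deg chi T k.
Proof.
have -> : uchi_scal p bc deg chi S k = piS (k *: 1) by rewrite (upiZ p bc deg chi k 1).
by rewrite (inclE (k *: 1)) (incl_morZ T k 1) (incl_mor1 F S T) (upiZ p bc deg chi k 1).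
Qed.
Lemma uchi_incl_iota x : in_sub S x ->
  incl (uiota p bc deg chi S x) = uiota p bc deg chi T x.
Proof. by move=> Sx; apply: etrans (inclE _) (congr1 piT (incl_mor_iotaT T Sx)). Qed.

End Inclusions.

Lemma additive0 (V V' : zmodType) (f : V -> V') :
  (forall x y, f (x + y) = f x + f y) -> f 0 = 0.
Proof. by move=> fD; apply: (addrI (f 0)); rewrite -fD !addr0. Qed.

Lemma additiveB (V V' : zmodType) (f : V -> V') :
  (forall x y, f (x + y) = f x + f y) -> forall x y, f (x - y) = f x - f y.
Proof. by move=> fD x y; apply/eqP; rewrite eq_sym subr_eq -fD subrK. Qed.

Lemma zspan_image (V V' : zmodType) (P : V -> Prop) (P' : V' -> Prop) (f : V -> V') :
  (forall x y, f (x + y) = f x + f y) -> (forall x, P x -> P' (f x)) ->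
  forall x, zspan P x -> zspan P' (f x).
Proof.
move=> fD PP' x; elim=> [y /PP' hy||y z _ hy _ hz]; first exact: zspan_gen.
- by rewrite additive0 //; exact: zspan0.
- by rewrite additiveB //; exact: zspanB.
Qed.

Lemma scal_mulCA (F : fieldType) (V : pzRingType) (s : scalars F V) k (x y : V) :
  s k * (x * y) = x * (s k * y).
Proof. by rewrite mulrA -(scalC s k) -mulrA. Qed.

Section BabyVerma.
Variables (F : fieldType) (p : nat) (pcharF : p \in [pchar F]) (p_gt2 : (2 < p)%N).
Variables (G : finZmodType) (bc : G -> G -> F).
Hypothesis bcP : bicharacter bc.
Variables (m : nat) (deg : 'I_m -> G) (chi : {scalar 'M[F]_m}).
Hypothesis chiP : standard_semisimple deg chi.
Local Notation idx := ('I_m * 'I_m)%type.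
Local Notation UU S := (uchi bc deg p chi S).
Local Notation U := (UU (gS m)).
Local Notation ui S := (@uiota F p G bc m deg chi S).
Local Notation pi S := (@upi F p G bc m deg chi S).
Local Notation sc S := (uchi_scalars p bc deg chi S).
Local Notation incl S := (@uchi_incl F G m bc deg p chi S (gS m)).
Local Notation ug := (@ugen F p G bc m deg chi).

Lemma sub_gS (S : {set idx}) : S \subset gS m.
Proof. by apply/fintype.subsetP => x; rewrite inE. Qed.
Lemma bS_trans i j k : (i, j) \in bS m -> (j, k) \in bS m -> (i, k) \in bS m.
Proof. by rewrite !inE; exact: leq_trans. Qed.
Lemma hS_trans i j k : (i, j) \in hS m -> (j, k) \in hS m -> (i, k) \in hS m.
Proof. by rewrite !inE /= => /eqP ->. Qed.

Lemma in_sub_delta (S : {set idx}) i j : (i, j) \in S -> in_sub S (delta_mx i j : 'M[F]_m).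
Proof. by move=> Sij k l; rewrite mxE; case: andP => [[/eqP -> /eqP ->]|]; rewrite ?eqxx. Qed.

Let inclB_delta i j : (i, j) \in bS m -> incl (bS m) (ui (bS m) (delta_mx i j)) = ug (i, j).
Proof.
move=> ij; exact: (uchi_incl_iota pcharF bc deg chi (sub_gS (bS m)) (@bS_trans) (in_sub_delta ij)).
Qed.
Let inclH_delta i : incl (hS m) (ui (hS m) (delta_mx i i)) = ug (i, i).
Proof.
have ij : (i, i) \in hS m by rewrite inE.
exact: (uchi_incl_iota pcharF bc deg chi (sub_gS (hS m)) (@hS_trans) (in_sub_delta ij)).
Qed.
Let inclB_sc k : incl (bS m) (sc (bS m) k) = sc (gS m) k.
Proof. exact: (uchi_incl_scal pcharF bc deg chi (sub_gS (bS m)) (@bS_trans) k). Qed.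
Let inclH_sc k : incl (hS m) (sc (hS m) k) = sc (gS m) k.
Proof. exact: (uchi_incl_scal pcharF bc deg chi (sub_gS (hS m)) (@hS_trans) k). Qed.
Let inclBD := @uchi_inclD F p pcharF G bc m deg chi _ _ (sub_gS (bS m)) (@bS_trans).
Let inclBM := @uchi_inclM F p pcharF G bc m deg chi _ _ (sub_gS (bS m)) (@bS_trans).
Let inclHD := @uchi_inclD F p pcharF G bc m deg chi _ _ (sub_gS (hS m)) (@hS_trans).
Let inclHM := @uchi_inclM F p pcharF G bc m deg chi _ _ (sub_gS (hS m)) (@hS_trans).

Section Ordering.
Variable delta : seq idx.
Hypotheses (delta_uniq : uniq delta) (deltaE : delta =i [pred x : idx | (x.1 < x.2)%N]).
Local Notation nilp := (@nil_elt F G m bc deg p chi).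
Let gla := uchi_gl_algebra pcharF p_gt2 bcP chiP.

Lemma nil_scal k x : nilp x -> nilp (sc (gS m) k * x).
Proof.
case=> [[n [y [hn ->]]]|[y [n [hn ->]]]].
  left; exists n, (sc (gS m) k * y); split; [exact: hn|exact: scal_mulCA].
right; exists (sc (gS m) k * y), n; split; [exact: hn|exact: mulrA].
Qed.

(** Without a witness the [xget] in [harish_chandra] would return its default value 0. *)
Lemma harish_chandra_exists (x : U) : exists h, zspan nilp (x - incl (hS m) h).
Proof.
set Q := fun x : U => exists h, zspan nilp (x - incl (hS m) h).
have incl0 : incl (hS m) 0 = 0 := additive0 inclHD.
have nilQ y : nilp y -> Q y.
  by move=> hy; exists 0; rewrite incl0 subr0; exact: zspan_gen.
have Q0 : Q 0 by exists 0; rewrite incl0 subr0; exact: zspan0.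
have QD y z : Q y -> Q z -> Q (y + z).
  move=> [h hy] [h' hz]; exists (h + h').
  have := zspanD hy hz; rewrite addrACA -opprD; congr (zspan _ (_ - _)).
  exact: esym (inclHD h h').
have QZ k y : Q y -> Q (sc (gS m) k * y).
  move=> [h hy]; exists (sc (hS m) k * h).
  have := zspan_image (mulrDr (sc (gS m) k)) (@nil_scal k) hy.
  rewrite mulrBr; congr (zspan _ (_ - _)); apply/esym.
  by apply: etrans (inclHM _ h) _; rewrite (inclH_sc k).
have Qw w : all (fun k : idx => k.1 == k.2) w -> Q (wprod ug w).
  move=> hw; suff [h ->] : exists h, wprod ug w = incl (hS m) h.
    by exists h; rewrite subrr; exact: zspan0.
  elim: w hw => [_|[i j] w IH /andP[/eqP /= <- /IH [h e]]].
    exists (sc (hS m) 1); rewrite /wprod big_nil; apply/esym; apply: etrans (inclH_sc 1) _.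
    exact: scal1.
  exists (ui (hS m) (delta_mx i i) * h); rewrite /wprod big_cons -/(wprod ug w) e.
  by apply/esym; apply: etrans (inclHM _ h) _; rewrite (inclH_delta i).
apply: (gla_triangular pcharF gla delta_uniq deltaE Q0 QD QZ Qw) => i j y ij; apply: nilQ.
- left; exists (delta_mx i j), y; split; last exact: erefl; move=> k l; rewrite mxE.
  by case: andP => [[/eqP -> /eqP ->]|]; rewrite ?eqxx.
- right; exists y, (delta_mx i j); split; last exact: erefl; move=> k l; rewrite mxE.
  by case: andP => [[/eqP -> /eqP ->]|]; rewrite ?eqxx.
Qed.

Lemma harish_chandraP (x : U) : zspan nilp (x - incl (hS m) (harish_chandra x)).
Proof. exact: xgetPex (harish_chandra_exists x). Qed.

Lemma f_elt_wprod : f_elt bc deg p chi delta =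
  harish_chandra (wprod ug (top_word p bc deg delta) * wprod ug (bot_word p bc deg delta)).
Proof.
have orderE d : d \in delta -> (unit_order p bc deg d).-1 = (pbar bc deg p d).-1.
  rewrite deltaE inE => lt; rewrite /unit_order ifF //.
  by apply/negbTE; rewrite -val_eqE ltn_eqF.
rewrite /f_elt; congr (harish_chandra (_ * _)); rewrite wprod_block.
  by apply: eq_big_seq => d /orderE <-.
rewrite big_map; apply: eq_big_seq => d /orderE e.
by rewrite /top_exp (unit_order_opp p bcP) e.
Qed.

End Ordering.

(** * The grading of u_chi(g) *)

Section Grading.

Lemma uchi_homogD a (x y : U) : uchi_homog a x -> uchi_homog a y -> uchi_homog a (x + y).
Proof.
move=> [s [hs ->]] [t [ht ->]]; exists (s + t); split; last exact: esym (upiD p bc deg chi s t).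
by move=> w /(fsubsetP (msuppD_le _ _)); rewrite in_fsetU => /orP[/hs|/ht].
Qed.

Lemma uchi_homogZ a k (x : U) : uchi_homog a x -> uchi_homog a (k *: x).
Proof.
move=> [s [hs ->]]; exists (k *: s); split; last exact: esym (upiZ p bc deg chi k s).
by move=> w /(fsubsetP (msuppZ_le _ _)) /hs.
Qed.

Lemma uchi_homog0 a : uchi_homog a (0 : U).
Proof.
exists 0; split; last exact: esym (upi0 p bc deg chi (gS m)).
by move=> w; rewrite msupp0 inE.
Qed.

Lemma uchi_homog1 : uchi_homog 0 (1 : U).
Proof.
exists << FMonom [::] >>; split; last by rewrite -fmoneE; exact: esym (upi1 p bc deg chi (gS m)).
by move=> w /(fsubsetP msuppU_le); rewrite inE => /eqP ->; rewrite /word_deg big_nil.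
Qed.

Lemma uchi_homog_ugen i j : uchi_homog (deg i - deg j) (ug (i, j)).
Proof.
have ij : (i, j) \in gS m by rewrite inE.
exists (iotaT (gS m) (delta_mx i j)); split; last exact: uiotaE.
rewrite (iotaT_delta F (exist _ (i, j) ij : unit_idx (gS m))) => w.
move/(fsubsetP msuppU_le); rewrite inE => /eqP ->.
by rewrite /word_deg fmuE big_seq1.
Qed.

Lemma uchi_homogM a b (x y : U) :
  uchi_homog a x -> uchi_homog b y -> uchi_homog (a + b) (x * y).
Proof.
move=> [s [hs ->]] [t [ht ->]]; exists (s * t); split; last exact: esym (upiM p bc deg chi s t).
move=> w /msuppM_le /= [w1 [w2 [/hs <- /ht <- ->]]].
by rewrite /word_deg fmM big_cat.
Qed.

Lemma uchi_homog_wprod w : exists a, uchi_homog a (wprod ug w).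
Proof.
elim: w => [|[i j] w [a IH]].
  by exists 0; rewrite /wprod big_nil; exact: uchi_homog1.
exists (deg i - deg j + a); rewrite /wprod big_cons.
exact: uchi_homogM (uchi_homog_ugen i j) IH.
Qed.

Lemma uchi_homog_sum (u : U) : exists c : G -> U,
  (forall g, uchi_homog g (c g)) /\ u = \sum_g c g.
Proof.
set P := fun u : U => exists c : G -> U, (forall g, uchi_homog g (c g)) /\ u = \sum_g c g.
have PD x y : P x -> P y -> P (x + y).
  move=> [c [hc ->]] [d [hd ->]]; exists (fun g => c g + d g); split; last by rewrite big_split.
  by move=> g; exact: uchi_homogD.
have PZ k x : P x -> P (k *: x).
  move=> [c [hc ->]]; exists (fun g => k *: c g); split; last exact: scaler_sumr.
  by move=> g; exact: uchi_homogZ.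
have P1 : P 1.
  exists (fun g => if g == 0 then 1 else 0); split.
    by move=> g; case: eqP => [->|_]; [exact: uchi_homog1|exact: uchi_homog0].
  by rewrite -big_mkcond big_pred1_eq.
have Pu i j x : (i, j) \in gS m -> P x -> P (ug (i, j) * x).
  (* The component of degree g of e_ij x comes from the component of x in degree g minus the degree
     of e_ij. *)
  move=> _ [c [hc ->]]; exists (fun g => ug (i, j) * c (g - (deg i - deg j))); split.
    by move=> g; rewrite -{1}(subrKC (deg i - deg j) g); exact: uchi_homogM (uchi_homog_ugen i j) _.
  rewrite mulr_sumr (reindex_inj (addIr (- (deg i - deg j)))); exact: eq_bigr.
exact: (@uchi_ind F p G bc m deg chi (gS m) P PD PZ P1 Pu u).
Qed.

End Grading.

(** * The baby Verma module of weight lambda *)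

Section Weight.
Variables (lam : {scalar 'rV[F]_m}) (W : lmodType (UU (bS m))) (v : W).
Hypothesis vP : weight_line lam v.
Let lam_ i := lam (delta_mx 0 i).
Let vB : resF W (sc (bS m)) := v.

Lemma weight_neq0 : vB <> 0. Proof. by case: vP. Qed.

Lemma weight_span (w : resF W (sc (bS m))) : exists k : F, w = k *: vB.
Proof. by case: vP => _ /(_ w) [k e] _ _; exists k; exact: e. Qed.

Lemma weight_pos (i j : 'I_m) : (i < j)%N -> umul (ui (bS m) (delta_mx i j)) vB = 0.
Proof.
case: vP => _ _ hN _ ij; apply: hN => k l; rewrite mxE.
by case: andP => [[/eqP -> /eqP ->]|]; rewrite ?eqxx.
Qed.

Lemma weight_diag i : umul (ui (bS m) (delta_mx i i)) vB = lam_ i *: vB.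
Proof.
have <- : diag_mx (delta_mx 0 i) = delta_mx i i :> 'M[F]_m.
  apply/matrixP => k l; rewrite !mxE eqxx /=.
  case: (eqVneq k i) => [->|ne]; first by rewrite eq_sym mulrb; case: (l == i).
  by rewrite mul0rn.
by case: vP => _ _ _ /(_ (delta_mx 0 i)) e; exact: e.
Qed.

(** The power relation of e_ii, evaluated at v <> 0, forces this condition, under which the model
    exists. *)
Lemma weight_power i : lam_ i ^+ p - lam_ i = chi (delta_mx i i) ^+ p.
Proof.
have ii : (i, i) \in bS m by rewrite inE /=.
have even : bc (deg i - deg i) (deg i - deg i) = 1 by rewrite subrr bc0l.
apply: (umul_eigen_power weight_neq0 (weight_diag i)).
apply: etrans (@uchi_powerE F p G bc m deg chi (bS m) _ _ (in_sub_delta ii)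
  (@mx_homog_delta F G m deg i i) even) _.
by rewrite delta_mx_exp ?eqxx ?scale1r // prime_gt1 // (pcharf_prime pcharF).
Qed.

Section Model.
Variables (T : vectType F) (T_gt0 : (0 < dim T)%N) (E : 'I_m -> 'I_m -> endo T_gt0).
Variables (vT u0 : T) (phiT : 'Hom(T, F^o)).
Hypothesis vm : verma_model p bc deg (fun i => chi (delta_mx i i)) lam_ E vT u0 phiT.
Let rep := vm_rep vm.
Local Notation R := (@rho F p G bc m deg chi T T_gt0 E).
Let RD x y : R (x + y) = R x + R y. Proof. exact: (rhoD pcharF bcP chiP rep). Qed.
Let RM x y : R (x * y) = R x * R y. Proof. exact: (rhoM pcharF bcP chiP rep). Qed.
Let Rsc k : R (sc (gS m) k) = k%:A. Proof. exact: (rho_sc pcharF bcP chiP rep). Qed.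
Let Rug k : R (ug k) = E k.1 k.2. Proof. exact: (rho_ugen pcharF bcP chiP rep). Qed.

Lemma weight_common_eigen b : common_eigen vB (fun b => R (incl (bS m) b)) vT b.
Proof.
set P := common_eigen _ _ _.
have PD x y : P x -> P y -> P (x + y).
  by apply: common_eigenD => a b'; exact: etrans (congr1 R (inclBD a b')) (RD _ _).
have PM x y : P x -> P y -> P (x * y).
  by apply: common_eigenM => a b'; exact: etrans (congr1 R (inclBM a b')) (RM _ _).
have Psc k : P (sc (bS m) k).
  by apply: common_eigen_sc => a; exact: etrans (congr1 R (inclB_sc a)) (Rsc _).
have P1 : P 1 by rewrite -(scal1 (sc (bS m))); exact: Psc.
have PZ k x : P x -> P (k *: x).
  by move=> /(PM _ _ (Psc k)); rewrite /= (uchi_scalE k x).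
have Pu i j x : (i, j) \in bS m -> P x -> P (ui (bS m) (delta_mx i j) * x).
  move=> ij; apply: PM; have e : R (incl (bS m) (ui (bS m) (delta_mx i j))) = E i j.
    exact: etrans (congr1 R (inclB_delta ij)) (Rug _).
  move: (ij); rewrite inE /= leq_eqVlt => /orP[/eqP /val_inj ji|lt].
    exists (lam_ i); rewrite e -ji (vm_wt vm); split=> //; exact: weight_diag.
  by exists 0; rewrite e (vm_hw vm) // !scale0r; split=> //; exact: weight_pos.
exact: (@uchi_ind F p G bc m deg chi (bS m) P PD PZ P1 Pu b).
Qed.

(** The coefficient of the highest weight vector in x v, computed in the model. It vanishes on N^- U
    + U N^+, hence factors through the Harish-Chandra projection. *)
Let theta (x : U) : F^o := phiT (endo_app (R x) vT).

Lemma thetaD x y : theta (x + y) = theta x + theta y.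
Proof. by rewrite /theta RD endoD lfun_add. Qed.

Lemma theta_nil x : nil_elt x -> theta x = 0.
Proof.
have Rui n : R (Defs.iota bc deg p chi (gS m) n) = gl_lin E n.
  exact: (rho_ui pcharF bcP chiP rep).
have phi0 : phiT 0 = 0 by rewrite -(scale0r 0) lfun_scale scale0r.
case=> [[n [y [hn ->]]]|[y [n [hn ->]]]]; rewrite /theta RM endoM Rui.
- rewrite endo_sum.
  elim/big_ind: _ => [|a b ha hb|i _]; rewrite ?lfun_add ?ha ?hb ?addr0 // endo_sum.
  elim/big_ind: _ => [|a b ha hb|j _]; rewrite ?lfun_add ?ha ?hb ?addr0 // endoZ lfun_scale.
  case: (eqVneq (n i j) 0) => [->|/hn ij]; first exact: scale0r.
  by rewrite (vm_phi0 vm) // scaler0.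
- have -> : endo_app (gl_lin E n) vT = 0; last by rewrite endo_zero.
  rewrite endo_sum big1 // => i _; rewrite endo_sum big1 // => j _; rewrite endoZ.
  case: (eqVneq (n i j) 0) => [->|/hn ij]; first exact: scale0r.
  by rewrite (vm_hw vm) // scaler0.
Qed.

(** The formula is proved for every element t of the tensor algebra, so the representative of h on
    which [weight_eval] is computed is of no consequence. *)
Lemma weight_evalP h : endo_app (R (incl (hS m) h)) vT = weight_eval lam h *: vT.
Proof.
pose f (k : idx) := lam (delta_mx 0 k.1).
suff ev t : endo_app (R (incl (hS m) (pi (hS m) t))) vT = free_mor idfun f t *: vT.
  by have := ev (repr h); rewrite (upi_repr h).
have RhD a b : R (incl (hS m) (a + b)) = R (incl (hS m) a) + R (incl (hS m) b).
  exact: etrans (congr1 R (inclHD a b)) (RD _ _).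
have RhM a b : R (incl (hS m) (a * b)) = R (incl (hS m) a) * R (incl (hS m) b).
  exact: etrans (congr1 R (inclHM a b)) (RM _ _).
have Rhsc k z : endo_app (R (incl (hS m) (sc (hS m) k))) z = k *: z.
  apply: etrans (congr1 (fun e => endo_app (R e) z) (inclH_sc k)) _.
  by rewrite Rsc endoZ endo1.
have scE k (x : UU (hS m)) : k *: x = sc (hS m) k * x by exact: esym (uchi_scalE k x).
move: t; apply: tensor_alg_ind => [s t hs ht|k t ht||k t ht].
- rewrite (upiD p bc deg chi s t) (RhD (pi _ s) (pi _ t)) endoD.
  apply: etrans (congr2 +%R hs ht) _; rewrite -scalerDl.
  by rewrite (free_morD idfun f).
- rewrite (upiZ p bc deg chi k t) (scE k (pi _ t)) (RhM _ (pi _ t)) endoM.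
  apply: etrans (congr1 (endo_app _) ht) _; rewrite endo_scaler.
  by apply: etrans (congr1 _ (Rhsc k vT)) _; rewrite scalerA mulrC (free_morZ idfun f).
- rewrite (upi1 p bc deg chi (hS m)); have <- := scal1 (sc (hS m)).
  by apply: etrans (Rhsc 1 vT) _; rewrite (free_mor1 (hS m) idfun).
- rewrite (upiM p bc deg chi (tvar F k) t) (RhM _ (pi _ t)) endoM.
  apply: etrans (congr1 (endo_app _) ht) _; rewrite endo_scaler.
  rewrite (free_morM (f := idfun) f); last by move=> a b; exact: mulrC.
  rewrite (free_morU idfun f) mulrC -scalerA; congr (_ *: _).
  rewrite -(iotaT_delta F k); case: k {ht} => [[i j] ij] /=.
  have /eqP ji : i == j by move: ij; rewrite inE.
  rewrite -ji; apply: etrans (vm_wt vm i); congr (endo_app _ _).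
  exact: etrans (congr1 R (inclH_delta i)) (Rug _).
Qed.

(** Every h which differs from x by an element of N^- U + U N^+ has the same value at lambda, so the
    choice made in [harish_chandra] is harmless. *)
Lemma phi_harish_chandra x h : zspan (@nil_elt F G m bc deg p chi) (x - incl (hS m) h) ->
  phiT (endo_app (R x) vT) = weight_eval lam h.
Proof.
move=> hx; have th0 : theta (x - incl (hS m) h) = 0.
  elim: hx => [y /theta_nil||y z _ hy _ hz] //; first exact: additive0 thetaD.
  by rewrite (additiveB thetaD) hy hz subrr.
rewrite (additiveB thetaD) in th0; have := subr0_eq th0; rewrite {1}/theta => ->.
rewrite /theta weight_evalP lfun_scale (vm_phi vm).
exact: mulr1.
Qed.

End Model.

Variable delta : seq idx.
Hypotheses (delta_uniq : uniq delta) (deltaE : delta =i [pred x : idx | (x.1 < x.2)%N]).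
Let gla := uchi_gl_algebra pcharF p_gt2 bcP chiP.
Local Notation Z := (@baby_verma F G m bc deg p chi W).
Let N : lmodType U := Z.
Let vN : resF N (sc (gS m)) := tens (incl (bS m)) 1 v.
Local Notation X := (gen_act (sc (gS m)) ug N).
Let top := wprod ug (top_word p bc deg delta).
Let bot := wprod ug (bot_word p bc deg delta).
Let Fv := umul bot vN.

Lemma graded_simple_weight_eval d :
  graded_simple (@baby_verma_gr F G m bc deg p chi W d) <->
  weight_eval lam (f_elt bc deg p chi delta) != 0.
Proof.
have hwN (i j : 'I_m) : (i < j)%N -> X (i, j) vN = 0.
  move=> ij; have ijb : (i, j) \in bS m by rewrite inE ltnW.
  have e : umul (ui (bS m) (delta_mx i j)) vB = 0 *: vB by rewrite scale0r; exact: weight_pos.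
  have := tens_eigen inclB_sc e; rewrite (inclB_delta ijb) scale0r; exact.
have wtN i : X (i, i) vN = lam_ i *: vN.
  have iib : (i, i) \in bS m by rewrite inE /=.
  have := tens_eigen inclB_sc (weight_diag i); rewrite (inclB_delta iib); exact.
have genN (z : resF N (sc (gS m))) : exists u, z = umul u vN.
  exact: (tens_generated inclB_sc weight_span z).
have [T [T_gt0 [E [vT [u0 [phiT vm]]]]]] :=
  verma_model_exists pcharF p_gt2 bcP deg (c := fun i => chi (delta_mx i i)) weight_power.
have rep := vm_rep vm.
have [Psi [Psi_u Psi_v]] := verma_map weight_neq0 weight_span
  (rhoD pcharF bcP chiP rep) (rhoM pcharF bcP chiP rep) (rho_sc pcharF bcP chiP rep)
  (rho1 pcharF bcP chiP rep) (weight_common_eigen vm).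
have Psi_g k z : Psi (X k z) = model_act E k (Psi z).
  by apply: etrans (Psi_u (ug k) z) _; rewrite (rho_ugen pcharF bcP chiP rep).
pose topw := top_word p bc deg delta.
pose botv := bot_vec p bc deg delta X vN.
have botvE : botv = Fv := act_wprod _ _ _.
have EFu : act X topw botv = umul (top * bot) vN.
  apply: etrans (act_wprod _ _ _) _; apply: etrans (congr1 (umul top) botvE) _.
  exact: esym (umulM top bot vN).
have fE : phiT (Psi (act X topw botv)) = weight_eval lam (f_elt bc deg p chi delta).
  apply: etrans (congr1 (fun z => phiT (Psi z)) EFu) _.
  apply: etrans (congr1 phiT (etrans (Psi_u (top * bot) vN) (congr1 _ Psi_v))) _.
  apply: etrans (phi_harish_chandra vm (harish_chandraP delta_uniq deltaE (top * bot))) _.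
  by rewrite (f_elt_wprod deltaE).
have EF : act X topw botv = weight_eval lam (f_elt bc deg p chi delta) *: vN.
  apply: etrans (top_Fv pcharF bcP delta_uniq deltaE vm gla hwN wtN Psi_v) _.
  exact: (congr1 (fun k : F => k *: vN) fE).
have vN0 : vN != 0.
  apply: contraTneq (oner_neq0 F) => vN0.
  have := vm_phi vm; rewrite -Psi_v -/vN vN0 linear0.
  by rewrite -(scale0r 0) lfun_scale scale0r => <-; rewrite eqxx.
split=> [[_ simple]|f0].
  apply/negP => /eqP f0; have EF0 : act X topw botv = 0 by rewrite EF f0 scale0r.
  (* The submodule generated by F v: it contains F v <> 0 but, since e F v = 0, it does not contain
     v. *)
  pose M (z : Z) := exists u : U, (z : resF N (sc (gS m))) = umul u Fv.
  have subM : graded_submodule (@baby_verma_gr F G m bc deg p chi W d) M.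
    split=> [|x y [u ->] [u' ->]|u x [u' ->]|x [u ->]].
    - by exists 0; rewrite umul0.
    - by exists (u + u'); rewrite umulD.
    - by exists (u * u'); exact: (esym (umulM u u' Fv)).
    have [b hb] := uchi_homog_wprod (bot_word p bc deg delta).
    have [c [hc ->]] := uchi_homog_sum u.
    (* As v has degree d and the product of the f_delta powers has degree b, the part of u F v in
       degree g comes from that of u in degree g - d - b. *)
    exists (fun g => umul (c (g - d - b)) Fv); split=> [g|].
      split; last by apply: (ex_intro _ (c (g - d - b))); exact: erefl.
      apply: zspan_gen; exists (c (g - d - b) * bot), v; split.
        have h := uchi_homogM (hc (g - d - b)) hb; rewrite (subrK b (g - d)) in h; exact: h.
      apply: etrans (congr1 (umul _) (tens_umul (sc (gS m)) (incl (bS m)) bot 1 v)) _.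
      by rewrite mulr1; exact: tens_umul.
    have inj : injective (fun g => g - d - b) by move=> g h /addIr /addIr.
    have sumFv : umul (\sum_g c g) Fv = \sum_g umul (c g) Fv.
      apply: (big_ind2 (fun x z => umul x Fv = z)) => [|y ? z ? <- <-|g _].
      - exact: umul0.
      - exact: umulD.
      - exact: erefl.
    apply: (etrans sumFv); exact: (@reindex_inj _ _ _ _ _ xpredT (fun g => umul (c g) Fv) inj).
  have [M0|M1] := simple M subM.
    have := Fv_neq0 pcharF p_gt2 bcP delta_uniq deltaE vm Psi_g Psi_v.
    move/eqP; case; apply: (etrans botvE); apply: M0; apply: (ex_intro _ 1).
    exact: (esym (umul1 Fv)).
  have [u e] := M1 vN.
  apply: (v_notin_UFv pcharF bcP delta_uniq deltaE vm gla hwN wtN Psi_g Psi_v EF0 (u := u)).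
  exact: (etrans (congr1 (umul u) botvE) (esym e)).
have EF0 : act X topw botv <> 0.
  by move/eqP; rewrite EF scaler_eq0 (negbTE f0) (negbTE vN0).
split; first by exists vN; apply/eqP.
move=> M [_ MD MU _]; case: (pselect (exists2 z : Z, M z & z <> 0)) => [[z Mz /eqP z0]|none].
  right; exact: (submodule_full pcharF p_gt2 bcP delta_uniq deltaE vm gla hwN wtN genN Psi_g Psi_v
    (M := M) MD MU EF0 z0 Mz).
by left=> z Mz; apply: contrapT => z0; apply: none; exists z.
Qed.

End Weight.

End BabyVerma.

Theorem corollary4p3 (F : closedFieldType) (p : nat)
    (pcharF : p \in [pchar F]) (p_gt3 : (3 < p)%N)
    (G : finZmodType) (bc : G -> G -> F) (bcP : bicharacter bc)
    (leG : rel G) (leG_anti : antisymmetric leG) (leG_trans : transitive leG)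
    (leG_total : total leG)
    (m : nat) (deg : 'I_m -> G)
    (deg_homo : forall i j : 'I_m, (i <= j)%N -> leG (deg i) (deg j))
    (chi : {scalar 'M[F]_m}) (chiP : standard_semisimple deg chi)
    (delta : seq ('I_m * 'I_m)) (deltaP : fp_triple F delta)
    (lam : {scalar 'rV[F]_m})
    (W : lmodType (uchi bc deg p chi (bS m))) (v : W) (vP : weight_line lam v)
    (d : G) :
  graded_simple (@baby_verma_gr F G m bc deg p chi W d) <->
  weight_eval lam (f_elt bc deg p chi delta) != 0.
Proof.
have [delta_uniq setE _] := deltaP.
have deltaE : delta =i [pred x : 'I_m * 'I_m | (x.1 < x.2)%N].
  by move=> x; move/setP/(_ x): setE; rewrite !inE.
have p_gt2 : (2 < p)%N by exact: ltnW.
exact: (graded_simple_weight_eval pcharF p_gt2 bcP chiP vP delta_uniq deltaE d).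
Qed.
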